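(* For every $n\ge1$, $[\mathrm{VAL}_n]=[\mathrm{SAT}_n]\cap[\overline{\mathrm{SAT}}_n]$.
   Context: $\Sigma=\{0,1\}$, $\Sigma^*$ the finite nonempty binary strings; for $x\in\Sigma^m$, $\pi_1(x)=x_1$. $\mathbb{P}_+\Sigma=\{\{0\},\{1\},\Sigma\}$. A promise problem is $\phi:\Sigma^*\to\mathbb{P}_+\Sigma$; a problem $\psi:\Sigma^*\to\Sigma$ is identified with $x\mapsto\{\psi(x)\}$. $\phi_1\propto\phi_2$ means there is a polynomial-time computable $\mu:\Sigma^*\to\Sigma^*$ with $\phi_1(x)\supseteq\phi_2(\mu(x))$ for all $x$; $[\phi]=\{\phi_1:\phi_1\propto\phi\}$. Level-$n$ problems: the input encodes (e.g. dimensions in binary plus a Boolean formula) $f:\Sigma^{m_1}\times\dots\times\Sigma^{m_n}\to\Sigma$, written $f(x,y^{(1)},\dots,y^{(n-1)})$ with $x\in\Sigma^{m_1}$; $f_x$ is $f$ with $x$ fixed. For a constant $c$, $\mathrm{SAT}_0(c)=\overline{\mathrm{SAT}}_0(c)=c$; for $n\ge1$, $\mathrm{SAT}_n(f)=1\iff\exists x:\overline{\mathrm{SAT}}_{n-1}(f_x)=1$, $\overline{\mathrm{SAT}}_n(f)=1\iff\forall x,\ \mathrm{SAT}_{n-1}(f_x)=1$, and $\mathrm{VAL}_n(f)=\{\pi_1x:\overline{\mathrm{SAT}}_{n-1}(f_x)=1\}$ if $\mathrm{SAT}_n(f)=1$, and $\Sigma$ otherwise. *)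

(* Defs.v *)
From mathcomp Require Import all_boot.
Set Implicit Arguments. Unset Strict Implicit. Unset Printing Implicit Defensive.

(* A nonempty string is represented as (first bit, remaining bits). *)
Definition str := (bool * seq bool)%type.
Definition tostr (s : str) : seq bool := s.1 :: s.2.

(* P_+ Sigma = nonempty subsets of {0,1}; we use {set bool} and require
   nonemptiness explicitly where promise problems are quantified over. *)
Definition promise_problem (phi : str -> {set bool}) : Prop :=
  forall x, phi x != set0.

(* Tape symbols: Some b (a bit) or None (blank).  States are 0..Q-1,
   0 is the start state, 1 is the (absorbing) halting state. *)
Inductive dir := DL | DR | DS.

Record TM := {
  tm_Q : nat;
  tm_delta : nat -> option bool -> (nat * option bool * dir)
}.

Definition tm_wf (M : TM) : Prop :=
  2 <= tm_Q M /\ forall q s, q < tm_Q M -> (tm_delta M q s).1.1 < tm_Q M.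

(* configuration: state, left part (nearest cell first), head cell, right part *)
Record config := Cfg {
  c_state : nat; c_left : seq (option bool); c_head : option bool;
  c_right : seq (option bool) }.

Definition tm_step (M : TM) (c : config) : config :=
  if c_state c == 1 then c else
  let: (q', w, d) := tm_delta M (c_state c) (c_head c) in
  match d with
  | DL => match c_left c with
          | [::] => Cfg q' [::] None (w :: c_right c)
          | a :: l => Cfg q' l a (w :: c_right c)
          end
  | DR => match c_right c with
          | [::] => Cfg q' (w :: c_left c) None [::]
          | a :: r => Cfg q' (w :: c_left c) a r
          end
  | DS => Cfg q' (c_left c) w (c_right c)
  end.

Definition tm_init (x : seq bool) : config :=
  match x with
  | [::] => Cfg 0 [::] None [::]
  | b :: r => Cfg 0 [::] (Some b) (map Some r)
  end.

Definition tm_run (M : TM) (t : nat) (x : seq bool) : config :=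
  iter t (tm_step M) (tm_init x).

Fixpoint read_out (s : seq (option bool)) : seq bool :=
  match s with
  | Some b :: s' => b :: read_out s'
  | _ => [::]
  end.

Definition tm_output (c : config) : seq bool := read_out (c_head c :: c_right c).

Definition polytime (mu : str -> str) : Prop :=
  exists M : TM, tm_wf M /\
  exists k c : nat, forall x : str,
    exists t, t <= c * (size (tostr x)) ^ k + c /\
      c_state (tm_run M t (tostr x)) = 1 /\
      tm_output (tm_run M t (tostr x)) = tostr (mu x).

Definition reduces (phi1 phi2 : str -> {set bool}) : Prop :=
  exists mu : str -> str, polytime mu /\
    forall x, phi2 (mu x) \subset phi1 x.

Inductive form :=
| FVar of nat | FTrue | FNot of form | FAnd of form & form | FOr of form & form.

(* variables are numbered 0,1,2,... along the concatenation x ++ y1 ++ ... ;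
   out-of-range variables read as 0 *)
Fixpoint evalf (a : seq bool) (F : form) : bool :=
  match F with
  | FVar i => nth false a i
  | FTrue => true
  | FNot f => ~~ evalf a f
  | FAnd f g => evalf a f && evalf a g
  | FOr f g => evalf a f || evalf a g
  end.

(* The string is cut into 3-bit tokens:
   0,1 = binary digits, 2 = '#' (end of number), 3 = VAR (followed by a
   binary index terminated by '#'), 4 = NOT, 5 = AND, 6 = OR, 7 = TRUE.
   An instance is: m_1 # m_2 # ... m_n # (binary, msb first) followed by a
   formula in prefix notation, consuming the whole string. *)
Fixpoint chunks (s : seq bool) : option (seq nat) :=
  match s with
  | [::] => Some [::]
  | a :: b :: c :: r =>
      match chunks r with
      | Some t => Some ((4 * a + 2 * b + c)%N :: t)
      | None => None
      end
  | _ => None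
  end.

Fixpoint parse_num (acc : nat) (t : seq nat) : option (nat * seq nat) :=
  match t with
  | 0 :: r => parse_num (2 * acc) r
  | 1 :: r => parse_num (2 * acc + 1) r
  | 2 :: r => Some (acc, r)
  | _ => None
  end.

Fixpoint parse_nums (k : nat) (t : seq nat) : option (seq nat * seq nat) :=
  match k with
  | 0 => Some ([::], t)
  | k'.+1 =>
      match parse_num 0 t with
      | Some (m, r) =>
          match parse_nums k' r with
          | Some (ds, r') => Some (m :: ds, r')
          | None => None
          end
      | None => None
      end
  end.

Fixpoint parse_form (fuel : nat) (t : seq nat) : option (form * seq nat) :=
  match fuel with
  | 0 => None
  | fuel'.+1 =>
      match t with
      | 3 :: r => match parse_num 0 r with
                  | Some (i, r') => Some (FVar i, r')
                  | None => None end
      | 4 :: r => match parse_form fuel' r with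
                  | Some (f, r') => Some (FNot f, r')
                  | None => None end
      | 5 :: r => match parse_form fuel' r with
                  | Some (f, r1) => match parse_form fuel' r1 with
                                    | Some (g, r2) => Some (FAnd f g, r2)
                                    | None => None end
                  | None => None end
      | 6 :: r => match parse_form fuel' r with
                  | Some (f, r1) => match parse_form fuel' r1 with
                                    | Some (g, r2) => Some (FOr f g, r2)
                                    | None => None end
                  | None => None end
      | 7 :: r => Some (FTrue, r)
      | _ => None
      end
  end.

(* invalid encodings denote the constant-0 function with all dimensions 1 *)
Definition default_inst (n : nat) : seq nat * form := (nseq n 1, FNot FTrue).

Definition decode (n : nat) (s : seq bool) : seq nat * form :=
  match chunks s with
  | Some t =>
      match parse_nums n t with
      | Some (ds, r) =>
          match parse_form (size r) r with
          | Some (F, [::]) => if all (fun m => 0 < m) ds then (ds, F)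
                              else default_inst n
          | _ => default_inst n
          end
      | None => default_inst n
      end
  | None => default_inst n
  end.

(* qsat F ex ds pre: with the already fixed arguments pre, the alternating
   quantifier prefix (starting with exists if ex, forall otherwise) over the
   remaining blocks of sizes ds.  qsat F true ds [::] = SAT_n(f),
   qsat F false ds [::] = coSAT_n(f); with ds = [::] it is the constant f. *)
Fixpoint qsat (F : form) (ex : bool) (ds : seq nat) (pre : seq bool) : bool :=
  match ds with
  | [::] => evalf pre F
  | m :: ds' =>
      if ex then [exists x : m.-tuple bool, qsat F (~~ ex) ds' (pre ++ x)]
      else [forall x : m.-tuple bool, qsat F (~~ ex) ds' (pre ++ x)]
  end.

Definition SATn (n : nat) (s : str) : {set bool} :=
  let: (ds, F) := decode n (tostr s) in [set qsat F true ds [::]].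

Definition coSATn (n : nat) (s : str) : {set bool} :=
  let: (ds, F) := decode n (tostr s) in [set qsat F false ds [::]].

Definition VALn (n : nat) (s : str) : {set bool} :=
  let: (ds, F) := decode n (tostr s) in
  match ds with
  | m :: ds' =>
      if qsat F true ds [::] then
        [set b : bool | [exists x : m.-tuple bool,
                           (head false x == b) && qsat F false ds' x]]
      else setT
  | [::] => setT
  end.

(* Main.v *)
(* VAL_n reduces to SAT_n by f |-> x_1 /\ f and to coSAT_n by
   f |-> ~ (~ x_1 /\ f).  Conversely, let phi reduce to SAT_n by s |-> f1 and
   to coSAT_n by s |-> f2, and put F(b x', ...) := if b then f1(x', ...) else
   ~ f2(x', ...).  A witness of F that starts with 1 shows SAT_n(f1) = 1, one
   that starts with 0 shows coSAT_n(f2) = 0, and if F has no witness then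
   SAT_n(f1) = 0 and coSAT_n(f2) = 1, so that both values are allowed for phi.

   The blocks of F must contain those of f1 and f2, which may be exponentially
   large.  If all numbers in f1 and f2 have at most K binary digits, block i of
   F gets 2^(i+K+1) variables, and the variable at offset o of block i of f1 or
   f2 gets the index with binary digits 1^(i+1) followed by the K digits of o;
   block and offset are found by subtracting the block sizes in turn.

   Polynomial-time computability is obtained from programs on finitely many
   stacks of bits, which are interleaved on the tape of a Turing machine. *)
From Stdlib Require Import ZArith Ring.
Require Import Defs.
From mathcomp Require Import all_boot.
From mathcomp Require Import zify.
Set Implicit Arguments. Unset Strict Implicit. Unset Printing Implicit Defensive.

(** * Structured tape programs *)

(** The sizes [2^(i+K+1)] serve three purposes. A one followed by zeros is a short description of an
    exponentially large block. The blocks before block i have total size [(2^i - 1) * 2^(K+1)], so a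
    variable put at position [2^K + o] of its block has the index [(2^(i+1) - 1) * 2^K + o]; these
    are the announced digits, and they can be written down once the block is located, without any
    addition or multiplication. And the offset [2^K] keeps position 0 of the first block free for
    the selector b. The given reductions are known only through Turing machines, which may leave
    debris on their tapes. Stack programs therefore run them step by step through an interpreter,
    instead of composing machines. Invalid encodings need care only when two instances are combined.
    When a literal is inserted into one instance they can be ignored: [VAL_n] then allows both
    values, hence so does phi, and any image will do. *)

Definition tape := Z -> option bool.

Definition upd (T : tape) (p : Z) (v : option bool) : tape :=
  fun z => if Z.eqb z p then v else T z.

Definition dirZ (d : dir) : Z :=
  match d with DL => (-1)%Z | DR => 1%Z | DS => 0%Z end.

Inductive lcmd :=
| LSkip
| LAct of (option bool -> option bool * dir)
| LSeq of lcmd & lcmd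
| LIf of (option bool -> bool) & lcmd & lcmd
| LWhile of (option bool -> bool) & lcmd.

(* The last index is the number of steps of the compiled Turing machine. *)
Inductive lexec : lcmd -> tape -> Z -> tape -> Z -> nat -> Prop :=
| LE_skip T p : lexec LSkip T p T p 0
| LE_act f T p T' p' : T' =1 upd T p (f (T p)).1 ->
    p' = (p + dirZ (f (T p)).2)%Z -> lexec (LAct f) T p T' p' 1
| LE_seq c d T p T1 p1 T2 p2 t1 t2 :
    lexec c T p T1 p1 t1 -> lexec d T1 p1 T2 p2 t2 ->
    lexec (LSeq c d) T p T2 p2 (t1 + t2)
| LE_ift (P : option bool -> bool) c d T p T' p' t : P (T p) -> lexec c T p T' p' t ->
    lexec (LIf P c d) T p T' p' t.+2
| LE_iff (P : option bool -> bool) c d T p T' p' t : ~~ P (T p) -> lexec d T p T' p' t ->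
    lexec (LIf P c d) T p T' p' t.+1
| LE_whilef (P : option bool -> bool) c T p : ~~ P (T p) -> lexec (LWhile P c) T p T p 1
| LE_whilet (P : option bool -> bool) c T p T1 p1 T2 p2 t1 t2 : P (T p) -> lexec c T p T1 p1 t1 ->
    lexec (LWhile P c) T1 p1 T2 p2 t2 ->
    lexec (LWhile P c) T p T2 p2 (t1 + t2).+2.

Definition instr := option bool -> nat * option bool * dir.

Fixpoint lsize (c : lcmd) : nat :=
  match c with
  | LSkip => 0
  | LAct _ => 1
  | LSeq c d => lsize c + lsize d
  | LIf _ c d => (lsize c + lsize d).+2
  | LWhile _ c => (lsize c).+2
  end.

Definition goto (q : nat) : instr := fun s => (q, s, DS).

(* Code placed at address [b]; control leaves it at address [b + lsize c]. *)
Fixpoint lcompile (c : lcmd) (b : nat) : seq instr :=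
  match c with
  | LSkip => [::]
  | LAct f => [:: fun s => (b.+1, (f s).1, (f s).2)]
  | LSeq c d => lcompile c b ++ lcompile d (b + lsize c)
  | LIf P c d =>
      (fun s => (if P s then b.+1 else (b + lsize c).+2, s, DS))
      :: lcompile c b.+1
      ++ goto (b + (lsize c + lsize d).+2) :: lcompile d (b + lsize c).+2
  | LWhile P c =>
      (fun s => (if P s then b.+1 else b + (lsize c).+2, s, DS))
      :: rcons (lcompile c b.+1) (goto b)
  end.

Lemma size_lcompile c b : size (lcompile c b) = lsize c.
Proof.
elim: c b => //= [c IHc d IHd|P c IHc d IHd|P c IHc] b.
- by rewrite size_cat IHc IHd.
- by rewrite size_cat /= IHc IHd; lia.
- by rewrite size_rcons IHc.
Qed.

(** Needed for [machine_wf]: every jump of a structured program stays inside the program or goes to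
    its exit. *)
Lemma lcompile_target c b i s :
  i < lsize c -> (nth (goto 1) (lcompile c b) i s).1.1 <= b + lsize c.
Proof.
elim: c b i => //= [f|c IHc d IHd|P c IHc d IHd|P c IHc] b i.
- by case: i => //= _; lia.
- move=> lti; rewrite nth_cat size_lcompile; case: ltnP => h.
    by have := IHc b i h; lia.
  by have := IHd (b + lsize c) (i - lsize c); lia.
- case: i => [|i] lti /=; first by case: ifP => _; lia.
  rewrite nth_cat size_lcompile; case: ltnP => h.
    by have := IHc b.+1 i h; lia.
  case E: (i - lsize c) => [|j] //=.
  by have := IHd (b + lsize c).+2 j; lia.
- case: i => [|i] lti /=; first by case: ifP => _; lia.
  rewrite nth_rcons size_lcompile; case: ltnP => h.
    by have := IHc b.+1 i h; lia.
  by case: eqP => // _ /=; lia.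
Qed.

(** Reading the two lists with a blank as default makes trailing blanks immaterial, and absolute
    integer positions turn head moves into additions. *)
Definition on_tape (cf : config) (q : nat) (T : tape) (p : Z) : Prop :=
  [/\ c_state cf = q, c_head cf = T p,
      forall j, nth None (c_left cf) j = T (p - 1 - Z.of_nat j)%Z
    & forall j, nth None (c_right cf) j = T (p + 1 + Z.of_nat j)%Z].

(** State 1 is absorbing, so a step follows [tm_delta] only in other states. The new tape is given
    up to pointwise equality, which avoids functional extensionality. *)
Lemma on_tape_step M cf q T p T' p' q' w d :
  on_tape cf q T p -> q != 1 -> tm_delta M q (T p) = (q', w, d) ->
  T' =1 upd T p w -> p' = (p + dirZ d)%Z -> on_tape (tm_step M cf) q' T' p'.
Proof.
case: cf => q0 l h r [/= -> hh hl hr] q1 hd eT ->.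
rewrite /tm_step /= (negbTE q1) hh hd.
have far z : z <> p -> T' z = T z.
  by move=> zp; rewrite eT /upd; case: Z.eqb_spec.
have near z : z = p -> T' z = w.
  by move=> ->; rewrite eT /upd Z.eqb_refl.
case: d {hd} => /=; split=> //=.
- by case: l hl.
- case: l hl => [|a l] hl //=; rewrite far; try lia.
    by have := hl 0; rewrite /= => ->; congr T; lia.
  by have := hl 0; rewrite /= => ->; congr T; lia.
- case: l hl => [|a l] hl j /=; rewrite far; try lia.
    by have := hl j.+1; rewrite !nth_nil /= => ->; congr T; lia.
  by have := hl j.+1; rewrite /= => ->; congr T; lia.
- by case: l hl => [|a l] hl [|j] /=;
    [rewrite near // | rewrite far ?hr | rewrite near // | rewrite far ?hr];
    try lia; congr T; lia.
- by case: r hr.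
- case: r hr => [|a r] hr //=; rewrite far; try lia.
    by have := hr 0; rewrite /= => ->; congr T; lia.
  by have := hr 0; rewrite /= => ->; congr T; lia.
- by case: r hr => [|a r] hr [|j] /=;
    [rewrite near // | rewrite far ?hl | rewrite near // | rewrite far ?hl];
    try lia; congr T; lia.
- case: r hr => [|a r] hr j /=; rewrite far; try lia.
    by have := hr j.+1; rewrite !nth_nil /= => ->; congr T; lia.
  by have := hr j.+1; rewrite /= => ->; congr T; lia.
- by rewrite near //; lia.
- by move=> j; rewrite hl far; try lia; congr T; lia.
- by move=> j; rewrite hr far; try lia; congr T; lia.
Qed.

Definition code_at (M : TM) (b : nat) (l : seq instr) : Prop :=
  forall i s, i < size l -> tm_delta M (b + i) s = nth (goto 1) l i s.

Lemma code_at_cat M b l1 l2 :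
  code_at M b (l1 ++ l2) -> code_at M b l1 /\ code_at M (b + size l1) l2.
Proof.
move=> h; split=> i s hi.
  by rewrite h ?size_cat ?nth_cat ?hi //; lia.
by rewrite -addnA h ?size_cat ?nth_cat; last lia; case: ltnP; try lia; rewrite addKn.
Qed.

Lemma code_at_cons M b x l :
  code_at M b (x :: l) -> (forall s, tm_delta M b s = x s) /\ code_at M b.+1 l.
Proof.
move=> h; split=> [s|i s hi]; first by have := h 0 s isT; rewrite addn0.
by have := h i.+1 s hi; rewrite addnS.
Qed.

Lemma upd_id T p : T =1 upd T p (T p).
Proof. by move=> z; rewrite /upd; case: Z.eqb_spec => [->|]. Qed.

Lemma on_tape_goto M cf b T p q' :
  1 < b -> on_tape cf b T p -> tm_delta M b (T p) = (q', T p, DS) ->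
  on_tape (tm_step M cf) q' T p.
Proof.
move=> b1 h hd; apply: (on_tape_step h _ hd); first by lia.
  exact: upd_id.
by rewrite Z.add_0_r.
Qed.

(** Induction on the run rather than on the program: a loop returns to its own address with the same
    code in place. Addresses exceed 1 because states 0 and 1 are reserved. *)
Lemma lcompile_sound c T p T' p' t :
  lexec c T p T' p' t ->
  forall M b cf, 1 < b -> code_at M b (lcompile c b) -> on_tape cf b T p ->
  on_tape (iter t (tm_step M) cf) (b + lsize c) T' p'.
Proof.
elim=> {c T p T' p' t} /=.
- by move=> T p M b cf _ _; rewrite addn0.
- move=> f T p T' p' eT ep M b cf b1 /code_at_cons[hd _] h.
  by rewrite addn1; apply: (on_tape_step h _ (hd _)) => //; lia.
- move=> c d T p T1 p1 T2 p2 t1 t2 _ IH1 _ IH2 M b cf b1 /code_at_cat[h1 h2] h.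
  rewrite addnC iterD addnA; apply: IH2; first lia.
    by rewrite size_lcompile in h2.
  exact: IH1.
- move=> P c d T p T' p' t hP _ IH M b cf b1 /code_at_cons[hd].
  move=> /code_at_cat[h1 /code_at_cons[h2 _]] h.
  have := on_tape_goto b1 h (hd _); rewrite hP => s1.
  have := IH M b.+1 _ (ltnW b1) h1 s1; rewrite -iterSr => s2.
  rewrite size_lcompile in h2.
  by apply: (on_tape_goto _ s2); [lia | rewrite h2].
- move=> P c d T p T' p' t hP _ IH M b cf b1 /code_at_cons[hd].
  move=> /code_at_cat[_ /code_at_cons[_ h2]] h.
  have := on_tape_goto b1 h (hd _); rewrite (negbTE hP) => s1.
  rewrite size_lcompile addSn in h2.
  have := IH M _ _ _ h2 s1; rewrite -iterSr.
  have -> : (b + lsize c).+2 + lsize d = b + (lsize c + lsize d).+2 by lia.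
  by apply; lia.
- move=> P c T p hP M b cf b1 /code_at_cons[hd _] h.
  by have := on_tape_goto b1 h (hd _); rewrite (negbTE hP).
- move=> P c T p T1 p1 T2 p2 t1 t2 hP _ IH1 _ IH2 M b cf b1 hc h.
  move: (hc); rewrite -cats1 => /code_at_cons[hd /code_at_cat[h1 /code_at_cons[h2 _]]].
  have := on_tape_goto b1 h (hd _); rewrite hP => s1.
  have := IH1 M b.+1 _ (ltnW b1) h1 s1; rewrite -iterSr => s2.
  rewrite size_lcompile in h2.
  have s3 : on_tape (iter t1.+2 (tm_step M) cf) b T1 p1.
    by rewrite iterS; apply: (on_tape_goto _ s2); [lia | rewrite h2].
  have := IH2 M b _ b1 hc s3; rewrite -iterD.
  by have -> : t2 + t1.+2 = (t1 + t2).+2 by lia.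
Qed.

(** State 0 only jumps to the code at address 2. The exit address [lsize c + 2] lies beyond the
    list, where the default instruction [goto 1] halts; these two jumps are the extra steps in
    [machine_sound]. *)
Definition machine (c : lcmd) : TM :=
  {| tm_Q := lsize c + 3;
     tm_delta := fun q s =>
       if q == 0 then (2, s, DS) else nth (goto 1) (lcompile c 2) (q - 2) s |}.

Lemma machine_wf c : tm_wf (machine c).
Proof.
split=> [|q s hq] /=; first by lia.
case: eqP => [|_] /=; first by lia.
case: (ltnP (q - 2) (lsize c)) => h; first by have := lcompile_target 2 s h; lia.
by rewrite nth_default ?size_lcompile //=; lia.
Qed.

Lemma machine_sound c T p T' p' t cf :
  lexec c T p T' p' t -> on_tape cf 0 T p ->
  on_tape (iter t.+2 (tm_step (machine c)) cf) 1 T' p'.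
Proof.
move=> ex h.
have s1 : on_tape (tm_step (machine c) cf) 2 T p.
  apply: (on_tape_step h) => //; first exact: upd_id.
  by rewrite Z.add_0_r.
have hc : code_at (machine c) 2 (lcompile c 2).
  by move=> i s hi; rewrite /= addKn.
have := lcompile_sound ex (isT : 1 < 2) hc s1; rewrite -iterSr => s2.
rewrite iterS; apply: (on_tape_goto _ s2); first by lia.
by rewrite /= addKn nth_default ?size_lcompile.
Qed.

(** * Stack programs *)

(** A test pops the bit that it inspects, so there is no separate pop. In [Case i c c0 c1] the
    program [c] is for the empty stack. *)
Inductive cmd :=
| Skip
| Push of nat & bool
| Seq of cmd & cmd
| Case of nat & cmd & cmd & cmd
| While of nat & cmd & cmd.

Definition store := seq (seq bool).
Definition get (s : store) (i : nat) : seq bool := nth [::] s i.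
Definition put (s : store) (i : nat) (v : seq bool) : store := set_nth [::] s i v.

Inductive exec : cmd -> store -> store -> nat -> Prop :=
| E_skip s : exec Skip s s 0
| E_push i b s : exec (Push i b) s (put s i (b :: get s i)) 1
| E_seq c d s s1 s2 t1 t2 :
    exec c s s1 t1 -> exec d s1 s2 t2 -> exec (Seq c d) s s2 (t1 + t2)
| E_case0 i c c0 c1 s s' t :
    get s i = [::] -> exec c s s' t -> exec (Case i c c0 c1) s s' t.+1
| E_case1 i c c0 c1 s b r s' t :
    get s i = b :: r -> exec (if b then c1 else c0) (put s i r) s' t ->
    exec (Case i c c0 c1) s s' t.+1
| E_while0 i c0 c1 s : get s i = [::] -> exec (While i c0 c1) s s 1
| E_while1 i c0 c1 s b r s1 s2 t1 t2 :
    get s i = b :: r -> exec (if b then c1 else c0) (put s i r) s1 t1 ->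
    exec (While i c0 c1) s1 s2 t2 -> exec (While i c0 c1) s s2 (t1 + t2).+1.

Lemma get_put s i v j : get (put s i v) j = if j == i then v else get s j.
Proof. by rewrite /get /put nth_set_nth. Qed.

(** A unit of cost pushes at most one bit. Time bounds thus double as size bounds, which is how the
    lengths of intermediate results are estimated later. *)
Lemma exec_grow c s s' t i : exec c s s' t -> size (get s' i) <= size (get s i) + t.
Proof.
elim=> {c s s' t}.
- by move=> s; rewrite addn0.
- by move=> j b s; rewrite get_put; case: eqP => [->|_] /=; lia.
- by move=> c d s s1 s2 t1 t2 _ IH1 _ IH2; lia.
- by move=> j c c0 c1 s s' t _ _ IH; lia.
- move=> j c c0 c1 s b r s' t e _; rewrite get_put.
  by case: eqP => [->|_]; rewrite ?e /=; lia.
- by move=> *; lia.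
- move=> j c0 c1 s b r s1 s2 t1 t2 e _; rewrite get_put.
  by case: eqP => [->|_] IH1 _ IH2; rewrite ?e /=; lia.
Qed.

(** * Layout of the stacks on a tape and compilation of stack programs *)

Section Layout.
Variable k : nat.

(* Stack 0 occupies the cells 0, 1, 2, ...; the stacks 1..k are interleaved on
   the negative side, and the k cells left of 0 always stay blank, so that the
   bottom of each stack is preceded by a blank cell. *)
Definition base (i : nat) : Z :=
  if i == 0 then 0%Z else (- Z.of_nat k - Z.of_nat i)%Z.
Definition stride (i : nat) : Z := if i == 0 then 1%Z else (- Z.of_nat k)%Z.
Definition cell (i j : nat) : Z := (base i + stride i * Z.of_nat j)%Z.
Definition gap (i : nat) : Z := (base i - stride i)%Z.

(** Stack 0 and the others lie on opposite sides of the tape; the stacks 1 to k are told apart by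
    residues modulo k. *)
Lemma cell_inj i j i' j' :
  i <= k -> i' <= k -> cell i j = cell i' j' -> i = i' /\ j = j'.
Proof.
rewrite /cell /base /stride; case: eqP => hi; case: eqP => hi' ik ik'; try nia.
move=> h.
have h' : (Z.of_nat k * (Z.of_nat j - Z.of_nat j') = Z.of_nat i' - Z.of_nat i)%Z by lia.
have ej : j = j'.
  have [hj|[//|hj]] : j < j' \/ j = j' \/ j' < j by lia.
    have h3 : (Z.of_nat k * (Z.of_nat j' - Z.of_nat j) >= Z.of_nat k * 1)%Z by nia.
    by lia.
  have h3 : (Z.of_nat k * (Z.of_nat j - Z.of_nat j') >= Z.of_nat k * 1)%Z by nia.
  by lia.
by split=> //; move: h'; rewrite ej Z.sub_diag Z.mul_0_r; lia.
Qed.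

(** The gap of stack 0 is the cell [-1] and that of a stack i > 0 is [-i]: left of stack 0 and right
    of all other stacks. *)
Lemma cell_gap i j i' : i <= k -> i' <= k -> cell i j <> gap i'.
Proof. by rewrite /cell /gap /base /stride; case: eqP; case: eqP; nia. Qed.

(** A stack is stored bottom first, so a push or pop changes a single cell at its growing end. The
    scans stop at the blank beyond that end and at the gap. *)
Definition laid (s : store) (T : tape) : Prop :=
  (forall i j, i <= k -> T (cell i j) = nth None (map some (rev (get s i))) j) /\
  (forall i, i <= k -> T (gap i) = None).

Lemma laid_push s T i b :
  i <= k -> laid s T ->
  laid (put s i (b :: get s i)) (upd T (cell i (size (get s i))) (Some b)).
Proof.
move=> ik [h1 h2]; split=> [i' j ik'|i' ik']; rewrite /upd; last first.
  by case: Z.eqb_spec => [e|_]; [case: (@cell_gap i (size (get s i)) i') | apply: h2].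
rewrite get_put; case: Z.eqb_spec => [/(cell_inj ik' ik)[-> ->]|ne].
  by rewrite eqxx rev_cons map_rcons nth_rcons size_map size_rev ltnn eqxx.
rewrite h1 //; case: eqP => // ei; rewrite {i' ik'}ei in ne *.
rewrite rev_cons map_rcons nth_rcons size_map size_rev.
case: ltnP => // hj; rewrite nth_default ?size_map ?size_rev //.
by case: eqP => // ej; case: ne; rewrite ej.
Qed.

Lemma laid_pop s T i b r :
  i <= k -> laid s T -> get s i = b :: r ->
  laid (put s i r) (upd T (cell i (size r)) None).
Proof.
move=> ik [h1 h2] e; split=> [i' j ik'|i' ik']; rewrite /upd; last first.
  by case: Z.eqb_spec => // _; apply: h2.
rewrite get_put; case: Z.eqb_spec => [/(cell_inj ik' ik)[-> ->]|ne].
  by rewrite eqxx nth_default // size_map size_rev.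
rewrite h1 //; case: eqP => // ei; rewrite {i' ik'}ei in ne *.
rewrite e rev_cons map_rcons nth_rcons size_map size_rev.
case: ltnP => // hj; rewrite [RHS]nth_default ?size_map ?size_rev //.
by case: eqP => // ej; case: ne; rewrite ej.
Qed.

Fixpoint shiftn (n : nat) (d : dir) : lcmd :=
  if n is n'.+1 then LSeq (LAct (fun s => (s, d))) (shiftn n' d) else LSkip.

Definition shift (z : Z) : lcmd :=
  if (0 <=? z)%Z then shiftn (Z.to_nat z) DR else shiftn (Z.to_nat (- z)) DL.

Lemma shiftn_exec n d T p :
  lexec (shiftn n d) T p T (p + Z.of_nat n * dirZ d)%Z n.
Proof.
elim: n p => [|n IH] p /=.
  by rewrite Z.add_0_r; apply: LE_skip.
apply: (@LE_seq _ _ _ _ T (p + dirZ d)%Z _ _ 1 n).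
  by apply: LE_act => //; apply: upd_id.
have -> : (p + Z.pos (Pos.of_succ_nat n) * dirZ d =
           p + dirZ d + Z.of_nat n * dirZ d)%Z by lia.
exact: IH.
Qed.

Lemma shift_exec z T p p' : p' = (p + z)%Z -> lexec (shift z) T p T p' (Z.abs_nat z).
Proof.
move=> ->; rewrite /shift; case: Z.leb_spec => h.
  by have := shiftn_exec (Z.to_nat z) DR T p; rewrite /dirZ; congr lexec; lia.
by have := shiftn_exec (Z.to_nat (- z)) DL T p; rewrite /dirZ; congr lexec; lia.
Qed.

Definition nonblank (s : option bool) : bool := isSome s.
Definition scan (d : Z) : lcmd := LWhile nonblank (shift d).

Lemma scan_exec d T p m p' :
  (forall j, j < m -> T (p + d * Z.of_nat j)%Z <> None) ->
  p' = (p + d * Z.of_nat m)%Z -> T p' = None ->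
  lexec (scan d) T p T p' (m * (Z.abs_nat d + 2) + 1).
Proof.
move=> h -> {p'}; elim: m p h => [|m IH] p h h0.
  have e : (p + d * Z.of_nat 0 = p)%Z by lia.
  by rewrite e in h0 *; apply: LE_whilef; rewrite h0.
have -> : m.+1 * (Z.abs_nat d + 2) + 1 =
          (Z.abs_nat d + (m * (Z.abs_nat d + 2) + 1)).+2 by lia.
have e : (p + d * Z.of_nat m.+1 = p + d + d * Z.of_nat m)%Z by lia.
apply: (@LE_whilet _ _ _ _ T (p + d)%Z).
- have := h 0 isT; rewrite Z.mul_0_r Z.add_0_r.
  by case: (T p).
- exact: shift_exec.
- rewrite e; apply: IH; last by rewrite -e.
  move=> j jm; have := h j.+1 jm.
  by have -> : (p + d * Z.of_nat j.+1 = p + d + d * Z.of_nat j)%Z by lia.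
Qed.

(** The scan overshoots the top by one cell, so one stride back reaches the top, or the gap if the
    stack is empty. As the gap is blank, testing for a blank tests for emptiness. *)
Definition peek (i : nat) : lcmd :=
  LSeq (shift (base i)) (LSeq (scan (stride i)) (shift (- stride i))).
Definition home (i : nat) : lcmd := shift (- gap i).
Definition write (v : option bool) : lcmd := LAct (fun _ => (v, DS)).
Definition push (i : nat) (b : bool) : lcmd :=
  LSeq (shift (base i)) (LSeq (scan (stride i)) (LSeq (write (Some b))
  (LSeq (scan (- stride i)) (home i)))).
Definition drop_top (i : nat) : lcmd :=
  LSeq (write None) (LSeq (shift (- stride i)) (LSeq (scan (- stride i)) (home i))).

Definition is1 (s : option bool) : bool := s == Some true.

Fixpoint scompile (c : cmd) : lcmd :=
  match c with
  | Skip => LSkip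
  | Push i b => push i b
  | Seq c d => LSeq (scompile c) (scompile d)
  | Case i c c0 c1 =>
      LSeq (peek i) (LIf nonblank
        (LIf is1 (LSeq (drop_top i) (scompile c1)) (LSeq (drop_top i) (scompile c0)))
        (LSeq (home i) (scompile c)))
  | While i c0 c1 =>
      LSeq (peek i) (LSeq (LWhile nonblank (LSeq
        (LIf is1 (LSeq (drop_top i) (scompile c1)) (LSeq (drop_top i) (scompile c0)))
        (peek i))) (home i))
  end.

(* The cell of the topmost element of a stack of height m, or the gap. *)
Definition top_cell (i m : nat) : Z := (base i + stride i * (Z.of_nat m - 1))%Z.

Lemma top_cellS i m : top_cell i m.+1 = cell i m.
Proof. by rewrite /top_cell /cell Nat2Z.inj_succ; ring. Qed.

Definition lrun (c : lcmd) (T : tape) (p : Z) (T' : tape) (p' : Z) (B : nat) :=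
  exists2 t, t <= B & lexec c T p T' p' t.

Lemma lrun_seq c d T p T1 p1 T2 p2 B1 B2 B :
  lrun c T p T1 p1 B1 -> lrun d T1 p1 T2 p2 B2 -> B1 + B2 <= B ->
  lrun (LSeq c d) T p T2 p2 B.
Proof.
move=> [t1 h1 e1] [t2 h2 e2] h; exists (t1 + t2); first by lia.
exact: LE_seq e1 e2.
Qed.

Lemma lrun_shift z T p p' B :
  p' = (p + z)%Z -> Z.abs_nat z <= B -> lrun (shift z) T p T p' B.
Proof. by move=> e h; exists (Z.abs_nat z) => //; apply: shift_exec. Qed.

Lemma lrun_scan d T p m p' B :
  (forall j, j < m -> T (p + d * Z.of_nat j)%Z <> None) ->
  p' = (p + d * Z.of_nat m)%Z -> T p' = None ->
  m * (Z.abs_nat d + 2) + 1 <= B -> lrun (scan d) T p T p' B.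
Proof. by move=> h e h0 hB; eexists; [exact: hB | exact: scan_exec]. Qed.

Lemma lrun_write v T p : lrun (write v) T p (upd T p v) p 1.
Proof. by exists 1 => //; apply: LE_act => //=; rewrite Z.add_0_r. Qed.

(** Room for a scan in each direction, at no more than [k + 3] steps per cell, and for the shifts
    between cell 0 and the bottom of the stack. *)
Definition unit_cost (m : nat) : nat := 10 * (k + 3) * m.+1.

Lemma base_le i : i <= k -> Z.abs_nat (base i) <= 2 * (k + 3).
Proof. by rewrite /base; case: eqP; lia. Qed.

Lemma stride_le i : Z.abs_nat (- stride i) <= k + 3.
Proof. by rewrite /stride; case: eqP; lia. Qed.

Lemma scan_up s T i : i <= k -> laid s T ->
  lrun (scan (stride i)) T (base i) T (cell i (size (get s i)))
       ((k + 3) * (size (get s i)).+1).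
Proof.
move=> ik [h1 h2]; apply: (@lrun_scan _ _ _ (size (get s i))) => //.
- move=> j hj; rewrite -/(cell i j) h1 //.
  by rewrite (nth_map false) ?size_rev.
- by rewrite h1 // nth_default // size_map size_rev.
- rewrite /stride; case: eqP => _; nia.
Qed.

Lemma scan_down T i m m' p : p = top_cell i m ->
  (forall j, j < m -> T (cell i j) <> None) -> T (gap i) = None ->
  m' = m ->
  lrun (scan (- stride i)) T p T (gap i) ((k + 3) * m'.+1).
Proof.
move=> -> h h0 ->; apply: (@lrun_scan _ _ _ m) => //.
- move=> j hj.
  have -> : (top_cell i m + - stride i * Z.of_nat j = cell i (m - j.+1))%Z.
    have e : Z.of_nat (m - j.+1) = (Z.of_nat m - Z.of_nat j - 1)%Z by lia.
    by rewrite /top_cell /cell e; ring.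
  by apply: h; lia.
- by rewrite /gap /top_cell; lia.
- by rewrite /stride; case: eqP => _; nia.
Qed.

Lemma peek_run s T i : i <= k -> laid s T ->
  lrun (peek i) T 0 T (top_cell i (size (get s i))) (unit_cost (size (get s i))).
Proof.
move=> ik hl; apply: lrun_seq (lrun_seq (scan_up ik hl) _ (leqnn _)) _.
- by apply: lrun_shift; last exact: leqnn.
- by apply: lrun_shift; [rewrite /top_cell /cell; lia | exact: leqnn].
- by have := base_le ik; have := stride_le i; rewrite /unit_cost; nia.
Qed.

Lemma home_run T i : i <= k -> lrun (home i) T (gap i) T 0 (k + 3).
Proof.
move=> ik; apply: lrun_shift; first by lia.
by rewrite /gap /base /stride; case: eqP; lia.
Qed.

Lemma push_run s T i b : i <= k -> laid s T ->
  exists2 T', laid (put s i (b :: get s i)) T' &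
  lrun (push i b) T 0 T' 0 (unit_cost (size (get s i))).
Proof.
move=> ik hl.
have hl' := laid_push b ik hl.
eexists; first exact: hl'.
move: hl' => [h1 h2].
set m := size (get s i) in h1 h2 *.
apply: lrun_seq (lrun_seq (scan_up ik hl) (lrun_seq (lrun_write _ _ _)
  (lrun_seq _ (home_run _ ik) (leqnn _)) (leqnn _)) (leqnn _)) _.
- by apply: lrun_shift; last exact: leqnn.
- apply: (@scan_down _ _ m.+1) => [|j hj||//]; last exact: h2.
    by rewrite top_cellS.
  by rewrite h1 // get_put eqxx (nth_map false) ?size_rev.
- by have := base_le ik; rewrite /unit_cost -/m; nia.
Qed.

Lemma drop_run s T i b r : i <= k -> laid s T -> get s i = b :: r ->
  exists2 T', laid (put s i r) T' &
  lrun (drop_top i) T (top_cell i (size (get s i))) T' 0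
       (unit_cost (size (get s i))).
Proof.
move=> ik hl e; have hl' := laid_pop ik hl e.
eexists; first exact: hl'.
move: hl' => [h1 h2].
have et : top_cell i (size (get s i)) = cell i (size r).
  by rewrite e top_cellS.
rewrite et; apply: lrun_seq (lrun_write _ _ _) (lrun_seq
  (lrun_shift _ _ (leqnn _)) (lrun_seq _ (home_run _ ik) (leqnn _)) (leqnn _)) _.
- by [].
- apply: (@scan_down _ _ (size r)) => [|j hj||//]; last exact: h2.
    by rewrite /top_cell /cell; lia.
  by rewrite h1 // get_put eqxx (nth_map false) ?size_rev.
- by have := stride_le i; rewrite /unit_cost e /=; nia.
Qed.

Lemma laid_top s T i : i <= k -> laid s T ->
  T (top_cell i (size (get s i))) = ohead (get s i).
Proof.
move=> ik [h1 h2]; case e: (get s i) => [|b r].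
  have -> : top_cell i 0 = gap i by rewrite /top_cell /gap; lia.
  exact: h2.
have -> : top_cell i (size r).+1 = cell i (size r).
  by rewrite /top_cell /cell; lia.
rewrite h1 // e rev_cons map_rcons nth_rcons size_map size_rev ltnn eqxx //.
Qed.

Lemma top_cell_nil s i : get s i = [::] -> top_cell i (size (get s i)) = gap i.
Proof. by move=> ->; rewrite /top_cell /gap /=; lia. Qed.

Fixpoint width (c : cmd) : nat :=
  match c with
  | Skip => 0
  | Push i _ => i
  | Seq c d => maxn (width c) (width d)
  | Case i c c0 c1 => maxn i (maxn (width c) (maxn (width c0) (width c1)))
  | While i c0 c1 => maxn i (maxn (width c0) (width c1))
  end.

Definition bounded (s : store) (N : nat) : Prop := forall i, size (get s i) <= N.

Lemma bounded_pop s i b r N : bounded s N -> get s i = b :: r -> bounded (put s i r) N.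
Proof.
move=> h e j; rewrite get_put; case: eqP => _; last exact: h.
by have := h i; rewrite e /=; lia.
Qed.

Lemma exec_bounded c s s' t N :
  exec c s s' t -> bounded s N -> bounded s' (N + t).
Proof. by move=> e h i; have := exec_grow i e; have := h i; lia. Qed.

Lemma unit_cost_le m N : m <= N -> unit_cost m <= unit_cost N.
Proof. by rewrite /unit_cost; nia. Qed.

Lemma lrun_if P b c0 c1 T p T' p' B :
  P (T p) = b -> lrun (if b then c1 else c0) T p T' p' B ->
  lrun (LIf P c1 c0) T p T' p' (B + 2).
Proof.
move=> e [t ht ex]; case: b e ex => e ex.
  by exists t.+2; [lia | apply: LE_ift => //; rewrite e].
by exists t.+1; [lia | apply: LE_iff => //; rewrite e].
Qed.

Lemma lrun_drop s T N i b r c0 c1 s' B :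
  i <= k -> bounded s N -> laid s T -> get s i = b :: r ->
  (forall T', laid (put s i r) T' -> exists2 T2, laid s' T2 &
     lrun (if b then scompile c1 else scompile c0) T' 0 T2 0 B) ->
  exists2 T2, laid s' T2 &
    lrun (LIf is1 (LSeq (drop_top i) (scompile c1)) (LSeq (drop_top i) (scompile c0)))
      T (top_cell i (size (get s i))) T2 0 (unit_cost N + B + 2).
Proof.
move=> ik hb hl e h.
have [T' hl' r1] := drop_run ik hl e.
have [T2 hl2 r2] := h T' hl'; exists T2 => //.
have et := laid_top ik hl; rewrite {2}e /= in et.
apply: (@lrun_if _ b); first by rewrite et; case: (b).
have := unit_cost_le (hb i).
by case: b {h et e hl} r1 r2 => r1 r2 hu; apply: lrun_seq r1 r2 _; lia.
Qed.

(* A unit of cost on stacks of height at most N takes O(N) machine steps. *)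
Lemma scompile_sound c s s' t : exec c s s' t ->
  forall N T, width c <= k -> bounded s N -> laid s T ->
  exists2 T', laid s' T' & lrun (scompile c) T 0 T' 0 (4 * unit_cost (N + t) * t).
Proof.
have u0 m : 30 <= unit_cost m by rewrite /unit_cost; nia.
have uh m : k + 3 <= unit_cost m by rewrite /unit_cost; nia.
elim=> {c s s' t} /=.
- by move=> s N T _ _ hl; exists T => //; exists 0 => //; apply: LE_skip.
- move=> i b s N T ik hb hl; have [T' hl' [t ht ex]] := push_run b ik hl.
  exists T' => //; exists t => //; apply: leq_trans ht _.
  have /unit_cost_le := leq_trans (hb i) (leq_addr 1 N).
  by lia.
- move=> c d s s1 s2 t1 t2 e1 IH1 _ IH2 N T; rewrite geq_max => /andP[wc wd] hb hl.
  have [T1 hl1 r1] := IH1 N T wc hb hl.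
  have [T2 hl2 r2] := IH2 _ T1 wd (exec_bounded e1 hb) hl1.
  exists T2 => //; apply: lrun_seq r1 r2 _.
  have u1 : unit_cost (N + t1) <= unit_cost (N + (t1 + t2)).
    by apply: unit_cost_le; lia.
  by rewrite -addnA; nia.
- move=> i c c0 c1 s s' t e ex IH N T.
  rewrite !geq_max => /and4P[ik wc _ _] hb hl.
  have [T' hl' r] := IH N T wc hb hl; exists T' => //.
  have et := laid_top ik hl; rewrite {2}e /= in et.
  have hp := peek_run ik hl.
  have hu := unit_cost_le (hb i).
  apply: lrun_seq hp _ _.
  + apply: (@lrun_if _ false); first by rewrite et.
    apply: lrun_seq r (leqnn _).
    by rewrite top_cell_nil //; apply: home_run.
  + have u1 : unit_cost (N + t) <= unit_cost (N + t.+1) by apply: unit_cost_le; lia.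
    have u2 : unit_cost N <= unit_cost (N + t) by apply: unit_cost_le; lia.
    by have := uh N; have := u0 N; nia.
- move=> i c c0 c1 s b r s' t e ex IH N T.
  rewrite !geq_max => /and4P[ik wc w0 w1] hb hl.
  have et := laid_top ik hl; rewrite {2}e /= in et.
  have hp := peek_run ik hl.
  have hu := unit_cost_le (hb i).
  have IH' T1 : laid (put s i r) T1 -> exists2 T2, laid s' T2 &
     lrun (if b then scompile c1 else scompile c0) T1 0 T2 0
       (4 * unit_cost (N + t) * t).
    have := IH N T1 _ (bounded_pop hb e).
    by case: b {e ex IH et} => h hl'; apply: h.
  have [T2 hl2 r2] := lrun_drop ik hb hl e IH'.
  exists T2 => //; apply: lrun_seq hp _ _.
  + by apply: (@lrun_if _ true); [rewrite et | exact: r2].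
  + have u1 : unit_cost (N + t) <= unit_cost (N + t.+1) by apply: unit_cost_le; lia.
    have u2 : unit_cost N <= unit_cost (N + t) by apply: unit_cost_le; lia.
    by have := u0 N; nia.
- move=> i c0 c1 s e N T; rewrite !geq_max => /and3P[ik _ _] hb hl.
  have et := laid_top ik hl; rewrite {2}e /= in et.
  exists T => //; apply: lrun_seq (peek_run ik hl)
    (@lrun_seq _ _ _ _ _ _ _ _ 1 _ _ _ _ (leqnn _)) _.
  + by exists 1; last (apply: LE_whilef; rewrite et).
  + by rewrite top_cell_nil //; apply: home_run.
  + have hu := unit_cost_le (hb i).
    have u2 : unit_cost N <= unit_cost (N + 1) by apply: unit_cost_le; lia.
    by have := u0 N; have := uh N; lia.
- move=> i c0 c1 s b r s1 s2 t1 t2 e e1 IH1 e2 IH2 N T w hb hl.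
  move: (w); rewrite !geq_max => /and3P[ik w0 w1].
  have et := laid_top ik hl; rewrite {2}e /= in et.
  have hu := unit_cost_le (hb i).
  have IH' T1 : laid (put s i r) T1 -> exists2 T2, laid s1 T2 &
     lrun (if b then scompile c1 else scompile c0) T1 0 T2 0
       (4 * unit_cost (N + t1) * t1).
    have := IH1 N T1 _ (bounded_pop hb e).
    by case: b {e e1 IH1 et} => h hl'; apply: h.
  have [T1 hl1 [tokbits htb rb]] := lrun_drop ik hb hl e IH'.
  have [T2 hl2 [tr htr rr]] :=
    IH2 (N + t1) T1 w (exec_bounded e1 (bounded_pop hb e)) hl1.
  exists T2 => //; apply: lrun_seq (peek_run ik hl)
    (_ : lrun _ _ _ _ _ (unit_cost N + 4 * unit_cost (N + t1) * t1 + 2 +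
                         4 * unit_cost (N + t1 + t2) * t2 + 2)) _.
  (* The run of the remaining loop starts with its own [peek], whereas the compiled loop has that
     [peek] at the end of its body. The run is taken apart and regrouped accordingly. *)
  + inversion rr as [| |? ? ? ? Ta pa ? ? ta tb' ra rb'| | | |]; subst.
    inversion rb' as [| |? ? ? ? Tc pc ? ? tc td rc rd| | | |]; subst.
    eexists; last first.
      apply: LE_seq rd; apply: LE_whilet rc; first by rewrite et.
      exact: LE_seq rb ra.
    have -> : (tokbits + ta + tc).+2 + td = tokbits + (ta + (tc + td)) + 2 by lia.
    by lia.
  + have u1 : unit_cost (N + t1) <= unit_cost (N + (t1 + t2).+1).
      by apply: unit_cost_le; lia.
    have u3 : unit_cost (N + t1 + t2) <= unit_cost (N + (t1 + t2).+1).
      by apply: unit_cost_le; lia.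
    have u2 : unit_cost N <= unit_cost (N + t1) by apply: unit_cost_le; lia.
    by have := u0 N; nia.
Qed.

End Layout.

(** * Polynomial time by stack programs *)

Definition poly (f : nat -> nat) : Prop :=
  exists k c : nat, forall n, f n <= c * n ^ k + c.

Lemma poly_le f g : poly g -> (forall n, f n <= g n) -> poly f.
Proof. by move=> [k [c h]] fg; exists k, c => n; apply: leq_trans (fg n) (h n). Qed.

Lemma poly_const a : poly (fun=> a).
Proof. by exists 0, a => n; lia. Qed.

Lemma poly_id : poly (fun n => n).
Proof. by exists 1, 1 => n; rewrite expn1; lia. Qed.

Lemma poly_pow k : poly (fun n => n ^ k).
Proof. by exists k, 1 => n; lia. Qed.

(** The summand 1 covers [n = 0], where [0 ^ 0 = 1] may exceed [0 ^ b]. *)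
Lemma leq_expnS n a b : n ^ a <= n ^ (a + b) + 1.
Proof.
case: n => [|n]; first by case: a => [|a]; [rewrite expn0 addn1 | rewrite exp0n].
by apply: leq_trans (leq_addr 1 _); rewrite leq_pexp2l ?leq_addr.
Qed.

Lemma poly_add f g : poly f -> poly g -> poly (fun n => f n + g n).
Proof.
move=> [k [c h]] [k' [c' h']]; exists (k + k'), (2 * (c + c')) => n.
have := h n; have := h' n; have := leq_expnS n k k'; have := leq_expnS n k' k.
by rewrite [k' + k]addnC; nia.
Qed.

Lemma poly_succ f : poly f -> poly (fun n => (f n).+1).
Proof. by move=> h; apply: poly_le (poly_add h (poly_const 1)) _ => n; rewrite addn1. Qed.

Lemma poly_mul f g : poly f -> poly g -> poly (fun n => f n * g n).
Proof.
move=> [k [c h]] [k' [c' h']]; exists (k + k'), (4 * (c * c')) => n.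
apply: leq_trans (leq_mul (h n) (h' n)) _.
have := leq_expnS n k k'; have := leq_expnS n k' k; rewrite [k' + k]addnC.
by rewrite expnD; nia.
Qed.

Definition runs (c : cmd) (s s' : store) (B : nat) : Prop :=
  exists2 t, t <= B & exec c s s' t.

Lemma runs_seq c d s s1 s2 B1 B2 B :
  runs c s s1 B1 -> runs d s1 s2 B2 -> B1 + B2 <= B -> runs (Seq c d) s s2 B.
Proof.
move=> [t1 h1 e1] [t2 h2 e2] h; exists (t1 + t2); first by lia.
exact: E_seq e1 e2.
Qed.

Lemma runs_le c s s' B B' : runs c s s' B -> B <= B' -> runs c s s' B'.
Proof. by move=> [t h e] h'; exists t => //; lia. Qed.

Lemma runs_case i c c0 c1 s s' B B' :
  (if get s i is b :: r then runs (if b then c1 else c0) (put s i r) s' B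
   else runs c s s' B) -> B < B' -> runs (Case i c c0 c1) s s' B'.
Proof.
case e: (get s i) => [|b r] [t h ex] h'; exists t.+1; try lia.
  exact: E_case0.
exact: E_case1 e ex.
Qed.

Lemma runs_while0 i c0 c1 s B : get s i = [::] -> 0 < B -> runs (While i c0 c1) s s B.
Proof. by move=> e h; exists 1 => //; apply: E_while0. Qed.

Lemma runs_while1 i c0 c1 s b r s1 s2 B1 B2 B :
  get s i = b :: r -> runs (if b then c1 else c0) (put s i r) s1 B1 ->
  runs (While i c0 c1) s1 s2 B2 -> B1 + B2 < B -> runs (While i c0 c1) s s2 B.
Proof.
move=> e [t1 h1 e1] [t2 h2 e2] h; exists (t1 + t2).+1; first by lia.
exact: E_while1 e e1 e2.
Qed.

Definition move (i j : nat) : cmd := While i (Push j false) (Push j true).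

(** Only the destination is described, so the store need not list the two stacks; [realize] applies
    this to an arbitrary final store. *)
Lemma move_get i j s : i != j ->
  exists2 s', runs (move i j) s s' (2 * size (get s i) + 1) &
    get s' j = rev (get s i) ++ get s j.
Proof.
move=> ij; move e: (get s i) => x; elim: x s e => [|b x IH] s e.
  by exists s => //; apply: runs_while0.
have [s' h1 h2] := IH (put (put s i x) j (b :: get s j)) ltac:(
  by rewrite !get_put (negbTE ij) eqxx).
exists s'; last by rewrite h2 rev_cons cat_rcons !get_put eqxx.
apply: (runs_while1 e (B1 := 1)) h1 _; last by rewrite /=; lia.
exists 1 => //; have -> : get s j = get (put s i x) j.
  by rewrite get_put eq_sym (negbTE ij).
by case: b {e IH h2}; apply: E_push.
Qed.

(** Stack 0 runs along the cells 0, 1, 2, ... and carries the input and output of the machine. A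
    program gets its input on stack 1 and finds stack 0 empty. *)
Definition init (x : seq bool) : store := [:: [::], x & nseq 13 [::]].

Definition tape_of (x : seq bool) : tape :=
  fun z => if (z <? 0)%Z then None else nth None (map some x) (Z.to_nat z).

Lemma read_out_some s y :
  (forall j, nth None s j = nth None (map some y) j) -> read_out s = y.
Proof.
elim: y s => [|b y IH] [|a s] h //=.
- by have := h 0; rewrite /= => ->.
- by have := h 0.
- by have := h 0; rewrite /= => ->; rewrite IH // => j; have := h j.+1.
Qed.

Lemma tm_run_halted M t t' x :
  c_state (tm_run M t x) = 1 -> t <= t' -> tm_run M t' x = tm_run M t x.
Proof.
move=> h /subnK <-; elim: (t' - t) => //= m; rewrite /tm_run /= => ->.
by rewrite /tm_step /= h.
Qed.

(** The result is specified by a relation, since a caller only knows that some suitable [y] is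
    produced. The function itself is read off from the machine, so no choice principle is
    involved. *)
Lemma realize (c : cmd) (p : nat -> nat) (P : str -> str -> Prop) : poly p ->
  (forall x, exists (y : str) (s' : store),
     [/\ runs c (init (tostr x)) s' (p (size (tostr x))), get s' 0 = [::],
         get s' 2 = tostr y & P x y]) ->
  exists2 mu, polytime mu & forall x, P x (mu x).
Proof.
move=> hp hc.
(* On stack 0 the first bit of the string is at the bottom, for the input as well as for the output;
   each [move] makes the necessary reversal. *)
pose prog := Seq (move 0 1) (Seq c (move 2 0)).
pose k := width prog; pose M := machine (scompile k prog).
(* The last [move] costs twice the height of stack 2, which is bounded by the time used before; the
   factor 10 absorbs this. *)
pose q n := 10 * (n + p n + 1).
pose f n := 4 * unit_cost k (n + q n) * q n + 2.
have [K [C hf]] : poly f.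
  have hq : poly q.
    by apply: poly_mul (poly_const _) (poly_add (poly_add poly_id hp) (poly_const _)).
  apply: (poly_add (poly_mul (poly_mul (poly_const _) _) hq) (poly_const _)).
  apply: (@poly_le _ (fun n => 10 * (k + 3) * (n + q n + 1))).
    apply: (poly_mul (poly_const _)).
    exact: (poly_add (poly_add poly_id hq) (poly_const _)).
  by move=> n; rewrite /unit_cost addn1.
have main x : exists t y, [/\ t <= f (size (tostr x)),
    c_state (tm_run M t (tostr x)) = 1,
    tm_output (tm_run M t (tostr x)) = tostr y & P x y].
  have [y [s' [[t1 ht1 e1] s0 s2 Pxy]]] := hc x; set n := size (tostr x) in ht1 *.
  pose s := rev (tostr x) :: nseq 14 [::].
  have [t0 ht0 e0] : runs (move 0 1) s (init (tostr x)) (2 * n + 1).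
    have hl u a r : runs (move 0 1) [:: u, a & r] [:: [::], rev u ++ a & r] (2 * size u + 1).
      elim: u a => [|b u IH] a; first exact: runs_while0.
      rewrite rev_cons cat_rcons.
      apply: (@runs_while1 _ _ _ _ b u _ _ 1 (2 * size u + 1)) (IH _) _ => //=; last by lia.
      by exists 1 => //; case: b; apply: E_push.
    by have := hl (rev (tostr x)) [::] (nseq 13 [::]); rewrite revK cats0 size_rev.
  have [s'' [t2 ht2 e2] h0] := @move_get 2 0 s' isT.
  have sS i : get s i.+1 = [::].
    by rewrite -[get _ _]/(nth [::] (nseq 14 [::]) i) nth_nseq; case: ifP.
  have bs : bounded s n by case=> [|i]; rewrite ?sS // /get /= size_rev.
  have bs' := exec_bounded e1 (exec_bounded e0 bs).
  have e : exec prog s s'' (t0 + (t1 + t2)) by apply: E_seq e0 (E_seq e1 e2).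
  have tq : t0 + (t1 + t2) <= q n by have := bs' 2; rewrite /q; lia.
  have hl : laid k s (tape_of (tostr x)).
    split=> [[|i] j ik|i ik]; rewrite /tape_of.
    - rewrite /cell /base /stride eqxx Z.add_0_l Z.mul_1_l -[get s 0]/(rev _) revK.
      by rewrite Nat2Z.id; case: Z.ltb_spec => //; lia.
    - rewrite sS nth_nil; case: Z.ltb_spec => //.
      by rewrite /cell /base /stride /=; nia.
    - by rewrite /gap /base /stride; case: eqP; case: Z.ltb_spec => //; lia.
  have [T' [hl' _] [t ht ex]] := scompile_sound e (leqnn _) bs hl.
  have ot : on_tape (tm_init (tostr x)) 0 (tape_of (tostr x)) 0.
    split=> [|//|j|j]; first by [].
      by rewrite [LHS]nth_nil /tape_of; case: Z.ltb_spec => //; lia.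
    rewrite /tape_of; case: Z.ltb_spec => [|_]; first by lia.
    by have -> : Z.to_nat (0 + 1 + Z.of_nat j) = j.+1 by lia.
  have [h1 h2 _ h3] := machine_sound ex ot.
  exists t.+2, y; split=> //.
    rewrite /f addn2 !ltnS; apply: leq_trans ht _.
    by rewrite leq_mul // leq_mul2l unit_cost_le // leq_add2l.
  apply: read_out_some => j.
  have := hl' 0 j isT; rewrite h0 s0 cats0 revK s2.
  rewrite /cell /base /stride /= => <-.
  case: j => [|j] /=; first by rewrite h2.
  by rewrite h3; congr T'; lia.
pose bnd x := C * (size (tostr x)) ^ K + C.
(* The machine is run up to the polynomial bound. Halting is absorbing, so the output there is the
   one at the actual halting time. *)
pose mu x := let o := tm_output (tm_run M (bnd x) (tostr x)) in (head false o, behead o).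
have muE x y t : t <= f (size (tostr x)) -> c_state (tm_run M t (tostr x)) = 1 ->
    tm_output (tm_run M t (tostr x)) = tostr y -> mu x = y.
  move=> h1 h2 h3; rewrite /mu (tm_run_halted h2) ?h3; last exact: leq_trans h1 (hf _).
  by case: (y).
exists mu => [|x].
  exists M; split; first exact: machine_wf.
  exists K, C => x; have [t [y [h1 h2 h3 h4]]] := main x.
  exists t; split; first exact: leq_trans h1 (hf _).
  by rewrite h3 (muE x y t).
have [t [y [h1 h2 h3 h4]]] := main x.
by rewrite (muE x y t).
Qed.

(** * Simulation of a Turing machine *)

Lemma put_put s i u v : put (put s i u) i v = put s i v.
Proof. by rewrite /put set_set_nth eqxx. Qed.

Lemma put_comm s i j u v : i != j -> put (put s i u) j v = put (put s j v) i u.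
Proof. by move=> ij; rewrite /put set_set_nth (negbTE ij). Qed.

Lemma size_put s i v : i < size s -> size (put s i v) = size s.
Proof. by move=> h; rewrite size_set_nth; apply/maxn_idPr. Qed.

Lemma put_get s i v : i < size s -> get s i = v -> put s i v = s.
Proof.
move=> h <-; apply: (@eq_from_nth _ [::]) => [|j _]; first exact: size_put.
by rewrite nth_set_nth /=; case: eqP => [->|].
Qed.

Lemma move_run i j s : i != j -> i < size s -> j < size s ->
  runs (move i j) s (put (put s j (rev (get s i) ++ get s j)) i [::])
       (2 * size (get s i) + 1).
Proof.
move=> ij hi hj; move e: (get s i) => x; elim: x s e hi hj => [|b x IH] s e hi hj.
  by rewrite (put_get hj) // (put_get hi) //; apply: runs_while0.
apply: (@runs_while1 _ _ _ _ b x _ _ 1 (2 * size x + 1)) => //; last by rewrite /=; lia.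
  exists 1 => //; case: (b); exact: E_push.
have ji : (j == i) = false by rewrite eq_sym (negbTE ij).
have := IH (put (put s i x) j (b :: get (put s i x) j)).
rewrite !get_put eqxx eqxx (negbTE ij) ji !size_put ?size_put // put_put.
rewrite [put (put s i x) j (_ ++ _)](put_comm _ _ _ ij) put_put.
by rewrite rev_cons cat_rcons; apply.
Qed.

Definition clear (i : nat) : cmd := While i Skip Skip.

Lemma clear_run i s : i < size s ->
  runs (clear i) s (put s i [::]) (size (get s i) + 1).
Proof.
move=> hi; move e: (get s i) => x; elim: x s e hi => [|b x IH] s e hi.
  by rewrite put_get //; apply: runs_while0.
apply: (@runs_while1 _ _ _ _ b x (put s i x) _ 0 (size x + 1)) => //.
  by exists 0 => //; case: (b); apply: E_skip.
by have := IH (put s i x); rewrite get_put eqxx put_put size_put //; apply.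
Qed.

(** An evaluator for loop-free programs: through [runs_sem] their runs are established by mere
    computation. *)
Fixpoint sem (c : cmd) (s : store) : option (store * nat) :=
  match c with
  | Skip => Some (s, 0)
  | Push i b => Some (put s i (b :: get s i), 1)
  | Seq c d =>
      if sem c s is Some (s1, t1) then
        if sem d s1 is Some (s2, t2) then Some (s2, t1 + t2) else None
      else None
  | Case i c c0 c1 =>
      let r := match get s i with
               | [::] => sem c s
               | true :: r => sem c1 (put s i r)
               | false :: r => sem c0 (put s i r)
               end in
      if r is Some (s', t) then Some (s', t.+1) else None
  | While _ _ _ => None
  end.

Lemma sem_exec c s s' t : sem c s = Some (s', t) -> exec c s s' t.
Proof.
elim: c s s' t => //=.
- by move=> s s' t [<- <-]; apply: E_skip.
- by move=> i b s s' t [<- <-]; apply: E_push.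
- move=> c IHc d IHd s s' t.
  case E1: (sem c s) => [[s1 t1]|//]; case E2: (sem d s1) => [[s2 t2]|//] [<- <-].
  by apply: E_seq; [apply: IHc E1 | apply: IHd E2].
- move=> i c IHc c0 IH0 c1 IH1 s s' t.
  case e: (get s i) => [|b r].
    case E: (sem c s) => [[s1 t1]|//] [<- <-].
    by apply: E_case0 => //; apply: IHc.
  case: b e => e.
    case E: (sem c1 _) => [[s1 t1]|//] [<- <-].
    by apply: E_case1 e _; apply: IH1.
  case E: (sem c0 _) => [[s1 t1]|//] [<- <-].
  by apply: E_case1 e _; apply: IH0.
Qed.

Lemma runs_sem c s s' t B : sem c s = Some (s', t) -> t <= B -> runs c s s' B.
Proof. by move=> /sem_exec e h; exists t. Qed.

Lemma runs_skip s B : runs Skip s s B.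
Proof. exact: runs_sem. Qed.

Lemma runs_push i b s s' B :
  s' = put s i (b :: get s i) -> 0 < B -> runs (Push i b) s s' B.
Proof. by move=> ->; apply: runs_sem. Qed.

(** Two bits for every symbol. An exhausted stack is read by [popsym] as a blank, in accordance with
    the infinite blank tape. *)
Definition enc (a : option bool) : seq bool :=
  if a is Some b then [:: true; b] else [:: false; false].
Definition encs (l : seq (option bool)) : seq bool := flatten (map enc l).

Lemma size_encs l : size (encs l) = 2 * size l.
Proof. by elim: l => //= a l; rewrite /encs /= size_cat => ->; case: a => /=; lia. Qed.

Definition pushsym (i : nat) (a : option bool) : cmd :=
  if a is Some b then Seq (Push i b) (Push i true)
  else Seq (Push i false) (Push i false).

(** Stack programs have no registers. The popped symbol is handed to a continuation and so becomes
    part of the program text, with a copy for each value. *)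
Definition popsym (i : nat) (k : option bool -> cmd) : cmd :=
  Case i (k None) (Case i (k None) (k None) (k None))
         (Case i (k None) (k (Some false)) (k (Some true))).

Lemma runs_pushsym i a s B : 1 < B ->
  runs (pushsym i a) s (put s i (enc a ++ get s i)) B.
Proof.
by case: a => [b|] h; apply: (@runs_sem _ _ _ 2) => //=;
   rewrite put_put get_put eqxx.
Qed.

Lemma runs_popsym i k l s s' B : i < size s -> get s i = encs l ->
  runs (k (head None l)) (put s i (encs (behead l))) s' B ->
  runs (popsym i k) s s' (B + 2).
Proof.
move=> hi; case: l => [|[b|] l] e /= h.
- rewrite put_get // in h; apply: (@runs_case _ _ _ _ _ _ B); last by lia.
  by rewrite e.
- apply: (@runs_case _ _ _ _ _ _ B.+1); last by lia.
  rewrite e; apply: (@runs_case _ _ _ _ _ _ B) => //.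
  by rewrite get_put eqxx put_put; case: b e h.
- apply: (@runs_case _ _ _ _ _ _ B.+1); last by lia.
  rewrite e; apply: (@runs_case _ _ _ _ _ _ B) => //.
  by rewrite get_put eqxx put_put.
Qed.

Fixpoint pushn (i n : nat) : cmd :=
  if n is n'.+1 then Seq (Push i true) (pushn i n') else Skip.

Lemma runs_pushn i n s : i < size s ->
  runs (pushn i n) s (put s i (nseq n true ++ get s i)) n.
Proof.
elim: n s => [|n IH] s hi /=; first by rewrite put_get //; apply: runs_skip.
have := IH (put s i (true :: get s i)); rewrite size_put // => /(_ hi).
rewrite put_put get_put eqxx.
have -> : nseq n true ++ true :: get s i = true :: nseq n true ++ get s i.
  by elim: (n) => //= m ->.
move=> h; apply: (@runs_seq _ _ _ _ _ 1 n n.+1 _ h) => //.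
exact: runs_push.
Qed.

Section Simulation.
Variable M : TM.

(** The scanned cell is the top of stack 4 and has just been popped, so [w] returns to stack 4
    unless the head moves to the right. *)
Definition simact (w : option bool) (d : dir) : cmd :=
  match d with
  | DL => Seq (pushsym 4 w) (popsym 3 (fun a => pushsym 4 a))
  | DR => pushsym 3 w
  | DS => pushsym 4 w
  end.

(** A bit on stack 6 requests another round of [sim_loop]. The halting state pushes none, which ends
    the loop. *)
Definition simstate (q : nat) : cmd :=
  if q == 1 then Skip
  else popsym 4 (fun a => let: (q', w, d) := tm_delta M q a in
         Seq (simact w d) (Seq (pushn 5 q') (Push 6 true))).

(* The state of M is kept in unary on stack 5. *)
Fixpoint simstep (fuel q : nat) : cmd :=
  if fuel is fuel'.+1
  then Case 5 (simstate q) Skip (simstep fuel' q.+1) else Skip.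

Definition simout : cmd :=
  popsym 4 (fun a => if a is Some b then Seq (Push 7 b) (Push 6 true) else Skip).

Definition sim_load : cmd :=
  Seq (move 1 7) (While 7 (Seq (Push 4 false) (Push 4 true))
                          (Seq (Push 4 true) (Push 4 true))).
Definition sim_loop : cmd := While 6 Skip (simstep (tm_Q M) 0).
Definition sim_out : cmd := Seq (Push 6 true) (While 6 Skip simout).

(* Stack 1 is the input and stack 2 the output; the left and the right part of
   the tape of M are kept on the stacks 3 and 4. *)
Definition sim : cmd :=
  Seq sim_load (Seq (Push 6 true) (Seq sim_loop (Seq sim_out
  (Seq (move 7 2) (Seq (clear 3) (clear 4)))))).

(** The interpreter works on the stacks 1 to 7 only; an arbitrary [rest] lets a caller keep data
    beyond them. *)
Definition st8 io x y l r q f t (rest : store) : store :=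
  [:: io, x, y, l, r, q, f, t & rest].

Lemma simstep_run fuel q q' io x y l r f t rest s' B : q' < fuel ->
  runs (simstate (q + q')) (st8 io x y l r [::] f t rest) s' B ->
  runs (simstep fuel q) (st8 io x y l r (nseq q' true) f t rest) s' (B + q'.+1).
Proof.
elim: q' fuel q => [|q' IH] [|fuel] // q hq h /=.
  by apply: (@runs_case _ _ _ _ _ _ B); [rewrite /= -[q]addn0 | lia].
apply: (@runs_case _ _ _ _ _ _ (B + q'.+1)); last by lia.
by apply: IH => //; rewrite addSnnS.
Qed.

Hypothesis Mwf : tm_wf M.

Definition simulates l rs (cf : config) : Prop :=
  [/\ c_left cf = l, c_head cf = head None rs & c_right cf = behead rs].

(** A move to the left from an exhausted left part makes a blank explicit, hence a growth by up to
    2. *)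
Lemma simact_run w d io x y l rs rest t q' f :
  exists l' rs', [/\ size l' + size rs' <= size l + size rs + 2,
    simulates l' rs' (match d with
      | DL => match l with
              | [::] => Cfg q' [::] None (w :: rs)
              | a :: l => Cfg q' l a (w :: rs) end
      | DR => match rs with
              | [::] => Cfg q' (w :: l) None [::]
              | a :: r => Cfg q' (w :: l) a r end
      | DS => Cfg q' l w rs end) &
    runs (simact w d) (st8 io x y (encs l) (encs rs) [::] f t rest)
      (st8 io x y (encs l') (encs rs') [::] f t rest) 6].
Proof.
case: d => /=.
- exists (behead l), (head None l :: w :: rs); split.
  + by case: l => [|a l] /=; lia.
  + by case: l.
  + apply: runs_seq (runs_pushsym _ _ _ (leqnn _)) _ (_ : 2 + 4 <= 6) => //.
    apply: (@runs_popsym _ _ l _ _ 2) => //.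
    exact: runs_pushsym.
- exists (w :: l), rs; split; first by rewrite /=; lia.
    by case: rs.
  exact: runs_pushsym.
- exists l, (w :: rs); split => //; first by rewrite /=; lia.
  exact: runs_pushsym.
Qed.

(** A simulated step costs at most about [tm_Q M] for decoding the unary state, as much for writing
    the next one, and a constant for the symbols. *)
Lemma sim_loop_run t cf io x y l rs u rest :
  c_state cf < tm_Q M -> simulates l rs cf ->
  c_state (iter t (tm_step M) cf) = 1 ->
  exists l' rs', [/\ size l' + size rs' <= size l + size rs + 2 * t,
    read_out rs' = tm_output (iter t (tm_step M) cf) &
    runs sim_loop
      (st8 io x y (encs l) (encs rs) (nseq (c_state cf) true) [:: true] u rest)
      (st8 io x y (encs l') (encs rs') [::] [::] u rest)
      (t.+1 * (2 * tm_Q M + 20))].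
Proof.
elim: t cf l rs => [|t IH] cf l rs hq hs hh; case: (eqVneq (c_state cf) 1) => q1.
- exists l, rs; case: hs => h1 h2 h3; split; first by lia.
    by rewrite /tm_output /= h2 h3; case: (rs).
  apply: (@runs_while1 _ _ _ _ _ _ _ _ (tm_Q M + 1) 1); first by [].
  + apply: runs_le (@simstep_run _ _ _ _ _ _ _ _ _ _ _ _ 0 hq _) _; last by lia.
    by rewrite add0n /simstate q1; apply: runs_skip.
  + exact: runs_while0.
  + lia.
- by rewrite /= in hh; rewrite hh in q1.
- have fix1 m : iter m (tm_step M) cf = cf.
    by elim: m => //= m ->; rewrite /tm_step q1.
  exists l, rs; case: hs => h1 h2 h3; split; first by lia.
    by rewrite fix1 /tm_output /= h2 h3; case: (rs).
  apply: (@runs_while1 _ _ _ _ _ _ _ _ (tm_Q M + 1) 1); first by [].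
  + apply: runs_le (@simstep_run _ _ _ _ _ _ _ _ _ _ _ _ 0 hq _) _; last by lia.
    by rewrite add0n /simstate q1; apply: runs_skip.
  + exact: runs_while0.
  + nia.
- rewrite iterSr in hh *.
  case: hs => h1 h2 h3.
  case E: (tm_delta M (c_state cf) (head None rs)) => [[q' w] d].
  have hq' : q' < tm_Q M by have := Mwf.2 (c_state cf) (head None rs) hq; rewrite E.
  have [l1 [rs1 [hsz hsim hrun]]] :=
    simact_run w d io x y l (behead rs) rest u q' [::].
  have estep : tm_step M cf = match d with
      | DL => match l with
              | [::] => Cfg q' [::] None (w :: behead rs)
              | a :: l => Cfg q' l a (w :: behead rs) end
      | DR => match behead rs with
              | [::] => Cfg q' (w :: l) None [::]
              | a :: r => Cfg q' (w :: l) a r end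
      | DS => Cfg q' l w (behead rs) end.
    by rewrite /tm_step (negbTE q1) h2 E h1 h3.
  rewrite -estep in hsim.
  have eq' : c_state (tm_step M cf) = q'.
    by rewrite estep; case: (d) => //; [case: (l) | case: (behead rs)].
  have [|l' [rs' [hsz' ho hr]]] := IH (tm_step M cf) l1 rs1 _ hsim hh.
    by rewrite eq'.
  exists l', rs'; split => //.
    by have := size_behead rs; lia.
  apply: (@runs_while1 _ _ _ _ _ _ _ _ (2 * tm_Q M + 15) (t.+1 * (2 * tm_Q M + 20))) hr _ => //.
  + apply: runs_le (@simstep_run _ _ (c_state cf) _ _ _ _ _ _ _ _ _ (q' + 10) hq _) _;
      last by lia.
    rewrite add0n /simstate (negbTE q1).
    apply: runs_le (@runs_popsym _ _ rs _ _ (q' + 7) _ _ _) _ => //; last by lia.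
    rewrite E; apply: runs_seq hrun (runs_seq (runs_pushn _ _) _ (leqnn _)) _ => //.
      by rewrite eq' /= cats0; apply: runs_push (leqnn _).
    lia.
  + nia.
Qed.

Lemma sim_load_run io x y l r q f rest :
  runs sim_load (st8 io x y l r q f [::] rest)
    (st8 io [::] y l (encs (map some x) ++ r) q f [::] rest) (5 * size x + 2).
Proof.
have loop u r' : runs (While 7 (Seq (Push 4 false) (Push 4 true))
                               (Seq (Push 4 true) (Push 4 true)))
    (st8 io [::] y l r' q f u rest)
    (st8 io [::] y l (encs (map some (rev u)) ++ r') q f [::] rest) (3 * size u + 1).
  elim: u r' => [|b u IH] r'; first exact: runs_while0.
  apply: (@runs_while1 _ _ _ _ b u
    (st8 io [::] y l (enc (Some b) ++ r') q f u rest) _ 2 (3 * size u + 1)) => //.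
  + by case: b; apply: runs_sem.
  + have := IH (enc (Some b) ++ r'); rewrite rev_cons map_rcons /encs map_rcons.
    by rewrite -cats1 flatten_cat /= -!catA.
  + by rewrite /=; lia.
apply: runs_seq (move_run _ _ _) _ _ => //.
  by have := loop (rev x) r; rewrite revK /= cats0; apply.
by rewrite /= size_rev; lia.
Qed.

Lemma sim_out_run io x y l rs q u rest :
  exists2 rs', size rs' <= size rs &
  runs sim_out (st8 io x y l (encs rs) q [::] u rest)
    (st8 io x y l (encs rs') q [::] (rev (read_out rs) ++ u) rest) (8 * size rs + 8).
Proof.
suff [rs' hs h] : exists2 rs', size rs' <= size rs &
  runs (While 6 Skip simout) (st8 io x y l (encs rs) q [:: true] u rest)
    (st8 io x y l (encs rs') q [::] (rev (read_out rs) ++ u) rest) (8 * size rs + 7).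
  exists rs' => //; apply: (runs_seq _ h (B1 := 1)); last by lia.
  exact: runs_push.
elim: rs u => [|[b|] rs IH] u.
- exists [::] => //; apply: (@runs_while1 _ _ _ _ _ _ _ _ 3 1) => //.
    by apply: (@runs_popsym _ _ [::] _ _ 1) => //; apply: runs_skip.
  exact: runs_while0.
- have [rs' hs h] := IH (b :: u); exists rs'; first by rewrite /=; lia.
  rewrite [read_out _]/= rev_cons cat_rcons.
  apply: (@runs_while1 _ _ _ _ _ _ _ _ 4 (8 * size rs + 7)) h _ => //.
    apply: (@runs_popsym _ _ (Some b :: rs) _ _ 2) => //.
    exact: runs_sem.
  by rewrite /=; lia.
- exists rs; first by rewrite /=; lia.
  apply: (@runs_while1 _ _ _ _ _ _ _ _ 3 1) => //; last by rewrite /=; lia.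
    by apply: (@runs_popsym _ _ (None :: rs) _ _ 1) => //; apply: runs_skip.
  exact: runs_while0.
Qed.

(** All working stacks end empty, so that two machines can be interpreted one after the other. *)
Lemma sim_run t x rest : c_state (tm_run M t x) = 1 ->
  runs sim (st8 [::] x [::] [::] [::] [::] [::] [::] rest)
    (st8 [::] [::] (tm_output (tm_run M t x)) [::] [::] [::] [::] [::] rest)
    ((2 * tm_Q M + 100) * (size x + t + 1)).
Proof.
move=> hh.
have hs : simulates [::] (map some x) (tm_init x) by case: (x).
have hq : c_state (tm_init x) < tm_Q M.
  by have := Mwf.1; case: (x) => /=; lia.
have [l [rs [hsz ho hr]]] := @sim_loop_run t _ [::] [::] [::] _ _ [::] rest hq hs hh.
have q0 : c_state (tm_init x) = 0 by case: (x).
rewrite q0 size_map /= in hr hsz.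
have hl := @sim_load_run [::] x [::] [::] [::] [::] [::] rest; rewrite cats0 in hl.
have [rs' hs' hout] := sim_out_run [::] [::] [::] (encs l) rs [::] [::] rest.
rewrite cats0 in hout.
have hm := @move_run 7 2 (st8 [::] [::] [::] (encs l) (encs rs') [::] [::]
  (rev (read_out rs)) rest) isT isT isT.
rewrite /= revK cats0 size_rev in hm.
have ro : size (read_out rs) <= size rs by elim: (rs) => [|[b|] r IH].
have hp : runs (Push 6 true) (st8 [::] [::] [::] [::] (encs (map some x)) [::] [::] [::] rest)
   (st8 [::] [::] [::] [::] (encs (map some x)) [::] [:: true] [::] rest) 1.
  exact: runs_push.
have h3 := @clear_run 3 (st8 [::] [::] (read_out rs) (encs l) (encs rs') [::] [::] [::] rest) isT.
have h4 := @clear_run 4 (st8 [::] [::] (read_out rs) [::] (encs rs') [::] [::] [::] rest) isT.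
rewrite -ho; apply: (runs_seq hl (runs_seq hp (runs_seq hr (runs_seq hout (runs_seq hm
  (runs_seq h3 h4 (leqnn _)) (leqnn _)) (leqnn _)) (leqnn _)) (leqnn _))).
by rewrite /= !size_encs; nia.
Qed.

End Simulation.

(** * Tokens and numbers *)

Definition tbits (t : nat) : seq bool := [:: odd t./2./2; odd t./2; odd t].
Definition tokbits (l : seq nat) : seq bool := flatten (map tbits l).

Lemma tokbits_cat l1 l2 : tokbits (l1 ++ l2) = tokbits l1 ++ tokbits l2.
Proof. by rewrite /tokbits map_cat flatten_cat. Qed.

Lemma size_tokbits l : size (tokbits l) = 3 * size l.
Proof. by elim: l => //= t l; rewrite /tokbits /= => ->; lia. Qed.

Definition is_tok (t : nat) : bool := t < 8.

Lemma chunks_tokbits l : all is_tok l -> chunks (tokbits l) = Some l.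
Proof.
elim: l => //= t l IH /andP[ht hl]; rewrite -/(tokbits l) IH //.
by do 8 (case: t ht => [|t] ht //).
Qed.

(** Programs consume a string token by token and must cope with one or two bits left over at the
    end, which is exactly when [chunks] fails. *)
Lemma chunksE e : exists toks rest,
  [/\ e = tokbits toks ++ rest, size rest < 3, all is_tok toks &
      chunks e = if rest is [::] then Some toks else None].
Proof.
have [m] := ubnP (size e); elim: m e => // m IH [|a [|b [|c e]]] hm.
- by exists [::], [::].
- by exists [::], [:: a].
- by exists [::], [:: a; b].
have [|toks [rest [-> hr ht hc]]] := IH e; first by move: hm => /=; lia.
clear hm.
exists (4 * a + 2 * b + c :: toks), rest; split=> //.
- by case: a; case: b; case: c.
- by rewrite /= ht; case: a; case: b; case: c.
- by rewrite /= hc; case: (rest).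
Qed.

Definition readtok (i : nat) (k : nat -> cmd) (bad : cmd) : cmd :=
  Case i bad
    (Case i bad (Case i bad (k 0) (k 1)) (Case i bad (k 2) (k 3)))
    (Case i bad (Case i bad (k 4) (k 5)) (Case i bad (k 6) (k 7))).

Lemma runs_readtok i k bad s t l rest s' B :
  is_tok t -> get s i = tokbits (t :: l) ++ rest ->
  runs (k t) (put s i (tokbits l ++ rest)) s' B ->
  runs (readtok i k bad) s s' (B + 3).
Proof.
move=> ht e h.
apply: (@runs_case _ _ _ _ _ _ B.+2); last by lia.
rewrite e; do 8 (case: t ht e h => [|t] ht e h //=;
  first by apply: (@runs_case _ _ _ _ _ _ B.+1); last by []; 
     rewrite get_put eqxx put_put; apply: (@runs_case _ _ _ _ _ _ B); last by [];
     rewrite get_put eqxx put_put).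
Qed.

Lemma runs_readtok_bad i k bad s s' B : i < size s -> size (get s i) < 3 ->
  runs bad (put s i [::]) s' B -> runs (readtok i k bad) s s' (B + 3).
Proof.
move=> hi; case e: (get s i) => [|a [|b [|]]] // _ h.
- apply: (@runs_case _ _ _ _ _ _ B); last by lia.
  by rewrite e; rewrite put_get in h.
- apply: (@runs_case _ _ _ _ _ _ B.+1); last by lia.
  by rewrite e; case: (a); apply: (@runs_case _ _ _ _ _ _ B) => //;
     rewrite get_put eqxx.
- apply: (@runs_case _ _ _ _ _ _ B.+2); last by lia.
  by rewrite e; case: (a); apply: (@runs_case _ _ _ _ _ _ B.+1) => //;
     rewrite get_put eqxx; case: (b); apply: (@runs_case _ _ _ _ _ _ B) => //;
     rewrite put_put get_put eqxx.
Qed.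

Fixpoint emit (i : nat) (l : seq nat) : cmd :=
  if l is t :: l' then
    Seq (Push i (odd t./2./2)) (Seq (Push i (odd t./2)) (Seq (Push i (odd t))
      (emit i l')))
  else Skip.

Lemma runs_emit i l s : i < size s ->
  runs (emit i l) s (put s i (rev (tokbits l) ++ get s i)) (3 * size l).
Proof.
elim: l s => [|t l IH] s hi; first by rewrite put_get //; apply: runs_skip.
pose s1 := put s i (odd t./2./2 :: get s i).
pose s2 := put s1 i (odd t./2 :: get s1 i).
pose s3 := put s2 i (odd t :: get s2 i).
have := IH s3; rewrite !size_put // ?size_put // => /(_ hi).
rewrite {2 3}/s3 /s2 /s1 !(get_put, put_put, eqxx) -/s1 -/s2 => h.
have e : rev (tokbits (t :: l)) ++ get s i =
    rev (tokbits l) ++ [:: odd t, odd t./2, odd t./2./2 & get s i].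
  by rewrite /tokbits /= !rev_cons !cat_rcons.
rewrite e /=.
apply: (@runs_seq _ _ _ s1 _ 1 (3 * size l + 2)); [exact: runs_push | | lia].
apply: (@runs_seq _ _ _ s2 _ 1 (3 * size l + 1)); [exact: runs_push | | lia].
apply: (@runs_seq _ _ _ s3 _ 1 (3 * size l) _ _ h); [exact: runs_push | lia].
Qed.

(** Mirrors [parse_num] but keeps the digits, as the number may be exponentially large. The
    accumulator reverses them, so the least significant bit comes first, as subtraction requires. *)
Fixpoint read_number (acc : seq bool) (t : seq nat) : option (seq bool * seq nat) :=
  match t with
  | 0 :: r => read_number (false :: acc) r
  | 1 :: r => read_number (true :: acc) r
  | 2 :: r => Some (acc, r)
  | _ => None
  end.

(* Working stacks: 1 input, 2 output (reversed), 3 dimensions, 4 dimensions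
   already passed (reversed), 5 number being read, 6 flag, 7 scratch and borrow,
   8 word length in unary, 9 difference, 10 copy of the minuend (reversed),
   11 number of formulas still expected in unary, 12 error flag, 13 and 14 data
   not touched by the translation of an instance. *)
Definition st15 e g d d' v f t k w u c b o e2 : store :=
  [:: [::]; e; g; d; d'; v; f; t; k; w; u; c; b; o; e2].

Definition digit_action (t : nat) : cmd :=
  match t with
  | 0 => Seq (Push 5 false) (Push 6 true)
  | 1 => Seq (Push 5 true) (Push 6 true)
  | 2 => Skip
  | _ => Push 12 true
  end.
Definition rdnum : cmd :=
  Seq (Push 6 true) (While 6 Skip (readtok 1 digit_action (Push 12 true))).

Lemma rdnum_run toks rest g d d' v t k w u c b o e2 :
  all is_tok toks -> size rest < 3 ->
  match read_number v toks with
  | Some (v', r) => runs rdnum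
      (st15 (tokbits toks ++ rest) g d d' v [::] t k w u c b o e2)
      (st15 (tokbits r ++ rest) g d d' v' [::] t k w u c b o e2) (10 * size toks + 10)
  | None => exists e' v', runs rdnum
      (st15 (tokbits toks ++ rest) g d d' v [::] t k w u c b o e2)
      (st15 e' g d d' v' [::] t k w u c (true :: b) o e2) (10 * size toks + 10)
  end.
Proof.
move=> ht hr.
suff : match read_number v toks with
  | Some (v', r) => runs (While 6 Skip (readtok 1 digit_action (Push 12 true)))
      (st15 (tokbits toks ++ rest) g d d' v [:: true] t k w u c b o e2)
      (st15 (tokbits r ++ rest) g d d' v' [::] t k w u c b o e2) (10 * size toks + 9)
  | None => exists e' v', runs (While 6 Skip (readtok 1 digit_action (Push 12 true)))
      (st15 (tokbits toks ++ rest) g d d' v [:: true] t k w u c b o e2)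
      (st15 e' g d d' v' [::] t k w u c (true :: b) o e2) (10 * size toks + 9)
  end.
  case: (read_number v toks) => [[v' r]|] => [h|[e' [v' h]]]; [|exists e', v'];
   by apply: (@runs_seq _ _ _ _ _ 1 _ _ _ h); [apply: runs_push | lia].
elim: toks v ht => [|x toks IH] v.
  move=> _; exists [::], v.
  apply: (@runs_while1 _ _ _ _ _ _ _ _ 4 1) => //; last exact: runs_while0.
  by apply: (@runs_readtok_bad _ _ _ _ _ 1) => //; apply: runs_push.
move=> /andP[hx ht].
have stop s' : runs (digit_action x)
      (st15 (tokbits toks ++ rest) g d d' v [::] t k w u c b o e2) s' 1 ->
    get s' 6 = [::] -> runs (While 6 Skip (readtok 1 digit_action (Push 12 true)))
      (st15 (tokbits (x :: toks) ++ rest) g d d' v [:: true] t k w u c b o e2)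
      s' (10 * size (x :: toks) + 9).
  move=> h e.
  apply: (@runs_while1 _ _ _ _ _ _ s' _ 4 1) => //; last by rewrite /=; lia.
    by apply: (@runs_readtok _ _ _ _ x toks rest _ 1).
  exact: runs_while0.
have go a s' : runs (digit_action x)
      (st15 (tokbits toks ++ rest) g d d' v [::] t k w u c b o e2)
      (st15 (tokbits toks ++ rest) g d d' (a :: v) [:: true] t k w u c b o e2) 2 ->
    runs (While 6 Skip (readtok 1 digit_action (Push 12 true)))
      (st15 (tokbits toks ++ rest) g d d' (a :: v) [:: true] t k w u c b o e2)
      s' (10 * size toks + 9) ->
    runs (While 6 Skip (readtok 1 digit_action (Push 12 true)))
      (st15 (tokbits (x :: toks) ++ rest) g d d' v [:: true] t k w u c b o e2)
      s' (10 * size (x :: toks) + 9).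
  move=> h h'.
  apply: (@runs_while1 _ _ _ _ _ _ _ _ 5 (10 * size toks + 9) _ _ _ h') => //;
    last by rewrite /=; lia.
  by apply: (@runs_readtok _ _ _ _ x toks rest _ 2).
case: x hx stop go => [|[|[|x]]] hx stop go.
- have := IH (false :: v) ht; rewrite /=.
  case: (read_number _ toks) => [[v' r] h|[e' [v' h]]]; [|exists e', v'];
    by apply: go h; apply: runs_sem.
- have := IH (true :: v) ht; rewrite /=.
  case: (read_number _ toks) => [[v' r] h|[e' [v' h]]]; [|exists e', v'];
    by apply: go h; apply: runs_sem.
- by apply: stop => //; apply: runs_sem.
- by exists (tokbits toks ++ rest), v; apply: stop => //; apply: runs_sem.
Qed.

(** Numbers of a common width can be subtracted bit by bit and can share one stack without
    separators. *)
Fixpoint pad (K : nat) (v : seq bool) : seq bool :=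
  if K is K'.+1 then head false v :: pad K' (behead v) else [::].

Lemma size_pad K v : size (pad K v) = K.
Proof. by elim: K v => //= K IH v; rewrite IH. Qed.

Definition padnum : cmd :=
  Seq (While 8 Skip (Seq (Push 7 true) (Case 5 (Push 9 false) (Push 9 false) (Push 9 true))))
      (Seq (move 7 8) (move 9 5)).

Lemma padnum_run K e g d d' v f u c b o e2 : size v <= K ->
  runs padnum (st15 e g d d' v f [::] (nseq K true) [::] u c b o e2)
    (st15 e g d d' (pad K v) f [::] (nseq K true) [::] u c b o e2) (10 * K + 10).
Proof.
move=> hv.
have nseqr n : nseq n true ++ [:: true] = nseq n.+1 true by elim: n => //= n ->.
have loop K' v' w' t' : size v' <= K' -> runs
    (While 8 Skip (Seq (Push 7 true) (Case 5 (Push 9 false) (Push 9 false) (Push 9 true))))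
    (st15 e g d d' v' f t' (nseq K' true) w' u c b o e2)
    (st15 e g d d' [::] f (nseq K' true ++ t') [::] (rev (pad K' v') ++ w') u c b o e2)
    (5 * K' + 1).
  elim: K' v' w' t' => [|K' IH] v' w' t' h.
    by case: v' h => // _; apply: runs_while0.
  have := IH (behead v') (head false v' :: w') (true :: t').
  have -> : nseq K' true ++ true :: t' = nseq K'.+1 true ++ t'.
    by rewrite -nseqr -catA.
  rewrite size_behead [pad _.+1 _]/= rev_cons cat_rcons => h'.
  apply: (@runs_while1 _ _ _ _ _ _ _ _ 3 (5 * K' + 1) _ _ _ (h' _)) => //; try lia.
  by case: v' h {h'} => [|[] v'] h; apply: runs_sem.
have h1 := loop K v [::] [::] hv; rewrite !cats0 in h1.
have h2 := @move_run 7 8 (st15 e g d d' [::] f (nseq K true) [::] (rev (pad K v)) u c b o e2)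
  isT isT isT.
have rn : rev (nseq K true) = nseq K true.
  by elim: (K) => //= n IH; rewrite rev_cons IH -cats1 nseqr.
rewrite /= cats0 rn size_nseq in h2.
have h3 := @move_run 9 5 (st15 e g d d' [::] f [::] (nseq K true) (rev (pad K v)) u c b o e2)
  isT isT isT.
rewrite /= cats0 revK size_rev size_pad in h3.
by apply: (runs_seq h1 (runs_seq h2 h3 (leqnn _))); lia.
Qed.

(** A zero dimension makes the encoding invalid. Each digit 1 leaves a mark on stack 6, so no mark
    means zero. *)
Definition storedim : cmd :=
  Seq (While 5 (Push 4 false) (Seq (Push 4 true) (Push 6 true)))
      (Case 6 (Push 12 true) (clear 6) (clear 6)).

Lemma storedim_run e g d d' v t k w u c b o e2 :
  runs storedim (st15 e g d d' v [::] t k w u c b o e2)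
    (st15 e g d (rev v ++ d') [::] [::] t k w u c (if has id v then b else true :: b) o e2)
    (10 * size v + 10).
Proof.
have loop f' v' D : runs (While 5 (Push 4 false) (Seq (Push 4 true) (Push 6 true)))
    (st15 e g d D v' (nseq f' true) t k w u c b o e2)
    (st15 e g d (rev v' ++ D) [::] (nseq (f' + count id v') true) t k w u c b o e2)
    (5 * size v' + 1).
  elim: v' f' D => [|a v' IH] f' D; first by rewrite addn0; apply: runs_while0.
  have := IH (f' + a) (a :: D); rewrite -addnA rev_cons cat_rcons => h.
  apply: (@runs_while1 _ _ _ _ a v' _ _ 2 (5 * size v' + 1) _ _ _ h) => //;
    last by rewrite /=; lia.
  have -> : nseq (f' + a) true = if a then true :: nseq f' true else nseq f' true.
    by case: (a); rewrite ?addn1 ?addn0.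
  by case: a {h}; apply: runs_sem.
have h1 := loop 0 v d'; rewrite has_count.
apply: (@runs_seq _ _ _ _ _ _ (2 * size v + 5) _ h1); last by lia.
have hc := count_size id v; rewrite add0n.
case: (count id v) hc => [|m] hc /=.
  by apply: (@runs_case _ _ _ _ _ _ 1); [apply: runs_push | lia].
have := @clear_run 6 (st15 e g d (rev v ++ d') [::] (nseq m true) t k w u c b o e2) isT.
by rewrite /= size_nseq => h; apply: (@runs_case _ _ _ _ _ _ (m + 1)) => //; lia.
Qed.

(** * Renaming of variables *)

(* Numbers are lists of bits, least significant bit first. *)
Fixpoint value (v : seq bool) : nat := if v is b :: v' then b + 2 * value v' else 0.

Definition borrow (a b c : bool) : bool := (~~ a && (b || c)) || (b && c).

Fixpoint fsub (c : bool) (v m : seq bool) : seq bool * bool :=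
  match v, m with
  | a :: v', b :: m' =>
      let r := fsub (borrow a b c) v' m' in (a (+) b (+) c :: r.1, r.2)
  | _, _ => ([::], c)
  end.

Lemma size_fsub c v m : size v = size m -> size (fsub c v m).1 = size v.
Proof. by elim: v c m => [|a v IH] c [|b m] //= [] /IH ->. Qed.

Lemma value_lt v : value v < 2 ^ size v.
Proof. by elim: v => //= b v IH; rewrite expnS; case: b; lia. Qed.

(** The invariant of subtraction with borrow, an outgoing borrow being worth [2 ^ size v]. Both the
    comparison and the difference are read off from it. *)
Lemma fsubE c v m : size v = size m ->
  value v + (fsub c v m).2 * 2 ^ size v = value m + c + value (fsub c v m).1.
Proof.
elim: v c m => [|a v IH] c [|b m] //=; first by rewrite expn0; lia.
move=> [] /(IH (borrow a b c)); rewrite expnS.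
by rewrite /borrow; case: a; case: b; case: c => /=; nia.
Qed.

Lemma fsub_lt v m : size v = size m -> (fsub false v m).2 = (value v < value m).
Proof.
move=> e; have := fsubE false e; have := value_lt m; have := value_lt (fsub false v m).1.
rewrite size_fsub // e; case: (fsub _ _ _).2; case: ltnP => //; nia.
Qed.

Lemma fsub_val v m : size v = size m -> value m <= value v ->
  value (fsub false v m).1 = value v - value m.
Proof.
move=> e h; have := fsubE false e; rewrite fsub_lt //.
by case: ltnP => //; lia.
Qed.

Definition digits (v : seq bool) : seq nat := map nat_of_bool v.

(** Each block passed contributes a leading digit 1. A variable beyond the last block gets one more
    1 than the last block does; its index exceeds all new blocks, so it still reads as 0. *)
Fixpoint var_digits (ds : seq (seq bool)) (v : seq bool) : seq nat :=
  match ds with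
  | m :: ds' =>
      if (fsub false v m).2 then 1 :: digits (rev v) ++ [:: 2]
      else 1 :: var_digits ds' (fsub false v m).1
  | [::] => 1 :: digits (rev v) ++ [:: 2]
  end.

Definition popbit (i : nat) (k : bool -> cmd) : cmd :=
  Case i (k false) (k false) (k true).

(** Both operands are saved: the dimension on stack 4 for later variables, the minuend on stack 10
    because it is the wanted offset if a borrow remains. An empty stack 7 means no borrow. *)
Definition subbit (a : bool) : cmd :=
  popbit 3 (fun b => popbit 7 (fun c =>
    Seq (Push 4 b) (Seq (Push 10 a) (Seq (Push 9 (a (+) b (+) c))
      (if borrow a b c then Push 7 true else Skip))))).
Definition subloop : cmd := While 5 (subbit false) (subbit true).

Lemma subloop_run (c : bool) v m e g d d' f k w u cc b o e2 : size m = size v ->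
  runs subloop (st15 e g (m ++ d) d' v f (nseq c true) k w u cc b o e2)
    (st15 e g d (rev m ++ d') [::] f (nseq (fsub c v m).2 true) k
      (rev (fsub c v m).1 ++ w) (rev v ++ u) cc b o e2) (10 * size v + 1).
Proof.
elim: v c m d' w u => [|a v IH] c [|x m] d' w u //=.
  by move=> _; apply: runs_while0.
move=> [hm]; have := IH (borrow a x c) m (x :: d') (a (+) x (+) c :: w) (a :: u) hm.
rewrite !rev_cons !cat_rcons => h.
apply: (@runs_while1 _ _ _ _ a v _ _ 6 (10 * size v + 1) _ _ _ h) => //; last by lia.
by case: a {h}; case: x; case: c; apply: runs_sem.
Qed.

(** A final borrow shows that the offset lies in this block. The negative difference is dropped; the
    copy on stack 10 has its most significant digit on top, ready to be written. *)
Definition found : cmd := Seq (Push 6 true) (clear 9).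
Definition lookup_step : cmd :=
  Seq subloop
    (Case 7 (Seq (emit 2 [:: 1]) (Seq (clear 10) (move 9 5))) found found).
Definition lookup_end : cmd :=
  Seq (Case 6 (move 5 10) Skip Skip)
  (Seq (emit 2 [:: 1])
  (Seq (While 10 (emit 2 [:: 0]) (emit 2 [:: 1]))
  (Seq (emit 2 [:: 2]) (move 4 3)))).
Fixpoint lookup (n : nat) : cmd :=
  if n is n'.+1 then Seq (Case 6 lookup_step (Push 6 true) (Push 6 true)) (lookup n')
  else lookup_end.

(** The offset is still on stack 5 if no block contained the variable, and on stack 10 if one
    did. *)
Lemma lookup_end_run e g d d' v u f k c b o e2 : (f = [::] /\ u = [::]) \/ (f = [:: true] /\ v = [::]) ->
  runs lookup_end (st15 e g d d' v f [::] k [::] u c b o e2)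
   (st15 e (rev (tokbits (1 :: digits (rev v ++ u) ++ [:: 2])) ++ g) (rev d' ++ d) [::]
      [::] [::] [::] k [::] [::] c b o e2) (20 * (size v + size u + size d' + 1)).
Proof.
move=> hf.
have h1 : runs (Case 6 (move 5 10) Skip Skip)
    (st15 e g d d' v f [::] k [::] u c b o e2)
    (st15 e g d d' [::] [::] [::] k [::] (rev v ++ u) c b o e2) (2 * size v + 3).
  case: hf => [[-> ->]|[-> ->]].
    have := @move_run 5 10 (st15 e g d d' v [::] [::] k [::] [::] c b o e2) isT isT isT.
    by rewrite /= => h; apply: (@runs_case _ _ _ _ _ _ (2 * size v + 1)) => //; lia.
  by apply: (@runs_case _ _ _ _ _ _ 1) => //; apply: runs_skip.
have loop x g' : runs (While 10 (emit 2 [:: 0]) (emit 2 [:: 1]))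
    (st15 e g' d d' [::] [::] [::] k [::] x c b o e2)
    (st15 e (rev (tokbits (digits x)) ++ g') d d' [::] [::] [::] k [::] [::] c b o e2)
    (5 * size x + 1).
  elim: x g' => [|a x IH] g'; first exact: runs_while0.
  have := IH (rev (tokbits [:: nat_of_bool a]) ++ g').
  rewrite catA -rev_cat -tokbits_cat /= => h.
  apply: (@runs_while1 _ _ _ _ a x _ _ 3 (5 * size x + 1) _ _ _ h) => //; last by lia.
  by case: a {h}; apply: runs_sem.
set x := rev v ++ u in h1 *.
have h2 := @runs_emit 2 [:: 1] (st15 e g d d' [::] [::] [::] k [::] x c b o e2) isT.
have h3 := loop x (rev (tokbits [:: 1]) ++ g).
have h4 := @runs_emit 2 [:: 2] (st15 e (rev (tokbits (digits x)) ++ rev (tokbits [:: 1]) ++ g)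
  d d' [::] [::] [::] k [::] [::] c b o e2) isT.
set g2 := rev (tokbits (digits x)) ++ _ in h3 h4.
have h5 := @move_run 4 3 (st15 e (rev (tokbits [:: 2]) ++ g2) d d' [::] [::] [::] k
  [::] [::] c b o e2) isT isT isT.
have eg : rev (tokbits (1 :: digits x ++ [:: 2])) ++ g = rev (tokbits [:: 2]) ++ g2.
  by rewrite /g2 -[1 :: _]/([:: 1] ++ _) !tokbits_cat !rev_cat -!catA.
rewrite eg.
have sx : size x = size v + size u by rewrite size_cat size_rev.
by apply: (runs_seq h1 (runs_seq h2 (runs_seq h3 (runs_seq h4 h5 (leqnn _))
  (leqnn _)) (leqnn _))); rewrite /=; lia.
Qed.

Lemma lookup_found n e g d d' u k c b o e2 :
  runs (lookup n) (st15 e g d d' [::] [:: true] [::] k [::] u c b o e2)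
   (st15 e (rev (tokbits (1 :: digits u ++ [:: 2])) ++ g) (rev d' ++ d) [::]
      [::] [::] [::] k [::] [::] c b o e2) (20 * (size u + size d' + 1) + 3 * n).
Proof.
elim: n => [|n IH].
  rewrite muln0 addn0.
  have := @lookup_end_run e g d d' [::] u [:: true] k c b o e2 (or_intror (conj erefl erefl)).
  by rewrite add0n.
apply: (runs_seq _ IH (B1 := 2)); last by lia.
by apply: runs_sem.
Qed.

Lemma lookup_run K ds v e g d' k c b o e2 : size v = K -> all (fun m => size m == K) ds ->
  runs (lookup (size ds))
   (st15 e g (flatten ds) d' v [::] [::] k [::] [::] c b o e2)
   (st15 e (rev (tokbits (var_digits ds v)) ++ g) (rev d' ++ flatten ds) [::]
      [::] [::] [::] k [::] [::] c b o e2)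
   (20 * (size d' + (size ds).+1 * (2 * K + 2))).
Proof.
elim: ds v g d' => [|m ds IH] v g d' hv.
  move=> _; have := @lookup_end_run e g [::] d' v [::] [::] k c b o e2 (or_introl (conj erefl erefl)).
  by rewrite cats0 /= => h; apply: runs_le h _; lia.
move=> /andP[/eqP hm hds]; rewrite [flatten _]/= [var_digits _ _]/=.
have hs : size m = size v by rewrite hm hv.
have h1 := @subloop_run false v m e g (flatten ds) d' [::] k [::] [::] c b o e2 hs.
rewrite !cats0 in h1.
have hf := size_fsub false (esym hs).
case E: (fsub false v m).2 h1 => h1.
- have h2 := @lookup_found (size ds) e g (flatten ds) (rev m ++ d') (rev v) k c b o e2.
  rewrite rev_cat revK -catA in h2.
  apply: (runs_seq _ h2 (B1 := 15 * K + 15)); last first.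
    by rewrite size_rev size_cat size_rev hm hv /=; nia.
  apply: (@runs_case _ _ _ _ _ _ (15 * K + 14)); last by lia.
  rewrite /=; apply: (runs_seq h1 _ (B2 := K + 5)); last by lia.
  apply: (@runs_case _ _ _ _ _ _ (K + 4)) => //; last by lia.
  rewrite /=; apply: (@runs_seq _ _ _ (st15 e g (flatten ds) (rev m ++ d') [::] [:: true]
    [::] k (rev (fsub false v m).1) (rev v) c b o e2) _ 1 (K + 1)); last by lia.
    exact: runs_push.
  have := @clear_run 9 (st15 e g (flatten ds) (rev m ++ d') [::] [:: true]
    [::] k (rev (fsub false v m).1) (rev v) c b o e2) isT.
  by rewrite /= size_rev hf hv.
- set r := (fsub false v m).1 in h1 hf *.
  have h2 := IH r (rev (tokbits [:: 1]) ++ g) (rev m ++ d') (etrans hf hv) hds.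
  rewrite rev_cat revK -catA catA -rev_cat -tokbits_cat in h2.
  apply: (runs_seq _ h2 (B1 := 15 * K + 15)); last first.
    by rewrite size_cat size_rev hm /=; nia.
  apply: (@runs_case _ _ _ _ _ _ (15 * K + 14)); last by lia.
  rewrite /=; apply: (runs_seq h1 _ (B2 := 4 * K + 9)); last by lia.
  apply: (@runs_case _ _ _ _ _ _ (4 * K + 8)) => //; last by lia.
  have h3 := @runs_emit 2 [:: 1] (st15 e g (flatten ds) (rev m ++ d') [::] [::]
    [::] k (rev r) (rev v) c b o e2) isT.
  have h4 := @clear_run 10 (st15 e (rev (tokbits [:: 1]) ++ g) (flatten ds) (rev m ++ d') [::] [::]
    [::] k (rev r) (rev v) c b o e2) isT.
  have h5 := @move_run 9 5 (st15 e (rev (tokbits [:: 1]) ++ g) (flatten ds) (rev m ++ d') [::] [::]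
    [::] k (rev r) [::] c b o e2) isT isT isT.
  rewrite /= revK cats0 size_rev hf hv in h5.
  rewrite /= size_rev hv in h4.
  by apply: (runs_seq h3 (runs_seq h4 h5 (leqnn _))); rewrite /=; lia.
Qed.

(** * Translation of an instance *)

Lemma read_number_size acc t v r : read_number acc t = Some (v, r) -> size v + size r < size acc + size t.
Proof.
elim: t acc => [|[|[|[|x]]] t IH] acc //=.
- by move/IH => /=; lia.
- by move/IH => /=; lia.
- by move=> [<- <-]; lia.
Qed.

Lemma read_number_all acc t v r : read_number acc t = Some (v, r) -> all is_tok t -> all is_tok r.
Proof.
elim: t acc => [|[|[|[|x]]] t IH] acc //=; try exact: IH.
by move=> [_ <-].
Qed.

Section Scan.
Variables (K : nat) (ds : seq (seq bool)).

(* [c] is the number of formulas that are still to be read. *)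
Fixpoint translate_toks (fuel c : nat) (t : seq nat) : option (seq nat) :=
  match c, fuel with
  | 0, _ => if t is [::] then Some [::] else None
  | _, 0 => None
  | c'.+1, fuel'.+1 =>
      match t with
      | 3 :: r =>
          if read_number [::] r is Some (v, r')
          then omap (fun g => 3 :: var_digits ds (pad K v) ++ g) (translate_toks fuel' c' r')
          else None
      | 4 :: r => omap (cons 4) (translate_toks fuel' c r)
      | 5 :: r => omap (cons 5) (translate_toks fuel' c.+1 r)
      | 6 :: r => omap (cons 6) (translate_toks fuel' c.+1 r)
      | 7 :: r => omap (cons 7) (translate_toks fuel' c' r)
      | _ => None
      end
  end.
End Scan.

Definition reject_formula : cmd := Seq (Push 12 true) (clear 11).
Definition token_action (n t : nat) : cmd :=
  match t with
  | 3 => Seq (emit 2 [:: 3]) (Seq rdnum (Case 12 (Seq padnum (lookup n)) reject_formula reject_formula))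
  | 4 => Seq (emit 2 [:: 4]) (Push 11 true)
  | 5 => Seq (emit 2 [:: 5]) (Seq (Push 11 true) (Push 11 true))
  | 6 => Seq (emit 2 [:: 6]) (Seq (Push 11 true) (Push 11 true))
  | 7 => emit 2 [:: 7]
  | _ => reject_formula
  end.
(** Popping stack 11 accounts for the formula starting at the next token, and the token pushes a
    mark for each of its arguments. This counter replaces the recursion of [parse_form]. *)
Definition formloop (n : nat) : cmd := While 11 Skip (readtok 1 (token_action n) reject_formula).

(** The loop also ends if the count reaches 0 too early. No error is flagged then, so remaining
    input counts as failure as well. *)
Definition failed (K : nat) o e2 (s : store) : Prop :=
  exists e g d d' v f t w u c b,
    s = st15 e g d d' v f t (nseq K true) w u c b o e2 /\ b ++ e != [::].

Lemma reject_formula_run e g d d' v f t k w u c b o e2 :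
  runs reject_formula (st15 e g d d' v f t k w u c b o e2)
    (st15 e g d d' v f t k w u [::] (true :: b) o e2) (size c + 2).
Proof.
have := @clear_run 11 (st15 e g d d' v f t k w u c (true :: b) o e2) isT.
move=> h; apply: (runs_seq _ h (B1 := 1)); last by rewrite /=; lia.
exact: runs_push.
Qed.

Lemma formloop_run K ds fuel c toks rest g o e2 :
  all (fun m => size m == K) ds -> all is_tok toks -> size rest < 3 ->
  size toks <= fuel -> size toks <= K ->
  let s0 := st15 (tokbits toks ++ rest) g (flatten ds) [::] [::] [::] [::] (nseq K true)
    [::] [::] (nseq c true) [::] o e2 in
  let X := (size toks).+1 * (100 * ((size ds).+1 * K.+1)) + c in
  match translate_toks K ds fuel c toks with
  | Some g' => runs (formloop (size ds)) s0
      (st15 rest (rev (tokbits g') ++ g) (flatten ds) [::] [::] [::] [::] (nseq K true)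
        [::] [::] [::] [::] o e2) X
  | None => exists2 s', runs (formloop (size ds)) s0 s' X & failed K o e2 s'
  end.
Proof.
(* [Y] bounds the work on one token. Variables are the expensive case: a subtraction of width K for
   each block. *)
move=> hds; set Y := 100 * _; move: c toks g.
have hZ : K.+1 <= (size ds).+1 * K.+1 by rewrite leq_pmull.
have hY : 100 <= Y by rewrite /Y; nia.
have hYK : 10 * K <= Y by rewrite /Y; nia.
have badrun e v u c : runs reject_formula
    (st15 e u (flatten ds) [::] v [::] [::] (nseq K true) [::] [::] (nseq c true) [::] o e2)
    (st15 e u (flatten ds) [::] v [::] [::] (nseq K true) [::] [::] [::] [:: true] o e2)
    (c + 2).
  have := @reject_formula_run e u (flatten ds) [::] v [::] [::] (nseq K true)
    [::] [::] (nseq c true) [::] o e2; by rewrite size_nseq.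
have stop e u c s' B : runs (readtok 1 (token_action (size ds)) reject_formula)
      (st15 e u (flatten ds) [::] [::] [::] [::] (nseq K true) [::] [::] (nseq c true) [::] o e2)
      s' B -> get s' 11 = [::] ->
    runs (formloop (size ds))
      (st15 e u (flatten ds) [::] [::] [::] [::] (nseq K true) [::] [::] (nseq c.+1 true) [::] o e2)
      s' (B + 2).
  move=> h e'; apply: (@runs_while1 _ _ _ _ true (nseq c true) _ _ B 1);
    [by [] | exact: h | exact: runs_while0 | lia].
have badtok e u c B x toks : is_tok x -> e = tokbits (x :: toks) ++ rest ->
    token_action (size ds) x = reject_formula -> c + 7 <= B -> exists2 s', runs (formloop (size ds))
      (st15 e u (flatten ds) [::] [::] [::] [::] (nseq K true) [::] [::] (nseq c.+1 true) [::] o e2)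
      s' B & failed K o e2 s'.
  move=> hx -> hb hB; eexists; last first.
    by exists (tokbits toks ++ rest), u, (flatten ds), [::], [::], [::], [::], [::], [::], [::], [:: true].
  apply: runs_le hB; rewrite -[7]/(2 + 3 + 2) !addnA; apply: stop => //.
  by apply: (@runs_readtok _ _ _ _ x toks rest) => //; rewrite hb; apply: badrun.
elim: fuel => [|fuel IH] [|c] toks g ht hr hf hK s0 X.
- case: toks ht hf hK @s0 @X => // _ _ _; apply: runs_while0 => //; lia.
- case: toks ht hf hK @s0 @X => // _ _ _ s0 X /=.
  eexists; last first.
    by exists [::], g, (flatten ds), [::], [::], [::], [::], [::], [::], [::], [:: true].
  have h : c + 2 + 3 + 2 <= X by rewrite /X /=; lia.
  apply: runs_le h; apply: stop => //.
  by apply: runs_readtok_bad => //; apply: badrun.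
- case: toks ht hf hK @s0 @X => [|x toks] /= ht _ hK.
    by apply: runs_while0 => //; lia.
  eexists; first by apply: runs_while0 => //; lia.
  by exists (tokbits (x :: toks) ++ rest), g, (flatten ds), [::], [::], [::], [::], [::],
    [::], [::], [::].
case: toks ht hf hK @s0 @X => [|x toks] ht hf hK s0 X.
  eexists; last first.
    by exists [::], g, (flatten ds), [::], [::], [::], [::], [::], [::], [::], [:: true].
  have h : c + 2 + 3 + 2 <= X by rewrite /X /=; lia.
  apply: runs_le h; apply: stop => //.
  by apply: runs_readtok_bad => //; apply: badrun.
move: ht => /= /andP[hx ht]; rewrite /= in hf hK.
have goon c' g' toks' B : size toks' <= size toks -> all is_tok toks' ->
    runs (token_action (size ds) x)
      (st15 (tokbits toks ++ rest) g (flatten ds) [::] [::] [::] [::] (nseq K true)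
        [::] [::] (nseq c true) [::] o e2)
      (st15 (tokbits toks' ++ rest) (rev (tokbits g') ++ g) (flatten ds) [::] [::] [::] [::] (nseq K true)
        [::] [::] (nseq c' true) [::] o e2) B ->
    B + 10 + c' <= Y + c ->
  match omap (fun g => g' ++ g) (translate_toks K ds fuel c' toks') with
  | Some g' => runs (formloop (size ds)) s0
      (st15 rest (rev (tokbits g') ++ g) (flatten ds) [::] [::] [::] [::] (nseq K true)
        [::] [::] [::] [::] o e2) X
  | None => exists2 s', runs (formloop (size ds)) s0 s' X & failed K o e2 s'
  end.
  move=> hs ht' h hB.
  have IH' := IH c' toks' (rev (tokbits g') ++ g) ht' hr (leq_trans hs hf)
    (leq_trans hs (ltnW hK)).
  have hX : B + 3 + ((size toks').+1 * Y + c') < X.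
    by rewrite /X /=; nia.
  have first s1 : runs (formloop (size ds))
      (st15 (tokbits toks' ++ rest) (rev (tokbits g') ++ g) (flatten ds) [::] [::] [::] [::] (nseq K true)
        [::] [::] (nseq c' true) [::] o e2) s1 ((size toks').+1 * Y + c') ->
    runs (formloop (size ds)) s0 s1 X.
    move=> h1; apply: (@runs_while1 _ _ _ _ _ _ _ _ (B + 3) _ _ _ _ h1) => //.
    by apply: (@runs_readtok _ _ _ _ x toks rest).
  case: (translate_toks _ _ _ _ _) IH' => [g1|] /=.
    by move=> h1; rewrite tokbits_cat rev_cat -catA; apply: first.
  by move=> [s1 h1 h2]; exists s1 => //; apply: first.
case: x hx @s0 @X goon => [|[|[|[|[|[|[|[|x]]]]]]]] // hx s0 X goon.
- by apply: (badtok _ _ _ _ 0 toks) => //; rewrite /X /=; lia.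
- by apply: (badtok _ _ _ _ 1 toks) => //; rewrite /X /=; lia.
- by apply: (badtok _ _ _ _ 2 toks) => //; rewrite /X /=; lia.
- have h1 := @runs_emit 2 [:: 3] (st15 (tokbits toks ++ rest) g (flatten ds) [::] [::] [::] [::]
    (nseq K true) [::] [::] (nseq c true) [::] o e2) isT.
  have h2 := @rdnum_run toks rest (rev (tokbits [:: 3]) ++ g) (flatten ds) [::] [::] [::]
    (nseq K true) [::] [::] (nseq c true) [::] o e2 ht hr.
  rewrite /=; case E: (read_number [::] toks) h2 => [[v r]|].
    move=> h2; have := read_number_size E; rewrite add0n => hsz.
    apply: (@goon c (3 :: var_digits ds (pad K v)) r (80 * ((size ds).+1 * K.+1))).
    + by lia.
    + exact: read_number_all E ht.
    + have h3 := @padnum_run K (tokbits r ++ rest) (rev (tokbits [:: 3]) ++ g) (flatten ds) [::] v [::]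
        [::] (nseq c true) [::] o e2.
      have h4 := @lookup_run K ds (pad K v) (tokbits r ++ rest) (rev (tokbits [:: 3]) ++ g) [::]
        (nseq K true) (nseq c true) [::] o e2 (size_pad _ _) hds.
      have hv : size v <= K by lia.
      rewrite -[3 :: _]/([:: 3] ++ _) tokbits_cat rev_cat -catA.
      apply: (runs_seq h1 (runs_seq h2 _ (leqnn _)
        (B2 := 10 * K + 11 + 40 * ((size ds).+1 * K.+1)))); last by rewrite /=; lia.
      apply: (@runs_case _ _ _ _ _ _ (10 * K + 10 + 40 * ((size ds).+1 * K.+1)));
        last by lia.
      have eZ : (size ds).+1 * (2 * K + 2) = 2 * ((size ds).+1 * K.+1).
        by rewrite mulnCA -mulnSr.
      by rewrite eZ in h4; apply: (runs_seq (h3 hv) h4); rewrite /=; lia.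
    + by rewrite /Y; lia.
  move=> [e' [v' h2]]; eexists; last first.
    by exists e', (rev (tokbits [:: 3]) ++ g), (flatten ds), [::], v', [::], [::], [::], [::], [::],
      [:: true].
  have hX : 10 * size toks + 20 + c + 3 + 2 <= X by rewrite /X /=; nia.
  apply: runs_le hX; apply: stop => //.
  apply: (@runs_readtok _ _ _ _ 3 toks rest) => //.
  apply: (runs_seq h1 (runs_seq h2 _ (leqnn _) (B2 := c + 3))); last by rewrite /=; lia.
  by apply: (@runs_case _ _ _ _ _ _ (c + 2)); [apply: badrun | lia].
- by apply: (@goon c.+1 [:: 4] toks 20) => //; [apply: runs_sem | lia].
- by apply: (@goon c.+2 [:: 5] toks 20) => //; [apply: runs_sem | lia].
- by apply: (@goon c.+2 [:: 6] toks 20) => //; [apply: runs_sem | lia].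
- by apply: (@goon c [:: 7] toks 20) => //; [apply: runs_sem | lia].
Qed.

Fixpoint read_dims (K m : nat) (t : seq nat) : option (seq (seq bool) * seq nat) :=
  if m is m'.+1 then
    if read_number [::] t is Some (v, r) then
      if has id (pad K v) then
        omap (fun p => (pad K v :: p.1, p.2)) (read_dims K m' r)
      else None
    else None
  else Some ([::], t).

(** [ds0] collects the dimensions already stored, for the induction in [header_run]. Leftover bits
    in [rest] are an error, as they are for [chunks]. *)
Definition translate_inst (K m : nat) (ds0 : seq (seq bool)) (t : seq nat) (rest : seq bool) :
    option (seq nat) :=
  if read_dims K m t is Some (ds, r) then
    if rest is [::] then translate_toks K (ds0 ++ ds) (size r) 1 r else None
  else None.

(** The test pops the error flag, hence the flag is pushed again; in nested use the first error
    skips all that follows. *)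
Definition okthen (c : cmd) : cmd := Case 12 c (Push 12 true) (Push 12 true).

Definition body (n : nat) : cmd :=
  Seq (move 4 3) (Seq (Push 11 true) (Seq (formloop n)
    (Case 1 Skip (Push 12 true) (Push 12 true)))).

Fixpoint header (n m : nat) : cmd :=
  if m is m'.+1 then
    Seq rdnum (okthen (Seq padnum (Seq storedim (okthen (header n m')))))
  else body n.

Definition rejected (K : nat) o e2 (s : store) : Prop :=
  exists e g d d' v f t w u c b,
    s = st15 e g d d' v f t (nseq K true) w u c b o e2 /\ b != [::].

(** At most K tokens, each with at most n subtractions of width K. *)
Definition body_cost (n K : nat) : nat := 110 * (n.+1 * (K.+1 * K.+1)).

Lemma body_run K ds toks rest o e2 :
  all (fun m => size m == K) ds -> all is_tok toks -> size rest < 3 -> size toks <= K ->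
  let s0 := st15 (tokbits toks ++ rest) [::] [::] (rev (flatten ds)) [::] [::] [::]
    (nseq K true) [::] [::] [::] [::] o e2 in
  let X := body_cost (size ds) K in
  match (if rest is [::] then translate_toks K ds (size toks) 1 toks else None) with
  | Some g => runs (body (size ds)) s0
      (st15 [::] (rev (tokbits g)) (flatten ds) [::] [::] [::] [::] (nseq K true)
        [::] [::] [::] [::] o e2) X
  | None => exists2 s', runs (body (size ds)) s0 s' X & rejected K o e2 s'
  end.
Proof.
move=> hds ht hr hK s0 X.
have h1 := @move_run 4 3 s0 isT isT isT.
rewrite /= revK cats0 size_rev in h1.
have hfl : size (flatten ds) = size ds * K.
  by elim: (ds) hds => //= m l IH /andP[/eqP hm /IH]; rewrite size_cat hm => ->; lia.
have h2 : runs (Push 11 true)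
    (st15 (tokbits toks ++ rest) [::] (flatten ds) [::] [::] [::] [::]
      (nseq K true) [::] [::] [::] [::] o e2)
    (st15 (tokbits toks ++ rest) [::] (flatten ds) [::] [::] [::] [::]
      (nseq K true) [::] [::] [:: true] [::] o e2) 1 by apply: runs_push.
have := @formloop_run K ds (size toks) 1 toks rest [::] o e2 hds ht hr (leqnn _) hK.
set Y := _ * _ + 1 => h3.
have hX : 2 * size (flatten ds) + 1 + (1 + (Y + 3)) <= X.
  have e1 : K.+1 <= K.+1 * K.+1 by rewrite leq_pmull.
  have e3 : (size ds).+1 * K.+1 <= (size ds).+1 * (K.+1 * K.+1) by rewrite leq_pmul2l.
  have e5 : 1 <= (size ds).+1 * K.+1 by [].
  have e4 : (size toks).+1 * (100 * ((size ds).+1 * K.+1)) <=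
            100 * ((size ds).+1 * (K.+1 * K.+1)).
    by rewrite mulnCA leq_mul2l /= mulnCA leq_mul2l /= leq_mul2r ltnS hK orbT.
  by rewrite /X /body_cost /Y hfl; lia.
have glue s1 s2 : runs (formloop (size ds))
    (st15 (tokbits toks ++ rest) [::] (flatten ds) [::] [::] [::] [::]
      (nseq K true) [::] [::] [:: true] [::] o e2) s1 Y ->
    runs (Case 1 Skip (Push 12 true) (Push 12 true)) s1 s2 3 ->
    runs (body (size ds)) s0 s2 X.
  by move=> h4 h5; exact: runs_seq h1 (runs_seq h2 (runs_seq h4 h5 (leqnn _)) (leqnn _)) hX.
case: (translate_toks _ _ _ _ _) h3 => [g|] h3.
  rewrite cats0 in h3; case: rest hr @s0 h1 h2 h3 glue => [|a rest] hr s0 h1 h2 h3 glue.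
    apply: glue h3 _.
    by apply: (@runs_case _ _ _ _ _ _ 1) => //; apply: runs_skip.
  eexists; last by eexists rest, _, _, _, _, _, _, _, _, _, [:: true].
  apply: glue h3 _; apply: (@runs_case _ _ _ _ _ _ 1) => //.
  by case: (a); apply: runs_sem.
have -> : (if rest is [::] then None else None) = None :> option (seq nat) by case: (rest).
case: h3 => s1 h3 [e [g [d [d' [v [f [t [w [u [c [b [e1 hb]]]]]]]]]]]].
rewrite {}e1 in h3.
case: e hb h3 => [|a e] hb h3.
  rewrite cats0 in hb; eexists; last by eexists [::], _, _, _, _, _, _, _, _, _, b.
  by apply: glue h3 _; apply: (@runs_case _ _ _ _ _ _ 1) => //; apply: runs_skip.
eexists; last by eexists e, _, _, _, _, _, _, _, _, _, (true :: b).
by apply: glue h3 _; apply: (@runs_case _ _ _ _ _ _ 1) => //; case: (a); apply: runs_sem.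
Qed.

Lemma runs_okthen_bad c e g d d' v f t k w u cc b o e2 : b != [::] ->
  exists2 b', b' != [::] &
  runs (okthen c) (st15 e g d d' v f t k w u cc b o e2)
    (st15 e g d d' v f t k w u cc b' o e2) 2.
Proof.
case: b => // a b _; exists (true :: b) => //.
by apply: (@runs_case _ _ _ _ _ _ 1) => //; case: (a); apply: runs_sem.
Qed.

Lemma runs_okthen c e g d d' v f t k w u cc o e2 s' B :
  runs c (st15 e g d d' v f t k w u cc [::] o e2) s' B ->
  runs (okthen c) (st15 e g d d' v f t k w u cc [::] o e2) s' (B + 1).
Proof. by move=> h; apply: (@runs_case _ _ _ _ _ _ B) => //; lia. Qed.

Lemma header_run K n m ds0 toks rest o e2 :
  all (fun m => size m == K) ds0 -> all is_tok toks -> size rest < 3 -> size toks <= K ->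
  n = size ds0 + m ->
  let s0 := st15 (tokbits toks ++ rest) [::] [::] (rev (flatten ds0)) [::] [::] [::]
    (nseq K true) [::] [::] [::] [::] o e2 in
  let X := m * (60 * K.+1) + body_cost n K in
  match translate_inst K m ds0 toks rest with
  | Some g => exists2 ds, all (fun m => size m == K) ds & runs (header n m) s0
      (st15 [::] (rev (tokbits g)) (flatten ds) [::] [::] [::] [::] (nseq K true)
        [::] [::] [::] [::] o e2) X
  | None => exists2 s', runs (header n m) s0 s' X & rejected K o e2 s'
  end.
Proof.
move=> hds ht hr hK en; elim: m ds0 toks hds ht hK en => [|m IH] ds0 toks hds ht hK en s0 X.
  rewrite addn0 in en; have := @body_run K ds0 toks rest o e2 hds ht hr hK.
  rewrite /translate_inst /= cats0 -en => h.
  case: (if rest is [::] then _ else _) h => [g|] h; last exact: h.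
  by exists ds0.
have h1 := @rdnum_run toks rest [::] [::] (rev (flatten ds0)) [::] [::]
  (nseq K true) [::] [::] [::] [::] o e2 ht hr.
rewrite /translate_inst /=.
case E: (read_number [::] toks) h1 => [[v r]|]; last first.
  move=> [e' [v' h1]].
  have [b' hb h2] := @runs_okthen_bad (Seq padnum (Seq storedim (okthen (header n m))))
    e' [::] [::] (rev (flatten ds0)) v' [::] [::] (nseq K true) [::] [::] [::] [:: true] o e2 isT.
  eexists; last by eexists e', _, _, _, _, _, _, _, _, _, b'.
  by apply: (runs_seq h1 h2); rewrite /X; lia.
move=> h1; have := read_number_size E; rewrite add0n => hsz.
have hv : size v <= K by lia.
have h2 := @padnum_run K (tokbits r ++ rest) [::] [::] (rev (flatten ds0)) v [::]
  [::] [::] [::] o e2 hv.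
have h3 := @storedim_run (tokbits r ++ rest) [::] [::] (rev (flatten ds0)) (pad K v) [::]
  (nseq K true) [::] [::] [::] [::] o e2.
rewrite size_pad in h3.
have glue s1 s2 B : runs storedim (st15 (tokbits r ++ rest) [::] [::] (rev (flatten ds0))
      (pad K v) [::] [::] (nseq K true) [::] [::] [::] [::] o e2) s1 (10 * K + 10) ->
    runs (okthen (header n m)) s1 s2 B -> B + 30 * K + 40 <= X ->
    runs (header n m.+1) s0 s2 X.
  move=> h4 h5 hB.
  apply: (runs_seq h1 (runs_okthen (runs_seq h2 (runs_seq h4 h5 (leqnn _)) (leqnn _)))).
  lia.
case: ifP h3 => hp h3; last first.
  have [b' hb h4] := @runs_okthen_bad (header n m) (tokbits r ++ rest) [::] [::]
    (rev (pad K v) ++ rev (flatten ds0)) [::] [::] [::] (nseq K true) [::] [::] [::]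
    [:: true] o e2 isT.
  eexists; last by eexists (tokbits r ++ rest), _, _, _, _, _, _, _, _, _, b'.
  by apply: glue h3 h4 _; rewrite /X /body_cost; lia.
have hds' : all (fun m => size m == K) (rcons ds0 (pad K v)).
  by rewrite all_rcons size_pad eqxx.
have hr' := read_number_all E ht.
have hK' : size r <= K by lia.
have := IH (rcons ds0 (pad K v)) r hds' hr' hK'.
rewrite size_rcons addSnnS => /(_ en).
have -> : rev (flatten (rcons ds0 (pad K v))) = rev (pad K v) ++ rev (flatten ds0).
  by rewrite -cats1 flatten_cat rev_cat /= cats0.
have hX : m * (60 * K.+1) + body_cost n K + 1 + 30 * K + 40 <= X by rewrite /X; lia.
rewrite /translate_inst; case: (read_dims K m r) => [[ds r']|] /=; last first.
  move=> [s1 h4 h5]; exists s1 => //; exact: glue h3 (runs_okthen h4) hX.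
rewrite cat_rcons.
case: (if rest is [::] then _ else _) => [g|] [s1 h4 h5].
  by exists s1 => //; exact: glue h3 (runs_okthen h5) hX.
by exists s1 => //; exact: glue h3 (runs_okthen h4) hX.
Qed.

Fixpoint clears (l : seq nat) : cmd :=
  if l is i :: l' then Seq (clear i) (clears l') else Skip.

Lemma clears_run l s N : all (fun i => i < size s) l -> (forall i, size (get s i) <= N) ->
  runs (clears l) s (foldl (fun s i => put s i [::]) s l) (size l * N.+1).
Proof.
elim: l s => [|i l IH] s /=; first by move=> _ _; apply: runs_skip.
move=> /andP[hi hl] hN; have h := IH (put s i [::]).
apply: (runs_seq (clear_run hi) (h _ _)).
- by rewrite size_put.
- by move=> j; rewrite get_put; case: eqP.
- by have := hN i; lia.
Qed.

(* The translation of an invalid instance is the constant-0 formula. *)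
Definition translate (n : nat) : cmd :=
  Seq (header n n)
  (Seq (Case 12 Skip (Seq (clear 2) (emit 2 [:: 4; 7])) (Seq (clear 2) (emit 2 [:: 4; 7])))
       (clears [:: 1; 3; 4; 5; 6; 7; 9; 10; 11; 12])).

Definition translate_cost (n K N : nat) : nat :=
  25 * (N + n * (60 * K.+1) + body_cost n K + 10).

Lemma translate_run K n toks rest o e2 N :
  all is_tok toks -> size rest < 3 -> size (tokbits toks ++ rest) <= K ->
  K <= N -> size o <= N -> size e2 <= N ->
  runs (translate n)
    (st15 (tokbits toks ++ rest) [::] [::] [::] [::] [::] [::]
      (nseq K true) [::] [::] [::] [::] o e2)
    (st15 [::] (rev (tokbits (odflt [:: 4; 7] (translate_inst K n [::] toks rest))))
      [::] [::] [::] [::] [::] (nseq K true) [::] [::] [::] [::] o e2)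
    (translate_cost n K N).
Proof.
move=> ht hr hsz hKN ho he2.
have hK : size toks <= K by move: hsz; rewrite size_cat size_tokbits; lia.
have := @header_run K n n [::] toks rest o e2 isT ht hr hK (esym (add0n n)).
set s0 := st15 _ _ _ _ _ _ _ _ _ _ _ _ _ _.
set B := _ + _.
have b0 i : size (get s0 i) <= N.
  have hs := leq_trans hsz hKN.
  have hs0 : all (fun x => size x <= N) s0 by rewrite /= hs ho he2 size_nseq hKN.
  case: (ltnP i 15) => hi; first by apply: (allP hs0); rewrite mem_nth.
  by rewrite /get nth_default.
have cl s1 t1 : exec (header n n) s0 s1 t1 -> t1 <= B ->
    forall s2 t2, exec (Case 12 Skip (Seq (clear 2) (emit 2 [:: 4; 7]))
                        (Seq (clear 2) (emit 2 [:: 4; 7]))) s1 s2 t2 ->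
    t2 <= N + B + 10 -> size s2 = 15 ->
    runs (translate n) s0 (foldl (fun s i => put s i [::]) s2
      [:: 1; 3; 4; 5; 6; 7; 9; 10; 11; 12]) (translate_cost n K N).
  move=> x1 hB1 s2 t2 x2 hB2 s15.
  (* After a failure the contents of the stacks are unknown, but the time used so far bounds their
     heights and hence the cost of clearing them. *)
  have hcl : forall i, size (get s2 i) <= N + B + (N + B + 10).
    move=> i; have := exec_grow i x1; have := exec_grow i x2; have := b0 i; lia.
  have := clears_run (l := [:: 1; 3; 4; 5; 6; 7; 9; 10; 11; 12]) _ hcl.
  rewrite s15 => /(_ isT) h3.
  apply: (runs_seq (ex_intro2 _ _ t1 hB1 x1) (runs_seq (ex_intro2 _ _ t2 hB2 x2) h3 (leqnn _))).
  rewrite /translate_cost -/B /=; lia.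
case: (translate_inst K n [::] toks rest) => [g|].
  move=> [ds _ [t1 hB1 x1]].
  apply: (cl _ _ x1 hB1 (st15 [::] (rev (tokbits g)) (flatten ds) [::] [::] [::] [::]
    (nseq K true) [::] [::] [::] [::] o e2) 1) => //; last by lia.
  by apply: E_case0 => //; apply: E_skip.
move=> [s1 [t1 hB1 x1] [e [g [d [d' [v [f [t [w [u [c [b [es hb]]]]]]]]]]]]].
have hg := exec_grow 2 x1; rewrite {}es in x1 hg.
case: b hb x1 hg => // a b _ x1 hg.
have hr2 : runs (Seq (clear 2) (emit 2 [:: 4; 7]))
   (st15 e g d d' v f t (nseq K true) w u c b o e2)
   (st15 e (rev (tokbits [:: 4; 7])) d d' v f t (nseq K true) w u c b o e2) (size g + 7).
  have h1 := @clear_run 2 (st15 e g d d' v f t (nseq K true) w u c b o e2) isT.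
  have h2 := @runs_emit 2 [:: 4; 7]
    (st15 e [::] d d' v f t (nseq K true) w u c b o e2) isT.
  by apply: (runs_seq h1 h2); rewrite /=; lia.
have [t2 hB2 x2] := hr2.
apply: (cl _ _ x1 hB1 (st15 e (rev (tokbits [:: 4; 7])) d d' v f t (nseq K true)
    w u c b o e2) t2.+1) => //.
  by apply: (@E_case1 _ _ _ _ _ a b) => //; case: (a).
by move: hg; rewrite /get /=; lia.
Qed.

(** * Combination of two instances *)

Definition dim_toks (K i : nat) : seq nat := 1 :: nseq (i.+1 + K) 0 ++ [:: 2].
Fixpoint dims_toks (K i m : nat) : seq nat :=
  if m is m'.+1 then dim_toks K i ++ dims_toks K i.+1 m' else [::].

Definition emit_dim (i : nat) : cmd :=
  Seq (emit 13 (1 :: nseq i.+1 0))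
  (Seq (While 8 Skip (Seq (Push 7 true) (emit 13 [:: 0])))
  (Seq (move 7 8) (emit 13 [:: 2]))).
Fixpoint emit_dims (i m : nat) : cmd :=
  if m is m'.+1 then Seq (emit_dim i) (emit_dims i.+1 m') else Skip.

Lemma rev_nseq (T : Type) n (a : T) : rev (nseq n a) = nseq n a.
Proof.
elim: n => //= n IH; rewrite rev_cons IH.
by elim: (n) => //= m ->.
Qed.

Lemma emit_dim_run K i e g d d' v f w u c b o e2 :
  runs (emit_dim i) (st15 e g d d' v f [::] (nseq K true) w u c b o e2)
    (st15 e g d d' v f [::] (nseq K true) w u c b (rev (tokbits (dim_toks K i)) ++ o) e2)
    (20 * (K + i + 1)).
Proof.
have loop K' k' o' : runs (While 8 Skip (Seq (Push 7 true) (emit 13 [:: 0])))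
    (st15 e g d d' v f (nseq k' true) (nseq K' true) w u c b o' e2)
    (st15 e g d d' v f (nseq (K' + k') true) [::] w u c b
      (rev (tokbits (nseq K' 0)) ++ o') e2) (5 * K' + 1).
  elim: K' k' o' => [|K' IH] k' o'; first exact: runs_while0.
  have := IH k'.+1 (rev (tokbits [:: 0]) ++ o').
  rewrite addnS catA -rev_cat -tokbits_cat /= => h.
  apply: (@runs_while1 _ _ _ _ true (nseq K' true) _ _ 4 (5 * K' + 1) _ _ _ h) => //;
    last by rewrite mulnS; lia.
  exact: runs_sem.
have h1 := @runs_emit 13 (1 :: nseq i.+1 0)
  (st15 e g d d' v f [::] (nseq K true) w u c b o e2) isT.
set o1 := _ ++ _ in h1.
have h2 := loop K 0 o1; rewrite addn0 in h2; set o2 := _ ++ o1 in h2.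
have h3 := @move_run 7 8 (st15 e g d d' v f (nseq K true) [::] w u c b o2 e2) isT isT isT.
rewrite /= rev_nseq cats0 size_nseq in h3.
have h4 := @runs_emit 13 [:: 2]
  (st15 e g d d' v f [::] (nseq K true) w u c b o2 e2) isT.
have eo : rev (tokbits (dim_toks K i)) ++ o = rev (tokbits [:: 2]) ++ o2.
  have -> : dim_toks K i = (1 :: nseq i.+1 0) ++ nseq K 0 ++ [:: 2].
    by rewrite /dim_toks nseqD -catA.
  by rewrite /o2 /o1 !tokbits_cat !rev_cat -!catA.
rewrite eo.
apply: (runs_seq h1 (runs_seq h2 (runs_seq h3 h4 (leqnn _)) (leqnn _))).
by rewrite /= size_nseq; lia.
Qed.

Lemma emit_dims_run K i m e g d d' v f w u c b o e2 :
  runs (emit_dims i m) (st15 e g d d' v f [::] (nseq K true) w u c b o e2)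
    (st15 e g d d' v f [::] (nseq K true) w u c b (rev (tokbits (dims_toks K i m)) ++ o) e2)
    (m * (20 * (K + i + m + 1))).
Proof.
elim: m i o => [|m IH] i o; first exact: runs_skip.
have h1 := @emit_dim_run K i e g d d' v f w u c b o e2.
have h2 := IH i.+1 (rev (tokbits (dim_toks K i)) ++ o).
rewrite -[dims_toks K i m.+1]/(dim_toks K i ++ dims_toks K i.+1 m) tokbits_cat rev_cat -catA.
by apply: (runs_seq h1 h2); nia.
Qed.

Definition dup : cmd :=
  Seq (move 1 7) (While 7 (Seq (Push 1 false) (Push 14 false))
                          (Seq (Push 1 true) (Push 14 true))).

(* Restores both instances and counts their bits on stack 8. *)
Definition measure : cmd :=
  Seq (While 13 (Seq (Push 8 true) (Push 1 false)) (Seq (Push 8 true) (Push 1 true)))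
  (Seq (While 14 (Seq (Push 8 true) (Push 7 false)) (Seq (Push 8 true) (Push 7 true)))
       (move 7 14)).

(** The second machine needs the input again, hence the copy on stack 14. The width K has to be the
    same for both instances; the sum of their bit lengths is a bound that is easily counted. *)
Definition fetch (M1 M2 : TM) : cmd :=
  Seq dup (Seq (sim M1) (Seq (move 2 13) (Seq (move 14 7) (Seq (move 7 1)
  (Seq (sim M2) (Seq (move 2 14) measure)))))).

Definition append_translation (n : nat) (l : seq nat) : cmd :=
  Seq (emit 13 l) (Seq (translate n) (Seq (move 2 7) (move 7 13))).

(** The tokens [6 5 3 2] spell OR AND VAR 0, the empty digit string denoting 0, and [5 4 3 2 4]
    spell AND NOT VAR 0 NOT. Followed by the two translations they form the selection in prefix
    notation. *)
Definition combine (M1 M2 : TM) (n : nat) : cmd :=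
  Seq (fetch M1 M2) (Seq (emit_dims 0 n)
  (Seq (append_translation n [:: 6; 5; 3; 2]) (Seq (move 14 1)
  (Seq (append_translation n [:: 5; 4; 3; 2; 4]) (move 13 2))))).

Section Fetch.
Variables (M1 M2 : TM) (wf1 : tm_wf M1) (wf2 : tm_wf M2).
Variables (x : seq bool) (t1 t2 : nat).
Hypothesis h1 : c_state (tm_run M1 t1 x) = 1.
Hypothesis h2 : c_state (tm_run M2 t2 x) = 1.
Let e1 := tm_output (tm_run M1 t1 x).
Let e2 := tm_output (tm_run M2 t2 x).

Definition fetch_cost (n : nat) : nat :=
  20 * ((2 * tm_Q M1 + 100) * (n + t1 + 1) + (2 * tm_Q M2 + 100) * (n + t2 + 1)).

Lemma fetch_run :
  runs (fetch M1 M2) (init x)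
    (st15 e1 [::] [::] [::] [::] [::] [::] (nseq (size e1 + size e2) true)
       [::] [::] [::] [::] [::] (rev e2)) (fetch_cost (size x)).
Proof.
have hdup : runs dup (init x) (st15 x [::] [::] [::] [::] [::] [::] [::]
   [::] [::] [::] [::] [::] x) (5 * size x + 2).
  have loop u v : runs (While 7 (Seq (Push 1 false) (Push 14 false))
                          (Seq (Push 1 true) (Push 14 true)))
     (st15 v [::] [::] [::] [::] [::] u [::] [::] [::] [::] [::] [::] v)
     (st15 (rev u ++ v) [::] [::] [::] [::] [::] [::] [::] [::] [::] [::] [::] [::] (rev u ++ v))
     (3 * size u + 1).
    elim: u v => [|a u IH] v; first exact: runs_while0.
    have h := IH (a :: v); rewrite rev_cons cat_rcons.
    apply: (@runs_while1 _ _ _ _ a u _ _ 2 (3 * size u + 1) _ _ _ h) => //;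
      last by rewrite /=; lia.
    by case: a {h}; apply: runs_sem.
  have hm := @move_run 1 7 (init x) isT isT isT; rewrite /= cats0 in hm.
  have := loop (rev x) [::]; rewrite revK cats0 size_rev => hl.
  by apply: (runs_seq hm hl); lia.
have hs1 := @sim_run M1 wf1 t1 x [:: [::]; [::]; [::]; [::]; [::]; [::]; x] h1.
rewrite -/e1 in hs1.
have he1 : size e1 <= (2 * tm_Q M1 + 100) * (size x + t1 + 1).
  by case: hs1 => t ht /(@exec_grow _ _ _ _ 2) /= h; apply: leq_trans h ht.
have m1 := @move_run 2 13 (st15 [::] e1 [::] [::] [::] [::] [::] [::]
  [::] [::] [::] [::] [::] x) isT isT isT.
rewrite /= cats0 in m1.
have m2 := @move_run 14 7 (st15 [::] [::] [::] [::] [::] [::] [::] [::]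
  [::] [::] [::] [::] (rev e1) x) isT isT isT.
rewrite /= cats0 in m2.
have m3 := @move_run 7 1 (st15 [::] [::] [::] [::] [::] [::] (rev x) [::]
  [::] [::] [::] [::] (rev e1) [::]) isT isT isT.
rewrite /= cats0 revK size_rev in m3.
have hs2 := @sim_run M2 wf2 t2 x [:: [::]; [::]; [::]; [::]; [::]; rev e1; [::]] h2.
rewrite -/e2 in hs2.
have he2 : size e2 <= (2 * tm_Q M2 + 100) * (size x + t2 + 1).
  by case: hs2 => t ht /(@exec_grow _ _ _ _ 2) /= h; apply: leq_trans h ht.
have m4 := @move_run 2 14 (st15 [::] e2 [::] [::] [::] [::] [::] [::]
  [::] [::] [::] [::] (rev e1) [::]) isT isT isT.
rewrite /= cats0 in m4.
have w1 y k u : runs (While 13 (Seq (Push 8 true) (Push 1 false)) (Seq (Push 8 true) (Push 1 true)))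
    (st15 u [::] [::] [::] [::] [::] [::] (nseq k true) [::] [::] [::] [::] y (rev e2))
    (st15 (rev y ++ u) [::] [::] [::] [::] [::] [::] (nseq (size y + k) true)
      [::] [::] [::] [::] [::] (rev e2)) (3 * size y + 1).
  elim: y k u => [|a y IH] k u; first exact: runs_while0.
  have := IH k.+1 (a :: u); rewrite rev_cons cat_rcons addnS => h.
  apply: (@runs_while1 _ _ _ _ a y _ _ 2 (3 * size y + 1) _ _ _ h) => //;
    last by rewrite /=; lia.
  by case: a {h}; apply: runs_sem.
have w2 y k u : runs (While 14 (Seq (Push 8 true) (Push 7 false)) (Seq (Push 8 true) (Push 7 true)))
    (st15 e1 [::] [::] [::] [::] [::] u (nseq k true) [::] [::] [::] [::] [::] y)
    (st15 e1 [::] [::] [::] [::] [::] (rev y ++ u) (nseq (size y + k) true)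
      [::] [::] [::] [::] [::] [::]) (3 * size y + 1).
  elim: y k u => [|a y IH] k u; first exact: runs_while0.
  have := IH k.+1 (a :: u); rewrite rev_cons cat_rcons addnS => h.
  apply: (@runs_while1 _ _ _ _ a y _ _ 2 (3 * size y + 1) _ _ _ h) => //;
    last by rewrite /=; lia.
  by case: a {h}; apply: runs_sem.
have := w1 (rev e1) 0 [::]; rewrite revK cats0 size_rev addn0 => hw1.
have := w2 (rev e2) (size e1) [::]; rewrite revK cats0 size_rev addnC => hw2.
have m5 := @move_run 7 14 (st15 e1 [::] [::] [::] [::] [::] e2 (nseq (size e1 + size e2) true)
  [::] [::] [::] [::] [::] [::]) isT isT isT.
rewrite /= cats0 in m5.
apply: (runs_seq hdup (runs_seq hs1 (runs_seq m1 (runs_seq m2 (runs_seq m3 (runs_seq hs2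
  (runs_seq m4 (runs_seq hw1 (runs_seq hw2 m5 (leqnn _)) (leqnn _)) (leqnn _)) (leqnn _))
  (leqnn _)) (leqnn _)) (leqnn _)) (leqnn _))).
rewrite /fetch_cost /= ?size_rev.
have : size x + 1 <= (2 * tm_Q M1 + 100) * (size x + t1 + 1) by nia.
lia.
Qed.

End Fetch.

Lemma append_translation_run K n l toks rest o e2 N :
  all is_tok toks -> size rest < 3 -> size (tokbits toks ++ rest) <= K ->
  K <= N -> size o + 3 * size l <= N -> size e2 <= N ->
  runs (append_translation n l)
    (st15 (tokbits toks ++ rest) [::] [::] [::] [::] [::] [::]
      (nseq K true) [::] [::] [::] [::] o e2)
    (st15 [::] [::] [::] [::] [::] [::] [::] (nseq K true) [::] [::] [::] [::]
      (rev (tokbits (l ++ odflt [:: 4; 7] (translate_inst K n [::] toks rest))) ++ o) e2)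
    (6 * (N + translate_cost n K N)).
Proof.
move=> ht hr hsz hKN ho he2; set g := odflt _ _.
have h1 := @runs_emit 13 l (st15 (tokbits toks ++ rest) [::] [::] [::] [::] [::] [::]
      (nseq K true) [::] [::] [::] [::] o e2) isT.
have ho' : size (rev (tokbits l) ++ o) <= N by rewrite size_cat size_rev size_tokbits addnC.
have h2 := @translate_run K n toks rest _ e2 N ht hr hsz hKN ho' he2.
rewrite -/g in h2.
have hg : size (rev (tokbits g)) <= translate_cost n K N.
  by case: h2 => t hB /(@exec_grow _ _ _ _ 2) /= h; apply: leq_trans h hB.
have h3 := @move_run 2 7 (st15 [::] (rev (tokbits g)) [::] [::] [::] [::] [::]
      (nseq K true) [::] [::] [::] [::] (rev (tokbits l) ++ o) e2) isT isT isT.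
rewrite /= revK cats0 in h3.
have h4 := @move_run 7 13 (st15 [::] [::] [::] [::] [::] [::] (tokbits g)
      (nseq K true) [::] [::] [::] [::] (rev (tokbits l) ++ o) e2) isT isT isT.
rewrite tokbits_cat rev_cat -catA.
apply: (runs_seq h1 (runs_seq h2 (runs_seq h3 h4 (leqnn _)) (leqnn _))).
rewrite /=; move: hg; rewrite size_rev /translate_cost; lia.
Qed.

Definition combined (n K : nat) (g1 g2 : seq nat) : seq nat :=
  dims_toks K 0 n ++ ([:: 6; 5; 3; 2] ++ g1) ++ [:: 5; 4; 3; 2; 4] ++ g2.

(** Bounds the relevant stack heights before the first translation, where [B] is the cost of
    [fetch]; [stage2] does so for the second. *)
Definition stage1 (n B : nat) : nat := 20 + B + n * (20 * (B + n + 1)).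
Definition stage_cost (n B N : nat) : nat := 6 * (N + translate_cost n B N).
Definition stage2 (n B : nat) : nat := stage1 n B + stage_cost n B (stage1 n B) + 20.
Definition combine_cost (n B : nat) : nat :=
  stage1 n B + stage_cost n B (stage1 n B) + (2 * B + 1) +
  stage_cost n B (stage2 n B) + 2 * (stage2 n B + stage_cost n B (stage2 n B)) + 1.

Lemma leq_translate_cost n K K' N : K <= K' -> translate_cost n K N <= translate_cost n K' N.
Proof.
move=> h; rewrite /translate_cost /body_cost.
have h2 : n.+1 * (K.+1 * K.+1) <= n.+1 * (K'.+1 * K'.+1).
  by rewrite leq_mul2l leq_mul.
have h3 : n * (60 * K.+1) <= n * (60 * K'.+1) by rewrite !leq_mul2l /= ltnS h orbT.
lia.
Qed.

Lemma combine_run M1 M2 n x t1 t2 toks1 rest1 toks2 rest2 :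
  tm_wf M1 -> tm_wf M2 ->
  c_state (tm_run M1 t1 x) = 1 -> c_state (tm_run M2 t2 x) = 1 ->
  let e1 := tm_output (tm_run M1 t1 x) in
  let e2 := tm_output (tm_run M2 t2 x) in
  let K := size e1 + size e2 in
  e1 = tokbits toks1 ++ rest1 -> all is_tok toks1 -> size rest1 < 3 ->
  e2 = tokbits toks2 ++ rest2 -> all is_tok toks2 -> size rest2 < 3 ->
  runs (combine M1 M2 n) (init x)
    (st15 [::] (tokbits (combined n K
         (odflt [:: 4; 7] (translate_inst K n [::] toks1 rest1))
         (odflt [:: 4; 7] (translate_inst K n [::] toks2 rest2))))
       [::] [::] [::] [::] [::] (nseq K true) [::] [::] [::] [::] [::] [::])
    (combine_cost n (fetch_cost M1 M2 t1 t2 (size x))).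
Proof.
move=> wf1 wf2 hh1 hh2 e1 e2 K E1 ht1 hr1 E2 ht2 hr2.
set g1 := odflt _ _; set g2 := odflt _ _.
have h1 := fetch_run wf1 wf2 hh1 hh2; set B := fetch_cost _ _ _ _ _ in h1 *.
rewrite -/e1 -/e2 -/K in h1.
(* Stack 8 was filled with K marks within B units of cost. *)
have hKB : K <= B.
  by case: h1 => t hB /(@exec_grow _ _ _ _ 8); rewrite /get /= size_nseq => /leq_trans; apply.
have h2 := @emit_dims_run K 0 n e1 [::] [::] [::] [::] [::] [::] [::] [::] [::] [::] (rev e2).
rewrite cats0 addn0 in h2; set o1 := rev (tokbits _) in h2.
have h2B : n * (20 * (K + n + 1)) <= n * (20 * (B + n + 1)).
  by rewrite !leq_mul2l !leq_add2r hKB /= orbT.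
have ho1 : size o1 + 12 <= stage1 n B.
  case: h2 => t hB /(@exec_grow _ _ _ _ 13); rewrite /get /= /stage1; lia.
have h3 : runs (append_translation n [:: 6; 5; 3; 2])
    (st15 e1 [::] [::] [::] [::] [::] [::] (nseq K true) [::] [::] [::] [::] o1 (rev e2))
    (st15 [::] [::] [::] [::] [::] [::] [::] (nseq K true) [::] [::] [::] [::]
      (rev (tokbits ([:: 6; 5; 3; 2] ++ g1)) ++ o1) (rev e2)) (stage_cost n B (stage1 n B)).
  rewrite E1; apply: runs_le.
    apply: (append_translation_run n (N := stage1 n B)) => //.
    - by rewrite -E1 /K; lia.
    - by rewrite /stage1; lia.
    - by rewrite size_rev /stage1; lia.
  by rewrite /stage_cost leq_mul2l leq_add2l leq_translate_cost // orbT.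
set o2 := _ ++ o1 in h3.
have ho2 : size o2 + 15 <= stage2 n B.
  case: h3 => t hB /(@exec_grow _ _ _ _ 13); rewrite /get /= /stage2; lia.
have h4 := @move_run 14 1 (st15 [::] [::] [::] [::] [::] [::] [::] (nseq K true)
   [::] [::] [::] [::] o2 (rev e2)) isT isT isT.
rewrite /= revK cats0 size_rev in h4.
have h5 : runs (append_translation n [:: 5; 4; 3; 2; 4])
    (st15 e2 [::] [::] [::] [::] [::] [::] (nseq K true) [::] [::] [::] [::] o2 [::])
    (st15 [::] [::] [::] [::] [::] [::] [::] (nseq K true) [::] [::] [::] [::]
      (rev (tokbits ([:: 5; 4; 3; 2; 4] ++ g2)) ++ o2) [::]) (stage_cost n B (stage2 n B)).
  rewrite E2; apply: runs_le.
    apply: (append_translation_run n (N := stage2 n B)) => //.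
    - by rewrite -E2 /K; lia.
    - by rewrite /stage2 /stage1; lia.
  by rewrite /stage_cost leq_mul2l leq_add2l leq_translate_cost // orbT.
set o3 := _ ++ o2 in h5.
have ho3 : size o3 <= stage2 n B + stage_cost n B (stage2 n B).
  case: h5 => t hB /(@exec_grow _ _ _ _ 13); rewrite /get /=; lia.
have h6 := @move_run 13 2 (st15 [::] [::] [::] [::] [::] [::] [::] (nseq K true)
   [::] [::] [::] [::] o3 [::]) isT isT isT.
rewrite /= cats0 in h6.
have -> : tokbits (combined n K g1 g2) = rev o3.
  by rewrite /o3 /o2 /o1 /combined !tokbits_cat !rev_cat !revK -!catA.
apply: (runs_seq h1 (runs_seq h2 (runs_seq h3 (runs_seq h4 (runs_seq h5 h6 (leqnn _))
  (leqnn _)) (leqnn _)) (leqnn _))).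
rewrite /combine_cost; move: (stage_cost _ _ _) (stage_cost _ _ _) ho3 => c1 c2.
by move: h2B hKB; rewrite {1}/stage1 /K; lia.
Qed.

(** * Insertion into an instance *)

(** The tokens before the separator are not checked to be digits: on an invalid instance any output
    is correct. *)
Fixpoint cutnum (t : seq nat) : option (seq nat * seq nat) :=
  match t with
  | [::] => None
  | x :: r => if x == 2 then Some ([:: 2], r)
              else omap (fun p => (x :: p.1, p.2)) (cutnum r)
  end.

Fixpoint cutnums (n : nat) (t : seq nat) : option (seq nat * seq nat) :=
  if n is n'.+1 then
    if cutnum t is Some (p, r) then
      omap (fun q => (p ++ q.1, q.2)) (cutnums n' r)
    else None
  else Some ([::], t).

Definition copytok (t : nat) : cmd :=
  Seq (emit 7 [:: t]) (if t == 2 then Skip else Push 6 true).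
Definition copynum : cmd :=
  Seq (Push 6 true) (While 6 Skip (readtok 2 copytok Skip)).
Fixpoint copynums (n : nat) : cmd :=
  if n is n'.+1 then Seq copynum (copynums n') else Skip.

Definition stc (y u f : seq bool) : store :=
  st15 [::] y [::] [::] [::] f u [::] [::] [::] [::] [::] [::] [::].

Lemma copynum_run toks rest u : all is_tok toks -> size rest < 3 ->
  runs copynum (stc (tokbits toks ++ rest) u [::])
   (if cutnum toks is Some (p, r) then stc (tokbits r ++ rest) (rev (tokbits p) ++ u) [::]
    else stc [::] (rev (tokbits toks) ++ u) [::])
   (10 * size toks + 10).
Proof.
move=> ht hr.
suff h : runs (While 6 Skip (readtok 2 copytok Skip))
   (stc (tokbits toks ++ rest) u [:: true])
   (if cutnum toks is Some (p, r) then stc (tokbits r ++ rest) (rev (tokbits p) ++ u) [::]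
    else stc [::] (rev (tokbits toks) ++ u) [::])
   (10 * size toks + 9).
  by apply: (@runs_seq _ _ _ _ _ 1 _ _ _ h); [apply: runs_push | lia].
elim: toks u ht => [|x toks IH] u.
  move=> _; apply: (@runs_while1 _ _ _ _ true [::] _ _ 3 1) => //; last exact: runs_while0.
  by apply: (@runs_readtok_bad _ _ _ _ _ 0) => //; apply: runs_skip.
move=> /andP[hx ht].
case: (eqVneq x 2) => [ex|nx].
  rewrite ex /=; apply: (@runs_while1 _ _ _ _ true [::]
    (stc (tokbits toks ++ rest) (rev (tokbits [:: 2]) ++ u) [::]) _ 6 1) => //; first last.
  - by lia.
  - exact: runs_while0.
  - by apply: (@runs_readtok _ _ _ _ 2 toks rest _ 3) => //; apply: runs_sem.
have h := IH (rev (tokbits [:: x]) ++ u) ht.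
have body : runs (readtok 2 copytok Skip) (stc (tokbits (x :: toks) ++ rest) u [::])
    (stc (tokbits toks ++ rest) (rev (tokbits [:: x]) ++ u) [:: true]) 7.
  apply: (@runs_readtok _ _ _ _ x toks rest _ 4) => //.
  by rewrite /copytok (negbTE nx); apply: runs_sem.
have -> : (if cutnum (x :: toks) is Some (p, r)
     then stc (tokbits r ++ rest) (rev (tokbits p) ++ u) [::]
     else stc [::] (rev (tokbits (x :: toks)) ++ u) [::]) =
   (if cutnum toks is Some (p, r)
     then stc (tokbits r ++ rest) (rev (tokbits p) ++ rev (tokbits [:: x]) ++ u) [::]
     else stc [::] (rev (tokbits toks) ++ rev (tokbits [:: x]) ++ u) [::]).
  have tbc q : tokbits (x :: q) = tokbits [:: x] ++ tokbits q by rewrite -tokbits_cat.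
  rewrite [cutnum _]/= (negbTE nx); case: (cutnum toks) => [[p r]|];
    by rewrite [omap _ _]/= tbc rev_cat -catA.
by apply: (@runs_while1 _ _ _ _ true [::] _ _ 7 (10 * size toks + 9));
  [by [] | exact: body | exact: h | rewrite /=; lia].
Qed.

Lemma cutnum_suffix t p r : cutnum t = Some (p, r) -> t = p ++ r.
Proof.
elim: t p => [|x t IH] p //=; case: eqP => [-> [<- <-] //|_].
by case: (cutnum t) IH => [[q r']|] // /(_ q) h [<- e]; rewrite /= h // e.
Qed.

(** The time bound holds for all inputs, but the output is determined only if the dimensions can be
    cut off; otherwise the copying goes on with an exhausted input. *)
Lemma copynums_run n toks rest u : all is_tok toks -> size rest < 3 ->
  exists p r rest', [/\ runs (copynums n) (stc (tokbits toks ++ rest) u [::])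
     (stc (tokbits r ++ rest') (rev (tokbits p) ++ u) [::]) (n * (10 * size toks + 10)) &
   forall q, cutnums n toks = Some q -> [/\ p = q.1, r = q.2 & rest' = rest]].
Proof.
elim: n toks rest u => [|n IH] toks rest u ht hr.
  by exists [::], toks, rest; split; [apply: runs_skip | move=> q [<-]].
have := copynum_run u ht hr; rewrite /=.
case E: (cutnum toks) => [[p r]|] h1.
  have e := cutnum_suffix E.
  have ht' : all is_tok r by move: ht; rewrite e all_cat => /andP[].
  have hs : size r <= size toks by rewrite e size_cat leq_addl.
  have [p' [r' [rest' [h2 h3]]]] := IH r rest (rev (tokbits p) ++ u) ht' hr.
  exists (p ++ p'), r', rest'; split.
    rewrite tokbits_cat rev_cat -catA.
    by apply: (runs_seq h1 h2); nia.
  by case: (cutnums n r) h3 => // q h3 _ [<-]; have [-> -> ->] := h3 _ erefl.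
have [p' [r' [rest' [h2 _]]]] := IH [::] [::] (rev (tokbits toks) ++ u) isT isT.
exists (toks ++ p'), r', rest'; split => //.
rewrite tokbits_cat rev_cat -catA.
by apply: (runs_seq h1 h2); rewrite /=; nia.
Qed.

(** In prefix notation a connective with a fixed first argument is added by placing tokens between
    the dimensions and the formula. *)
Definition insert (M : TM) (n : nat) (w : seq nat) : cmd :=
  Seq (sim M) (Seq (copynums n) (Seq (emit 7 w) (move 7 2))).

Definition insert_cost (M : TM) (n t m a : nat) : nat :=
  let B := (2 * tm_Q M + 100) * (a + t + 1) in
  3 * (B + n * (10 * B + 10) + 3 * m + 1).

Lemma insert_run M n w x t toks rest : tm_wf M -> c_state (tm_run M t x) = 1 ->
  tm_output (tm_run M t x) = tokbits toks ++ rest -> all is_tok toks -> size rest < 3 ->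
  exists p r rest', [/\ runs (insert M n w) (init x)
     (stc (tokbits (p ++ w ++ r) ++ rest') [::] [::]) (insert_cost M n t (size w) (size x)) &
   forall q, cutnums n toks = Some q -> [/\ p = q.1, r = q.2 & rest' = rest]].
Proof.
move=> wf hh eo ht hr.
have h1 := @sim_run M wf t x (nseq 7 [::]) hh.
rewrite eo in h1; set B := _ * _ in h1.
have hB : 3 * size toks <= B.
  case: h1 => t' hB /(@exec_grow _ _ _ _ 2); rewrite /get /= size_cat size_tokbits; lia.
have [p [r [rest' [h2 h3]]]] := copynums_run n [::] ht hr.
exists p, r, rest'; split => //; rewrite cats0 in h2.
have h4 := @runs_emit 7 w (stc (tokbits r ++ rest') (rev (tokbits p)) [::]) isT.
have h5 := @move_run 7 2 (stc (tokbits r ++ rest') (rev (tokbits w) ++ rev (tokbits p)) [::]) isT isT isT.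
have hp : size (tokbits p) <= B + n * (10 * size toks + 10).
  case: h2 => t' hB' /(@exec_grow _ _ _ _ 7); rewrite /get /= size_rev; lia.
rewrite /= rev_cat !revK in h5.
rewrite !tokbits_cat -!catA; rewrite -catA in h5.
apply: (runs_seq h1 (runs_seq h2 (runs_seq h4 h5 (leqnn _)) (leqnn _))).
rewrite /insert_cost -/B size_cat !size_rev size_tokbits.
have : n * (10 * size toks + 10) <= n * (10 * B + 10) by rewrite leq_mul2l; lia.
lia.
Qed.

(** * Correctness of the translation *)

Lemma parse_form_fuel f f' t x : parse_form f t = Some x -> f <= f' -> parse_form f' t = Some x.
Proof.
elim: f f' t x => [|f IH] [|f'] //= t x h hf.
case: t h => [|[|[|[|[|[|[|[|a]]]]]]] t] //.
- case E: (parse_form f t) => [[F r]|//]; by rewrite (IH f' _ _ E).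
- case E: (parse_form f t) => [[F r]|//]; rewrite (IH f' _ _ E) //.
  case E2: (parse_form f r) => [[F2 r2]|//]; by rewrite (IH f' _ _ E2).
- case E: (parse_form f t) => [[F r]|//]; rewrite (IH f' _ _ E) //.
  case E2: (parse_form f r) => [[F2 r2]|//]; by rewrite (IH f' _ _ E2).
Qed.

Lemma parse_num_cut acc t m r : parse_num acc t = Some (m, r) ->
  exists2 p, cutnum t = Some (p, r) & forall r', parse_num acc (p ++ r') = Some (m, r').
Proof.
elim: t acc => [|[|[|[|a]]] t IH] acc //=.
- by move=> /IH[p -> h]; exists (0 :: p).
- by move=> /IH[p -> h]; exists (1 :: p).
- by move=> [<- <-]; exists [:: 2].
Qed.

Lemma parse_nums_cut n t ds r : parse_nums n t = Some (ds, r) ->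
  exists2 p, cutnums n t = Some (p, r) & forall r', parse_nums n (p ++ r') = Some (ds, r').
Proof.
elim: n t ds r => [|n IH] t ds r /=; first by move=> [<- <-]; exists [::].
case E: (parse_num 0 t) => [[m r1]|//]; have [p -> hp] := parse_num_cut E.
case E1: (parse_nums n r1) => [[ds' r2]|//] [<- <-].
have [q -> hq] := IH _ _ _ E1.
by exists (p ++ q) => // r'; rewrite -catA hp hq.
Qed.

Lemma parse_numE acc t :
  parse_num (value acc) t = omap (fun q => (value q.1, q.2)) (read_number acc t).
Proof.
elim: t acc => [|[|[|[|a]]] t IH] acc //=.
  by rewrite -IH.
by rewrite -IH; congr parse_num; rewrite /= addnC.
Qed.

Lemma parse_num_digits acc v r :
  parse_num acc (digits (rev v) ++ 2 :: r) = Some (acc * 2 ^ size v + value v, r).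
Proof.
rewrite -[v in RHS]revK size_rev; elim: (rev v) acc => [|b u IH] acc /=.
  by rewrite expn0 muln1 addn0.
have vr a w : value (rcons w a) = value w + a * 2 ^ size w.
  by elim: w => [|x w IHw] /=; rewrite ?IHw ?expnS ?expn0; nia.
rewrite rev_cons vr size_rev expnS.
by case: b => /=; rewrite IH; congr (Some (_, _)); nia.
Qed.

(* Block i of the new instance starts at acc * 2^(K+1), where acc = 2^i - 1. *)
Fixpoint rename (K acc : nat) (ns : seq nat) (v : nat) : nat :=
  match ns with
  | m :: ns' => if v < m then (2 * acc + 1) * 2 ^ K + v
                else rename K (2 * acc + 1) ns' (v - m)
  | [::] => (2 * acc + 1) * 2 ^ K + v
  end.

(** Reading a digit 1 turns [acc] into [2 * acc + 1], which is the step of [rename] from one block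
    to the next; the K offset digits then multiply by [2 ^ K] and add the offset. *)
Lemma parse_var_digits K ds v acc r : size v = K -> all (fun m => size m == K) ds ->
  parse_num acc (var_digits ds v ++ r) = Some (rename K acc (map value ds) (value v), r).
Proof.
elim: ds v acc => [|m ds IH] v acc hv /=.
  by rewrite -catA cat1s parse_num_digits hv.
move=> /andP[/eqP hm hds]; have hs : size v = size m by rewrite hv hm.
rewrite fsub_lt //; case: ltnP => h /=.
  by rewrite -catA cat1s parse_num_digits hv.
by rewrite IH ?size_fsub // fsub_val.
Qed.

Lemma value_pad K v : size v <= K -> value (pad K v) = value v.
Proof.
elim: K v => [|K IH] [|b v] //= h.
  by rewrite IH.
by rewrite IH.
Qed.

Lemma has_value v : has id v = (0 < value v).
Proof. by elim: v => //= b v ->; case: b => //=; lia. Qed.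

Lemma read_dimsE K m t : size t <= K ->
  match parse_nums m t with
  | Some (ns, r) =>
      if all (fun m => 0 < m) ns then
        exists ds, [/\ read_dims K m t = Some (ds, r), map value ds = ns,
          all (fun m => size m == K) ds & size r <= size t]
      else read_dims K m t = None
  | None => read_dims K m t = None
  end.
Proof.
elim: m t => [|m IH] t ht /=; first by exists [::].
rewrite -[0]/(value [::]) parse_numE.
case E: (read_number [::] t) => [[v r]|] //=; have := read_number_size E; rewrite add0n => hs.
rewrite has_value value_pad; last by lia.
have hr : size r <= K by lia.
have := IH r hr; case: (parse_nums m r) => [[ns r']|] /=; last first.
  by move=> ->; case: ifP.
case: ifP => ha; rewrite ?andbT ?andbF; last by move=> ->; case: ifP.
move=> [ds [-> h1 h2 h3]]; case: (0 < value v) => //; exists (pad K v :: ds); split => //=.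
- by rewrite h1 value_pad //; lia.
- by rewrite size_pad eqxx.
- by lia.
Qed.

Fixpoint map_form (r : nat -> nat) (F : form) : form :=
  match F with
  | FVar i => FVar (r i)
  | FTrue => FTrue
  | FNot f => FNot (map_form r f)
  | FAnd f g => FAnd (map_form r f) (map_form r g)
  | FOr f g => FOr (map_form r f) (map_form r g)
  end.

Lemma evalf_map_form a b r F : (forall v, nth false a (r v) = nth false b v) ->
  evalf a (map_form r F) = evalf b F.
Proof.
by move=> h; elim: F => //= [f ->|f -> g ->|f -> g ->].
Qed.

Lemma translate_toks_fuel K ds f f' c t : size t <= f -> size t <= f' ->
  translate_toks K ds f c t = translate_toks K ds f' c t.
Proof.
elim: f f' c t => [|f IH] [|f'] [|c] [|x t] //= h h'.
case: x => [|[|[|[|[|[|[|[|x]]]]]]]] //; rewrite ?(IH f') //.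
case E: (read_number [::] t) => [[v r]|//]; have := read_number_size E; rewrite add0n => hs.
by rewrite (IH f') //; lia.
Qed.

Lemma var_digits_tok ds v : all is_tok (var_digits ds v).
Proof.
have hd w : all is_tok (digits w) by elim: w => //= b w ->; case: b.
elim: ds v => [|m ds IH] v /=; first by rewrite all_cat hd.
by case: ifP => _ /=; rewrite ?all_cat ?hd.
Qed.

(** Arbitrary trailing tokens and any sufficient fuel are allowed, so that encodings can be
    concatenated under a connective. *)
Definition encodes (g : seq nat) (F : form) : Prop :=
  all is_tok g /\
  forall r f, size g <= f -> parse_form f (g ++ r) = Some (F, r).

Lemma encodes_not g F : encodes g F -> encodes (4 :: g) (FNot F).
Proof. by move=> [h1 h2]; split=> // r [|f] //= hf; rewrite h2. Qed.

Lemma encodes_and g F g' F' : encodes g F -> encodes g' F' ->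
  encodes (5 :: g ++ g') (FAnd F F').
Proof.
move=> [h1 h2] [h1' h2']; split=> [|r [|f]] //=; first by rewrite all_cat h1.
by rewrite size_cat => hf; rewrite -catA h2 ?h2' //; lia.
Qed.

Lemma encodes_or g F g' F' : encodes g F -> encodes g' F' ->
  encodes (6 :: g ++ g') (FOr F F').
Proof.
move=> [h1 h2] [h1' h2']; split=> [|r [|f]] //=; first by rewrite all_cat h1.
by rewrite size_cat => hf; rewrite -catA h2 ?h2' //; lia.
Qed.

Lemma encodes_true : encodes [:: 7] FTrue.
Proof. by split=> // r [|f]. Qed.

Lemma encodes_var0 : encodes [:: 3; 2] (FVar 0).
Proof. by split=> // r [|f]. Qed.

(** The counter agrees with recursive descent: where [parse_form] reads one formula, the scan lowers
    its count by one and goes on with the same remaining tokens. *)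
Lemma translate_toksP K ds fuel t :
  all (fun m => size m == K) ds -> size t <= K -> size t <= fuel ->
  match parse_form fuel t with
  | Some (F, r) => size r < size t /\
      exists2 g, encodes g (map_form (rename K 0 (map value ds)) F) &
      forall c, translate_toks K ds (size t) c.+1 t = omap (cat g) (translate_toks K ds (size r) c r)
  | None => forall c, translate_toks K ds (size t) c.+1 t = None
  end.
Proof.
move=> hds; elim: fuel t => [|fuel IH] t hK hf; first by case: t hf hK.
case: t hK hf => [|x t] //= hK hf.
have IHt := IH t (ltnW hK) hf.
case: x => [|[|[|[|[|[|[|[|x]]]]]]]] //.
- rewrite -[0]/(value [::]) parse_numE.
  case E: (read_number [::] t) => [[v r]|] //=; have := read_number_size E; rewrite add0n => hs.
  split; first by lia.
  exists (3 :: var_digits ds (pad K v)).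
    split=> [|r' [|f]] //=; first exact: var_digits_tok.
    by move=> _; rewrite (parse_var_digits _ _ (size_pad _ _)) // value_pad //; lia.
  by move=> c; rewrite (@translate_toks_fuel _ _ (size t) (size r)) //; lia.
- case: (parse_form fuel t) IHt => [[F r]|] /=; last first.
    by move=> h c; rewrite h.
  move=> [hs [g hg h]]; split; first by lia.
  exists (4 :: g); first exact: encodes_not.
  by move=> c; rewrite h; case: (translate_toks _ _ _ _ _).
- case: (parse_form fuel t) IHt => [[F r]|] /=; last by move=> h c; rewrite h.
  move=> [hs [g hg h]].
  have := IH r; case: (parse_form fuel r) => [[F' r']|] /= IHr; last first.
    by move=> c; rewrite h IHr //; lia.
  have [||hs' [g' hg' h']] := IHr; try lia.
  split; first by lia.
  exists (5 :: g ++ g'); first exact: encodes_and.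
  by move=> c; rewrite h h'; case: (translate_toks _ _ _ _ _) => //= u; rewrite catA.
- case: (parse_form fuel t) IHt => [[F r]|] /=; last by move=> h c; rewrite h.
  move=> [hs [g hg h]].
  have := IH r; case: (parse_form fuel r) => [[F' r']|] /= IHr; last first.
    by move=> c; rewrite h IHr //; lia.
  have [||hs' [g' hg' h']] := IHr; try lia.
  split; first by lia.
  exists (6 :: g ++ g'); first exact: encodes_or.
  by move=> c; rewrite h h'; case: (translate_toks _ _ _ _ _) => //= u; rewrite catA.
- split=> //; exists [:: 7]; first exact: encodes_true.
  by move=> c; case: (translate_toks _ _ _ _ _).
Qed.

Lemma parse_nums_size n t ns r : parse_nums n t = Some (ns, r) -> size ns = n.
Proof.
elim: n t ns r => [|n IH] t ns r /=; first by move=> [<-].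
case: (parse_num 0 t) => [[m r1]|//]; case E: (parse_nums n r1) => [[ds r2]|//] [<- _] /=.
by rewrite (IH _ _ _ E).
Qed.

Definition good_dims (K n : nat) (ns : seq nat) : Prop :=
  [/\ size ns = n, all (fun m => 0 < m) ns & all (fun m => m <= 2 ^ K) ns].

(** An invalid instance fits the same pattern: its formula has no variables, so renaming leaves it
    as the tokens [4 7], and its dimensions 1 are at most [2 ^ K]. *)
Lemma translate_instP K n toks rest :
  all is_tok toks -> size rest < 3 -> size toks <= K ->
  chunks (tokbits toks ++ rest) = (if rest is [::] then Some toks else None) ->
  let: (ns, F) := decode n (tokbits toks ++ rest) in
  good_dims K n ns /\
  encodes (odflt [:: 4; 7] (translate_inst K n [::] toks rest)) (map_form (rename K 0 ns) F).
Proof.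
move=> ht hr hK hc.
have dflt : let: (ns, F) := default_inst n in
    good_dims K n ns /\ encodes [:: 4; 7] (map_form (rename K 0 ns) F).
  split; last exact: encodes_not encodes_true.
  split; first by rewrite size_nseq.
    by rewrite all_nseq orbT.
  by rewrite all_nseq expn_gt0 orbT.
rewrite /decode hc /translate_inst.
case: rest hr hc => [|a rest] hr hc; last first.
  by case: (read_dims K n toks) => [[ds r]|].
have := read_dimsE n hK; case E: (parse_nums n toks) => [[ns r]|]; last by move=> ->.
case: ifP => hpos; last first.
  by move=> ->; case: (parse_form _ _) => [[F [|x u]]|].
move=> [ds [-> e hds hsz]] /=.
have := translate_toksP hds (leq_trans hsz hK) (leqnn (size r)).
case: (parse_form _ _) => [[F u]|]; last by move=> ->.
move=> [hu [g hg h]]; rewrite h; case: u hu h => [|x u] hu h /=; last by [].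
rewrite e in hg; rewrite cats0; split => //; split=> //.
- exact: parse_nums_size E.
- apply/allP => m; rewrite -e => /mapP[w hw ->].
  by have := value_lt w; rewrite (eqP (allP hds w hw)) => /ltnW.
Qed.

(** * Semantics *)

Fixpoint new_dims (K i m : nat) : seq nat :=
  if m is m'.+1 then 2 ^ (i.+1 + K) :: new_dims K i.+1 m' else [::].

Lemma new_dims_gt0 K i m : all (fun m => 0 < m) (new_dims K i m).
Proof. by elim: m i => //= m IH i; rewrite expn_gt0 IH. Qed.

Lemma parse_num_zeros acc k r :
  parse_num acc (nseq k 0 ++ 2 :: r) = Some (acc * 2 ^ k, r).
Proof.
elim: k acc => [|k IH] acc /=; first by rewrite expn0 muln1.
by rewrite IH expnS; congr (Some (_, _)); lia.
Qed.

Lemma parse_dims_toks K i m r :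
  parse_nums m (dims_toks K i m ++ r) = Some (new_dims K i m, r).
Proof.
elim: m i => // m IH i.
have -> : dims_toks K i m.+1 ++ r =
    1 :: (nseq (i.+1 + K) 0 ++ 2 :: (dims_toks K i.+1 m ++ r)) by rewrite /= -!catA.
have := parse_num_zeros 1 (i.+1 + K) (dims_toks K i.+1 m ++ r).
move: (nseq _ _) => z hz.
by rewrite [parse_nums _ _]/= muln0 add0n hz IH mul1n.
Qed.

Lemma dims_toks_tok K i m : all is_tok (dims_toks K i m).
Proof.
by elim: m i => //= m IH i; rewrite !all_cat all_nseq IH /= orbT.
Qed.

(* The part of a new block [X] that holds a block of the original instance. *)
Definition extract (K m : nat) (X : seq bool) : seq bool :=
  mkseq (fun o => nth false X (2 ^ K + o)) m.

Fixpoint extract_all (K : nat) (ns : seq nat) (Xs : seq (seq bool)) : seq bool :=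
  match ns, Xs with
  | m :: ns', X :: Xs' => extract K m X ++ extract_all K ns' Xs'
  | _, _ => [::]
  end.

(** With [acc = 2 ^ i - 1], the earlier blocks fill [acc * 2 ^ K.+1] positions and this block has
    [acc.+1 * 2 ^ K.+1]; subtracting the start of the block leaves position [2 ^ K + v]. Past the
    last block both sides read the default. *)
Lemma nth_rename K ns Xs i acc v :
  acc.+1 = 2 ^ i -> all (fun m => m <= 2 ^ K) ns ->
  map size Xs = new_dims K i (size ns) ->
  acc * 2 ^ K.+1 <= rename K acc ns v /\
  nth false (flatten Xs) (rename K acc ns v - acc * 2 ^ K.+1) = nth false (extract_all K ns Xs) v.
Proof.
elim: ns Xs i acc v => [|m ns IH] [|X Xs] i acc v //= hi.
  by move=> _ _; rewrite !nth_nil expnS; split=> //; nia.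
move=> /andP[hm hns] [hX hXs].
have hi' : (2 * acc + 1).+1 = 2 ^ i.+1 by rewrite expnS; lia.
have hsX : size X = acc.+1 * 2 ^ K.+1 by rewrite hX hi -expnD; congr (2 ^ _); lia.
have := IH Xs i.+1 (2 * acc + 1) (v - m) hi' hns hXs.
rewrite !nth_cat size_mkseq hsX; case: ltnP => hv.
  move=> _; split; first by rewrite expnS; nia.
  have -> : (2 * acc + 1) * 2 ^ K + v - acc * 2 ^ K.+1 = 2 ^ K + v.
    by rewrite expnS; nia.
  rewrite nth_mkseq // ifT //.
  have : 2 ^ K.+1 <= acc.+1 * 2 ^ K.+1 by rewrite leq_pmull.
  by rewrite {1}expnS; lia.
move=> [h1 h2].
have e : (2 * acc + 1) * 2 ^ K.+1 = acc * 2 ^ K.+1 + acc.+1 * 2 ^ K.+1 by nia.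
split; first by lia.
rewrite ifF; last by lia.
by rewrite -h2; congr nth; lia.
Qed.

Lemma qsat_ext F G ex ds pre :
  (forall u, evalf (pre ++ u) F = evalf (pre ++ u) G) -> qsat F ex ds pre = qsat G ex ds pre.
Proof.
elim: ds ex pre => [|m ds IH] ex pre h /=; first by have := h [::]; rewrite cats0.
have h' (x : m.-tuple bool) : qsat F (~~ ex) ds (pre ++ x) = qsat G (~~ ex) ds (pre ++ x).
  by apply: IH => u; rewrite -catA.
by case: ex h h' => h h'; [apply: eq_existsb | apply: eq_forallb] => x; rewrite h'.
Qed.

Lemma qsat_const F c ex ds pre : (forall u, evalf (pre ++ u) F = c) -> qsat F ex ds pre = c.
Proof.
elim: ds ex pre => [|m ds IH] ex pre h /=; first by have := h [::]; rewrite cats0.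
have h' (x : m.-tuple bool) : qsat F (~~ ex) ds (pre ++ x) = c.
  by apply: IH => u; rewrite -catA.
have x0 : m.-tuple bool by exact: [tuple of nseq m false].
clear IH h; case: ex h' => h'; case: c h' => h'.
- by apply/existsP; exists x0; rewrite h'.
- by apply/existsP => -[x]; rewrite h'.
- by apply/forallP => x; rewrite h'.
- by apply/negbTE/forallPn; exists x0; rewrite h'.
Qed.

Lemma qsat_not F ex ds pre : qsat (FNot F) ex ds pre = ~~ qsat F (~~ ex) ds pre.
Proof.
elim: ds ex pre => [|m ds IH] [] pre //=.
  rewrite negb_forall; apply: eq_existsb => x; exact: IH.
rewrite negb_exists; apply: eq_forallb => x; exact: IH.
Qed.

(** A right inverse of [extract] with prescribed selector bit. The selector and the [2 ^ K - 1]
    zeros after it make [x] start at position [2 ^ K]. *)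
Definition block (K m : nat) (b : bool) (x : seq bool) : seq bool :=
  b :: nseq (2 ^ K).-1 false ++ x ++ nseq (m - 2 ^ K - size x) false.

Lemma size_block K m b x : 2 ^ K + size x <= m -> size (block K m b x) = m.
Proof.
have : 0 < 2 ^ K by rewrite expn_gt0.
by rewrite /= !size_cat !size_nseq; lia.
Qed.

Lemma extract_block K m b x : extract K (size x) (block K m b x) = x.
Proof.
apply: (@eq_from_nth _ false) => [|o]; rewrite size_mkseq // => ho.
rewrite nth_mkseq // /block; have : 0 < 2 ^ K by rewrite expn_gt0.
case: (2 ^ K) => // N _; rewrite addSn /= nth_cat size_nseq.
by rewrite ltnNge leq_addr /= addKn nth_cat ho.
Qed.

Lemma size_extract K m X : size (extract K m X) == m.
Proof. by rewrite size_mkseq. Qed.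

(** [extract] is onto, by [block], so quantifying over the larger block amounts to quantifying over
    the part that matters. *)
Lemma existsb_extract K m n (p q : seq bool -> bool) : 2 ^ K + n <= m ->
  (forall X, size X = m -> p X = q (extract K n X)) ->
  [exists X : m.-tuple bool, p X] = [exists x : n.-tuple bool, q x].
Proof.
move=> hm h; apply/existsP/existsP => [[X]|[x]].
  by rewrite h ?size_tuple // => hq; exists (Tuple (size_extract K n X)).
move=> hq; have hs : size (block K m false x) == m by rewrite size_block ?size_tuple.
by exists (Tuple hs); rewrite h ?size_tuple //= -{1}(size_tuple x) extract_block.
Qed.

Lemma forallb_extract K m n (p q : seq bool -> bool) : 2 ^ K + n <= m ->
  (forall X, size X = m -> p X = q (extract K n X)) ->
  [forall X : m.-tuple bool, p X] = [forall x : n.-tuple bool, q x].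
Proof.
move=> hm h; apply: negb_inj; rewrite !negb_forall.
by apply: (@existsb_extract K _ _ (fun x => ~~ p x) (fun x => ~~ q x)) => // X /h ->.
Qed.

Lemma qsat_blocks K F G i ns preN preO ex :
  all (fun m => m <= 2 ^ K) ns ->
  (forall Xs, map size Xs = new_dims K i (size ns) ->
     evalf (preN ++ flatten Xs) G = evalf (preO ++ extract_all K ns Xs) F) ->
  qsat G ex (new_dims K i (size ns)) preN = qsat F ex ns preO.
Proof.
elim: ns i preN preO ex => [|m ns IH] i preN preO ex /=.
  by move=> _ h; have := h [::] erefl; rewrite /= !cats0.
move=> /andP[hm hns] h.
have hb : 2 ^ K + m <= 2 ^ (i.+1 + K).
  have : 2 ^ K <= 2 ^ (i + K) by rewrite leq_exp2l // leq_addl.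
  by rewrite addSn expnS; lia.
have h' X : size X = 2 ^ (i.+1 + K) ->
    qsat G (~~ ex) (new_dims K i.+1 (size ns)) (preN ++ X) =
    qsat F (~~ ex) ns (preO ++ extract K m X).
  move=> hX; apply: IH => // Xs hXs.
  by have := h (X :: Xs); rewrite /= hX hXs -!catA => ->.
pose p X := qsat G (~~ ex) (new_dims K i.+1 (size ns)) (preN ++ X).
pose q x := qsat F (~~ ex) ns (preO ++ x).
have := forallb_extract hb (p := p) (q := q) h'; have := existsb_extract hb (p := p) (q := q) h'.
by rewrite /p /q; case: (ex).
Qed.

Definition mixed (F1 F2 : form) : form :=
  FOr (FAnd (FVar 0) F1) (FAnd (FNot (FVar 0)) (FNot F2)).

Section Mixed.
Variables (K m1 m2 : nat) (ns1 ns2 : seq nat) (F1 F2 : form).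
Hypothesis hs : size ns1 = size ns2.
Hypothesis h1 : all (fun m => m <= 2 ^ K) (m1 :: ns1).
Hypothesis h2 : all (fun m => m <= 2 ^ K) (m2 :: ns2).
Let G := mixed (map_form (rename K 0 (m1 :: ns1)) F1) (map_form (rename K 0 (m2 :: ns2)) F2).

Lemma evalf_rename ns F Xs : all (fun m => m <= 2 ^ K) ns ->
  map size Xs = new_dims K 0 (size ns) ->
  evalf (flatten Xs) (map_form (rename K 0 ns) F) = evalf (extract_all K ns Xs) F.
Proof.
move=> hn hX; apply: evalf_map_form => v.
by have [_] := @nth_rename K ns Xs 0 0 v erefl hn hX; rewrite subn0.
Qed.

(** Once the first block is fixed, the selector is a constant and one disjunct disappears. Moving
    the negation of [F2] outwards dualizes the remaining quantifiers. *)
Lemma mixed_block X : size X = 2 ^ K.+1 ->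
  qsat G false (new_dims K 1 (size ns1)) X =
  if head false X then qsat F1 false ns1 (extract K m1 X) else ~~ qsat F2 true ns2 (extract K m2 X).
Proof.
move=> hX.
have aux m ns F ex : all (fun m => m <= 2 ^ K) (m :: ns) -> size ns1 = size ns ->
    qsat (map_form (rename K 0 (m :: ns)) F) ex (new_dims K 1 (size ns1)) X =
    qsat F ex ns (extract K m X).
  move=> hn es; rewrite es; apply: qsat_blocks => [|Xs hXs]; first by case/andP: hn.
  by have := @evalf_rename (m :: ns) F (X :: Xs) hn; rewrite /= hX add1n hXs => ->.
have hX0 u : nth false (X ++ u) 0 = head false X.
  by move: hX; case: (X) => [/esym /eqP|//]; rewrite expn_eq0.
case E: (head false X).
  rewrite -(aux _ _ _ _ h1) //; apply: qsat_ext => u; rewrite /= hX0 E /=.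
  by rewrite orbF.
rewrite -(aux _ _ _ _ h2) // -[true]/(~~ false) -qsat_not; apply: qsat_ext => u.
by rewrite /= hX0 E.
Qed.
End Mixed.

(** * The reductions *)

Lemma decode_valid n t ds r F :
  all is_tok t -> parse_nums n t = Some (ds, r) ->
  parse_form (size r) r = Some (F, [::]) -> all (fun m => 0 < m) ds ->
  decode n (tokbits t) = (ds, F).
Proof. by move=> ht h1 h2 h3; rewrite /decode chunks_tokbits // h1 h2 h3. Qed.

Lemma decode_combined n K g1 g2 F1 F2 : encodes g1 F1 -> encodes g2 F2 ->
  decode n (tokbits (combined n K g1 g2)) = (new_dims K 0 n, mixed F1 F2).
Proof.
move=> hg1 hg2.
have [hm hp] : encodes (6 :: (5 :: [:: 3; 2] ++ g1) ++ (5 :: (4 :: [:: 3; 2]) ++ (4 :: g2)))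
    (mixed F1 F2).
  apply: encodes_or; first exact: encodes_and encodes_var0 hg1.
  exact: encodes_and (encodes_not encodes_var0) (encodes_not hg2).
apply: (@decode_valid _ _ _ _ _ _ (parse_dims_toks _ _ _ _)).
- by rewrite all_cat dims_toks_tok.
- by rewrite -[X in parse_form _ X]cats0; apply: hp.
- exact: new_dims_gt0.
Qed.

Lemma VAL_combined n K s s1 s2 (phi : {set bool}) ns1 ns2 F1 F2 :
  0 < n -> decode n (tostr s1) = (ns1, F1) -> decode n (tostr s2) = (ns2, F2) ->
  good_dims K n ns1 -> good_dims K n ns2 ->
  decode n (tostr s) = (new_dims K 0 n, mixed (map_form (rename K 0 ns1) F1) (map_form (rename K 0 ns2) F2)) ->
  SATn n s1 \subset phi -> coSATn n s2 \subset phi -> VALn n s \subset phi.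
Proof.
rewrite /SATn /coSATn /VALn => hn -> -> [hs1 _ hb1] [hs2 _ hb2] ->.
case: n hn hs1 hs2 => // n _.
case: ns1 hb1 => // m1 ns1 hb1 [hs1]; case: ns2 hb2 => // m2 ns2 hb2 [hs2].
rewrite !sub1set => hsat hco.
set G := mixed _ _.
have hblk X : size X = 2 ^ K.+1 -> qsat G false (new_dims K 1 n) X =
   if head false X then qsat F1 false ns1 (extract K m1 X) else ~~ qsat F2 true ns2 (extract K m2 X).
  by move=> hX; rewrite -hs1; apply: mixed_block => //; rewrite hs1 hs2.
have hm m ns : all (fun m => m <= 2 ^ K) (m :: ns) -> 2 ^ K + m <= 2 ^ K.+1.
  by move=> /andP[h _]; rewrite expnS; lia.
(* Used when the combined instance has no witness: any assignment to a first block of an old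
   instance lifts to a new block with either selector. *)
have build b m ns (x : m.-tuple bool) : all (fun m => m <= 2 ^ K) (m :: ns) ->
    exists X : (2 ^ K.+1).-tuple bool, head false X = b /\ extract K m X = x.
  move=> hn; have hX : size (block K (2 ^ K.+1) b x) == 2 ^ K.+1.
    by rewrite size_block // size_tuple (hm _ _ hn).
  by exists (Tuple hX); split=> //; rewrite -{1}(size_tuple x) extract_block.
rewrite [new_dims K 0 n.+1]/= add1n; case: ifP => hG; apply/subsetP => b; rewrite inE.
- move=> /existsP[X /andP[/eqP hX]]; rewrite hblk ?size_tuple // hX.
  case: b hX => hX hq.
    suff e : qsat F1 true (m1 :: ns1) [::] by rewrite e in hsat.
    by apply/existsP; exists (Tuple (size_extract K m1 X)).
  suff e : qsat F2 false (m2 :: ns2) [::] = false by rewrite e in hco.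
  by apply/negbTE/forallPn; exists (Tuple (size_extract K m2 X)).
- move=> _; move/negbT: hG; rewrite /= => /existsPn hG; case: b.
    suff e : qsat F2 false (m2 :: ns2) [::] by rewrite e in hco.
    apply/forallP => x; have [X [h1 h2]] := build false m2 ns2 x hb2.
    by have := hG X; rewrite hblk ?size_tuple // h1 h2 negbK.
  suff e : qsat F1 true (m1 :: ns1) [::] = false by rewrite e in hsat.
  apply/negbTE/existsPn => x; have [X [h1 h2]] := build true m1 ns1 x hb1.
  by have := hG X; rewrite hblk ?size_tuple // h1 h2.
Qed.

(** The constant-0 instance has no witness, so an invalid encoding imposes no condition. *)
Lemma VAL_cases n s : 0 < n -> VALn n s = setT \/
  exists t r ds F, [/\ chunks (tostr s) = Some t, parse_nums n t = Some (ds, r),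
    parse_form (size r) r = Some (F, [::]), all (fun m => 0 < m) ds &
    decode n (tostr s) = (ds, F)].
Proof.
move=> hn; rewrite /VALn /decode.
have dflt : let: (ds, F) := default_inst n in
  match ds with
  | m :: ds' =>
      if qsat F true ds [::] then
        [set b : bool | [exists x : m.-tuple bool, (head false x == b) && qsat F false ds' x]]
      else setT
  | [::] => setT
  end = setT.
  case: n hn => // n _.
  have : qsat (FNot FTrue) true (nseq n.+1 1) [::] = false by apply: qsat_const.
  by rewrite /= => ->.
case: chunks => [t|]; last by left.
case E1: parse_nums => [[ds r]|]; last by left.
case E2: parse_form => [[F [|x u]]|]; [|by left|by left].
case: ifP => hp; last by left.
by right; exists t, r, ds, F.
Qed.

Lemma qsat_var0_and F ex ds (b : bool) pre :
  qsat (FAnd (FVar 0) F) ex ds (b :: pre) = b && qsat F ex ds (b :: pre).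
Proof. by case: b; [apply: qsat_ext | apply: qsat_const]. Qed.

Lemma qsat_nvar0_and F ex ds (b : bool) pre :
  qsat (FAnd (FNot (FVar 0)) F) ex ds (b :: pre) = ~~ b && qsat F ex ds (b :: pre).
Proof. by case: b; [apply: qsat_const | apply: qsat_ext]. Qed.

(** Answer 1 exhibits a witness starting with 1. With answer 0, either there is no witness and both
    values are allowed, or every witness starts with 0. *)
Lemma SAT_sub_VAL n s s' ds F : 0 < n -> all (fun m => 0 < m) ds -> size ds = n ->
  decode n (tostr s) = (ds, F) -> decode n (tostr s') = (ds, FAnd (FVar 0) F) ->
  SATn n s' \subset VALn n s.
Proof.
rewrite /SATn /VALn => hn hp hs -> ->; rewrite sub1set.
case: ds hp hs => [|m ds] /=; first by move=> _ e; rewrite -e in hn.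
move=> /andP[hm _] _.
(* A positive dimension makes variable 0 the first bit of [x]. *)
have e (x : m.-tuple bool) : qsat (FAnd (FVar 0) F) false ds x =
    (head false x == true) && qsat F false ds x.
  have := size_tuple x; move: (tval x) => {x} [|b u] hx; first by rewrite -hx in hm.
  by rewrite qsat_var0_and; case: (b).
rewrite (eq_existsb e).
case: ifP => [|_]; last by rewrite inE.
move=> /existsP[x hx]; rewrite inE; case: existsP => [/existsP //|h].
apply/existsP; exists x; rewrite hx andbT; apply/eqP/negbTE/negP => h0.
by apply: h; exists x; rewrite h0 hx.
Qed.

(** By [qsat_not] the answer is 0 exactly if some witness starts with 0; the argument is then dual
    to the one for [SATn]. *)
Lemma coSAT_sub_VAL n s s' ds F : 0 < n -> all (fun m => 0 < m) ds -> size ds = n ->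
  decode n (tostr s) = (ds, F) ->
  decode n (tostr s') = (ds, FNot (FAnd (FNot (FVar 0)) F)) ->
  coSATn n s' \subset VALn n s.
Proof.
rewrite /coSATn /VALn => hn hp hs -> ->; rewrite sub1set qsat_not.
case: ds hp hs => [|m ds] /=; first by move=> _ e; rewrite -e in hn.
move=> /andP[hm _] _.
have e (x : m.-tuple bool) : qsat (FAnd (FNot (FVar 0)) F) false ds x =
    (head false x == false) && qsat F false ds x.
  have := size_tuple x; move: (tval x) => {x} [|b u] hx; first by rewrite -hx in hm.
  by rewrite qsat_nvar0_and; case: (b).
rewrite (eq_existsb e).
case: ifP => [|_]; last by rewrite inE.
move=> /existsP[x hx]; rewrite inE; case: existsP => [/existsP //|h].
apply/existsP; exists x; rewrite hx andbT; apply/eqP; case h0: (head false x) => //.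
by case: h; exists x; rewrite h0 hx.
Qed.

Lemma cutnums_suffix n t p r : cutnums n t = Some (p, r) -> t = p ++ r.
Proof.
elim: n t p => [|n IH] t p /=; first by move=> [<- <-].
case E: (cutnum t) => [[q u]|//]; rewrite (cutnum_suffix E).
case E2: (cutnums n u) => [[q' u']|//] [<- eu].
by rewrite (IH u q') ?E2 ?eu // catA.
Qed.

Lemma halted_at M k c x (mu : str -> str) :
  (forall x : str, exists t, t <= c * size (tostr x) ^ k + c /\
     c_state (tm_run M t (tostr x)) = 1 /\
     tm_output (tm_run M t (tostr x)) = tostr (mu x)) ->
  c_state (tm_run M (c * size (tostr x) ^ k + c) (tostr x)) = 1 /\
  tm_output (tm_run M (c * size (tostr x) ^ k + c) (tostr x)) = tostr (mu x).
Proof. by move=> /(_ x)[t [h1 [h2 h3]]]; rewrite (tm_run_halted h2 h1). Qed.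

Ltac poly_tac :=
  lazymatch goal with
  | |- poly (fun x => addn (@?f x) (@?g x)) => apply: (@poly_add f g); poly_tac
  | |- poly (fun x => muln (@?f x) (@?g x)) => apply: (@poly_mul f g); poly_tac
  | |- poly (fun x => S (@?f x)) => apply: (@poly_succ f); poly_tac
  | |- poly (fun x => expn x _) => exact: poly_pow
  | |- poly (fun x => x) => exact: poly_id
  | |- poly (fun=> _) => exact: poly_const
  end.

Lemma insert_polytime n w mu : polytime mu -> w != [::] -> all is_tok w ->
  exists2 mu', polytime mu' & forall x t p r,
    chunks (tostr (mu x)) = Some t -> cutnums n t = Some (p, r) ->
    tostr (mu' x) = tokbits (p ++ w ++ r).
Proof.
move=> [M [wf [k [c hM]]]] w0 hw.
apply: (@realize (insert M n w)
  (fun a => insert_cost M n (c * a ^ k + c) (size w) a)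
  (fun x y => forall t p r, chunks (tostr (mu x)) = Some t -> cutnums n t = Some (p, r) ->
    tostr y = tokbits (p ++ w ++ r))).
  by rewrite /insert_cost; poly_tac.
move=> x; have [h1 h2] := halted_at x hM.
have [t [rest [e hr ht hc]]] := chunksE (tostr (mu x)).
have [p [r [rest' [h3 h4]]]] := insert_run n w wf h1 (etrans h2 e) ht hr.
(* Strings are nonempty, which the inserted tokens guarantee even on invalid instances. *)
have [y ey] : exists y, tokbits (p ++ w ++ r) ++ rest' = tostr y.
  case E: (tokbits _ ++ _) => [|b y]; last by exists (b, y).
  have := congr1 size E; rewrite size_cat size_tokbits !size_cat.
  by case: (w) w0 => //= *; lia.
exists y; eexists; split; [exact: h3 | by [] | exact: ey |] => t' p' r'.
rewrite hc => e1 e2; case: rest hr e hc h4 h2 h3 e1 => // hr e hc h4 h2 h3 [e1].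
rewrite -e1 in e2; have [ep er er'] := h4 _ e2.
by rewrite -ey ep er er' cats0.
Qed.

Theorem theorem9 (n : nat) (hn : 1 <= n) (phi1 : str -> {set bool})
  (hphi1 : promise_problem phi1) :
  reduces phi1 (VALn n) <-> (reduces phi1 (SATn n) /\ reduces phi1 (coSATn n)).
Proof.
split=> [[mu [pmu hmu]]|[[mu1 [[M1 [wf1 [k1 [c1 hM1]]]] hmu1]]
                         [mu2 [[M2 [wf2 [k2 [c2 hM2]]]] hmu2]]]].
(* Common to both targets: inserting the tokens [w] turns a formula F into [Q F]. *)
- have key w (Q : form -> form) (phi : str -> {set bool}) : w != [::] -> all is_tok w ->
      (forall r F, parse_form (size r) r = Some (F, [::]) ->
         parse_form (size (w ++ r)) (w ++ r) = Some (Q F, [::])) ->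
      (forall s s' ds F, all (fun m => 0 < m) ds -> size ds = n ->
         decode n (tostr s) = (ds, F) -> decode n (tostr s') = (ds, Q F) ->
         phi s' \subset VALn n s) -> reduces phi1 phi.
    move=> w0 hw hQ hphi.
    have [mu' pmu' hmu'] := insert_polytime n pmu w0 hw.
    exists mu'; split=> // x.
    have [e|[t [r [ds [F [h1 h2 h3 h4 h5]]]]]] := VAL_cases (mu x) hn.
      (* Here [phi1 x] contains both values, so the image of [x] is immaterial. *)
      by have := hmu x; rewrite e subTset => /eqP ->; apply: subsetT.
    apply: subset_trans (hmu x); apply: (hphi _ _ ds F) => //.
      exact: parse_nums_size h2.
    have [p h6 h7] := parse_nums_cut h2.
    rewrite (hmu' x t p r h1 h6).
    apply: (decode_valid _ (h7 _)) => //; last exact: hQ.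
    have [t' [rest [_ _ ht' hc]]] := chunksE (tostr (mu x)).
    have : all is_tok t by move: hc; rewrite h1; case: (rest) => // -[->].
    by rewrite (cutnums_suffix h6) !all_cat hw => /andP[-> ->].
  split.
  (* The tokens of AND VAR 0. *)
  + apply: (key [:: 5; 3; 2] (fun F => FAnd (FVar 0) F)) => //.
      move=> r F h.
      rewrite -[LHS]/(if parse_form (size r).+2 r is Some (G, u)
                      then Some (FAnd (FVar 0) G, u) else None).
      by rewrite (parse_form_fuel h) // leqW.
    by move=> s s' ds F h1 h2 h3 h4; apply: SAT_sub_VAL h3 h4.
  (* The tokens of NOT AND NOT VAR 0. *)
  + apply: (key [:: 4; 5; 4; 3; 2] (fun F => FNot (FAnd (FNot (FVar 0)) F))) => //.
      move=> r F h.
      rewrite -[LHS]/(if (if parse_form (size r).+3 r is Some (G, u)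
                          then Some (FAnd (FNot (FVar 0)) G, u) else None) is Some (G, u)
                      then Some (FNot G, u) else None).
      by rewrite (parse_form_fuel h) //; lia.
    by move=> s s' ds F h1 h2 h3 h4; apply: coSAT_sub_VAL h3 h4.
(* The relation given to [realize] is the very condition on a reduction, so it remains to bound the
   cost and to check the output for each [x]. *)
- have [|x|mu pmu hmu] := @realize (combine M1 M2 n)
    (fun a => combine_cost n (fetch_cost M1 M2 (c1 * a ^ k1 + c1) (c2 * a ^ k2 + c2) a))
    (fun x y => VALn n y \subset phi1 x); last by exists mu.
    by rewrite /combine_cost /stage2 /stage_cost /translate_cost /body_cost /stage1 /fetch_cost;
       poly_tac.
  have [h1 e1] := halted_at x hM1; have [h2 e2] := halted_at x hM2.
  have [t1 [r1 [d1 hr1 ht1 hc1]]] := chunksE (tostr (mu1 x)).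
  have [t2 [r2 [d2 hr2 ht2 hc2]]] := chunksE (tostr (mu2 x)).
  have := combine_run n wf1 wf2 h1 h2; rewrite e1 e2 => hrun.
  have {hrun} hrun := hrun t1 r1 t2 r2 d1 ht1 hr1 d2 ht2 hr2.
  set K := _ + _ in hrun.
  have hK1 : size t1 <= K by rewrite /K d1 size_cat size_tokbits; lia.
  have hK2 : size t2 <= K by rewrite /K d2 size_cat size_tokbits; lia.
  set g1 := odflt _ _ in hrun; set g2 := odflt _ _ in hrun.
  have hi1 := @translate_instP K n t1 r1 ht1 hr1 hK1.
  have hi2 := @translate_instP K n t2 r2 ht2 hr2 hK2.
  rewrite -d1 in hi1; rewrite -d2 in hi2.
  have {hi1} := hi1 hc1; have {hi2} := hi2 hc2.
  case E1: (decode n (tostr (mu1 x))) => [ns1 F1].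
  case E2: (decode n (tostr (mu2 x))) => [ns2 F2].
  move=> [hd2 he2] [hd1 he1].
  (* For positive n the output starts with the leading digit of the first dimension, so it is
     nonempty. *)
  have [y ey] : exists y, tokbits (combined n K g1 g2) = tostr y.
    by case: (n) hn => // m _; eexists (_, _); reflexivity.
  exists y; eexists; split; [exact: hrun | by [] | exact: ey |].
  apply: (@VAL_combined n K y (mu1 x) (mu2 x) (phi1 x) ns1 ns2 F1 F2) => //.
  by rewrite -ey; apply: decode_combined.
Qed.
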